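(* Let $Q$ be a finite quiver with vertex set $Q_0$. In the twisted formal power series ring $\mathbb{M}_{\mathbb L}[[Q_0]]$ we have the identity $$\left(\sum_{\mathbf{d}\in\mathbb{N}Q_0}\frac{[N_{\mathbf d}]}{[G_{\mathbf d}]}\,t^{\mathbf d}\right)\cdot\left(\sum_{\mathbf{d}\in\mathbb{N}Q_0}\frac{t^{\mathbf d}}{(\mathbb{L})_{\mathbf d}}\right)=1.$$
   Context: $\mathbb{N}$ includes $0$. Arrows of $Q$ are written $\alpha:i\to j$. The Euler form is $\langle\mathbf{d},\mathbf{e}\rangle=\sum_{i\in Q_0}d_ie_i-\sum_{\alpha:i\to j}d_ie_j$. For $\mathbf{d}\in\mathbb{N}Q_0$ fix complex vector spaces $V_i$ with $\dim V_i=d_i$; $R_{\mathbf d}=\bigoplus_{\alpha:i\to j}\mathrm{Hom}_{\mathbb C}(V_i,V_j)$, with the base change action of $G_{\mathbf d}=\prod_{i\in Q_0}\mathrm{GL}(V_i)$. The nullcone $N_{\mathbf d}\subset R_{\mathbf d}$ is the closed subvariety (with reduced structure) of those $V$ such that $0$ lies in the closure of $G_{\mathbf d}\cdot V$; equivalently, such that $V_{\alpha_1}\circ\cdots\circ V_{\alpha_s}$ is nilpotent for every oriented cycle $\alpha_1\cdots\alpha_s$ in $Q$; equivalently, such that $V$ has a filtration by subrepresentations whose subquotients are among the one-dimensional representations $S_i$ ($i\in Q_0$) concentrated at vertex $i$ with all arrows acting as zero. $K_0(\mathrm{Var}_{\mathbb C})$ is the Grothendieck ring of complex varieties, $[X]$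 the class of $X$, $\mathbb{L}=[\mathbb{A}^1]$, and $\mathbb{M}=K_0(\mathrm{Var}_{\mathbb C})[\mathbb{L}^{-1},(1-\mathbb{L}^i)^{-1}: i\ge 1]$. Put $(q)_n=(1-q)\cdots(1-q^n)$ and $(q)_{\mathbf d}=\prod_{i\in Q_0}(q)_{d_i}$. The ring $\mathbb{M}_{\mathbb L}[[Q_0]]$ is the twisted formal power series ring with topological $\mathbb{M}$-basis $t^{\mathbf d}$, $\mathbf{d}\in\mathbb{N}Q_0$, and multiplication $t^{\mathbf d}\cdot t^{\mathbf e}=\mathbb{L}^{-\langle\mathbf{d},\mathbf{e}\rangle}\,t^{\mathbf{d}+\mathbf{e}}$. *)

(* Defs.v *)
From HB Require Import structures.
From mathcomp Require Import all_boot all_order all_algebra.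
From mathcomp Require Import generic_quotient.
From mathcomp Require Import boolp classical_sets reals complex.

Set Implicit Arguments.
Unset Strict Implicit.
Unset Printing Implicit Defensive.

Import GRing.Theory.
Local Open Scope classical_set_scope.
Local Open Scope ring_scope.

(* Varieties over an algebraically closed field k are treated classically, as
   spaces with functions: a set of points, a topology on it, and for each open
   set U the k-algebra of regular functions on U.  Such a space is a variety
   (i.e. comes from a reduced separated scheme of finite type) when it is
   separated and has a finite cover by open subspaces isomorphic to Zariski
   closed subsets of affine spaces k^n.

   Points are elements of [seq k], the affine space k^n being the set of
   sequences of length n.  This only serves to keep the varieties in a small
   type, on which K_0 can be built; it loses no isomorphism class, since the
   points of a variety form a finite disjoint union of subsets of various k^n,
   and these can be given different n. *)

Section Spaces.
Variable k : closedFieldType.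
Notation pt := (seq k).

(* A regular function on U is a total function pt -> k of which only the
   values on U matter: this is part of [reg_local], which also says that
   regular functions restrict to and glue from open subsets. *)
Record space := Space {
  points :> pt -> Prop;
  opens : set (set pt);
  reg : set pt -> set (pt -> k);
  opens_sub : forall U, opens U -> U `<=` points;
  opensT : opens points;
  opensI : forall U V, opens U -> opens V -> opens (U `&` V);
  opens_bigcup : forall F : set (set pt),
    F `<=` opens -> opens (\bigcup_(U in F) U);
  reg_cst : forall U c, opens U -> reg U (fun=> c);
  regD : forall U f g, opens U -> reg U f -> reg U g ->
    reg U (fun x => f x + g x);
  regM : forall U f g, opens U -> reg U f -> reg U g ->
    reg U (fun x => f x * g x);
  reg_local : forall U f, opens U ->
    (forall x, U x -> exists V g, [/\ opens V, V x, reg V g &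
       forall y, U y -> V y -> f y = g y]) -> reg U f;
  opens_neq0 : forall U f, opens U -> reg U f ->
    opens [set x | U x /\ f x != 0];
  regV : forall U f, opens U -> reg U f ->
    reg [set x | U x /\ f x != 0] (fun x => (f x)^-1) }.

Definition morphism (X Y : space) (phi : pt -> pt) : Prop :=
  (forall x, X x -> Y (phi x)) /\
  forall U, opens Y U ->
    opens X (points X `&` phi @^-1` U) /\
    forall f, reg Y U f -> reg X (points X `&` phi @^-1` U) (f \o phi).

Definition isomorphic (X Y : space) : Prop :=
  exists phi psi, [/\ morphism X Y phi, morphism Y X psi,
    forall x, X x -> psi (phi x) = x & forall y, Y y -> phi (psi y) = y].

Definition closed_in (X : space) (W : set pt) : Prop := opens X (points X `\` W).

Definition closure_in (X : space) (W : set pt) : set pt :=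
  [set x | X x /\ forall U, opens X U -> U x -> exists y, W y /\ U y].

Lemma reg_restrict (X : space) U V f : opens X U -> opens X V -> V `<=` U ->
  reg X U f -> reg X V f.
Proof.
move=> oU oV VU rf; apply: reg_local => // x Vx.
by exists U, f; split=> //; apply: VU.
Qed.

Lemma reg_ext (X : space) U f g : opens X U -> (forall x, U x -> f x = g x) ->
  reg X U g -> reg X U f.
Proof.
by move=> oU fg rg; apply: reg_local => // x Ux; exists U, g; split=> // y; auto.
Qed.

Lemma opens_local (X : space) U :
  (forall x, U x -> exists V, [/\ opens X V, V x & V `<=` U]) -> opens X U.
Proof.
move=> H; have -> : U = \bigcup_(V in [set V | opens X V /\ V `<=` U]) V.
  apply/seteqP; split => [x /H[V [oV Vx VU]]|x [V [_ VU]] Vx]; last exact: VU.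
  by exists V.
by apply: opens_bigcup => V [].
Qed.

Section Sub.
Variables (X : space) (W : set pt).
Let P := points X `&` W.
Let O : set (set pt) := [set U | exists2 V, opens X V & U = V `&` W].
Let R (U : set pt) : set (pt -> k) := [set f | forall x, U x ->
  exists V g, [/\ opens X V, V x, reg X V g & forall y, U y -> V y -> f y = g y]].

Fact sub_opens_sub U : O U -> U `<=` P.
Proof.
by move=> [V oV ->] x [Vx Wx]; split => //; apply: (opens_sub oV).
Qed.

Fact sub_opensT : O P.
Proof. by exists (points X) => //; apply: opensT. Qed.

Fact sub_opensI U V : O U -> O V -> O (U `&` V).
Proof.
move=> [U' oU ->] [V' oV ->]; exists (U' `&` V'); first exact: opensI.
by rewrite setIACA setIid.
Qed.

Fact sub_opens_bigcup (F : set (set pt)) :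
  F `<=` O -> O (\bigcup_(U in F) U).
Proof.
move=> FO.
exists (\bigcup_(V in [set V | opens X V /\ V `&` W `<=` \bigcup_(U in F) U]) V).
  by apply: opens_bigcup => V [].
apply/seteqP; split => [x [U FU Ux]|x [[V [_ VF] Vx] Wx]]; last exact: VF.
have [V oV UE] := FO _ FU; move: Ux; rewrite UE => -[Vx Wx]; split=> //.
by exists V => //; split => // y VWy; exists U => //; rewrite UE.
Qed.

Fact sub_reg_cst U c : O U -> R U (fun=> c).
Proof.
move=> OU x Ux; exists (points X), (fun=> c); split=> //; first exact: opensT.
  by case: (sub_opens_sub OU Ux).
exact/reg_cst/opensT.
Qed.

Fact sub_regD U f g : O U -> R U f -> R U g -> R U (fun x => f x + g x).
Proof.
move=> OU rf rg x Ux; have [V [f' [oV Vx rf' ff']]] := rf x Ux.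
have [V' [g' [oV' V'x rg' gg']]] := rg x Ux.
have oI := opensI oV oV'.
exists (V `&` V'), (fun x => f' x + g' x); split => //.
- apply: regD => //.
    exact: (reg_restrict oV oI (@subIsetl _ _ _) rf').
  exact: (reg_restrict oV' oI (@subIsetr _ _ _) rg').
- by move=> y Uy [Vy V'y]; rewrite ff' ?gg'.
Qed.

Fact sub_regM U f g : O U -> R U f -> R U g -> R U (fun x => f x * g x).
Proof.
move=> OU rf rg x Ux; have [V [f' [oV Vx rf' ff']]] := rf x Ux.
have [V' [g' [oV' V'x rg' gg']]] := rg x Ux.
have oI := opensI oV oV'.
exists (V `&` V'), (fun x => f' x * g' x); split => //.
- apply: regM => //.
    exact: (reg_restrict oV oI (@subIsetl _ _ _) rf').
  exact: (reg_restrict oV' oI (@subIsetr _ _ _) rg').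
- by move=> y Uy [Vy V'y]; rewrite ff' ?gg'.
Qed.

Fact sub_reg_local U f : O U ->
  (forall x, U x -> exists V g, [/\ O V, V x, R V g &
       forall y, U y -> V y -> f y = g y]) -> R U f.
Proof.
move=> OU H x Ux; have [V [g [[V0 oV0 ->] [V0x Wx] rg fg]]] := H x Ux.
have [V' [h [oV' V'x rh gh]]] := rg x (conj V0x Wx).
have oI := opensI oV0 oV'.
exists (V0 `&` V'), h; split=> //.
  by apply: reg_restrict rh => //; apply: subIsetr.
move=> y Uy [V0y V'y]; have [_ Wy] := sub_opens_sub OU Uy.
by rewrite fg ?gh.
Qed.

Fact sub_opens_neq0 U f : O U -> R U f -> O [set x | U x /\ f x != 0].
Proof.
move=> [U0 oU0 UE] rf.
exists (\bigcup_(V in [set V | opens X V /\ V `&` W `<=` [set x | U x /\ f x != 0]]) V).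
  by apply: opens_bigcup => V [].
apply/seteqP; split => [x [Ux fx]|x [[V [_ VF] Vx] Wx]]; last exact: VF.
have [V [g [oV Vx rg fg]]] := rf x Ux.
split; last by move: Ux; rewrite UE => -[].
have oI := opensI oU0 oV.
have rg' : reg X (U0 `&` V) g by apply: reg_restrict rg => //; apply: subIsetr.
exists [set x | (U0 `&` V) x /\ g x != 0]; last first.
  by move: (Ux); rewrite UE => -[U0x _]; split=> //; rewrite -fg.
split; first exact: opens_neq0.
move=> y [[[U0y Vy] gy] Wy]; have Uy : U y by rewrite UE.
by split=> //; rewrite fg.
Qed.

Fact sub_regV U f : O U -> R U f ->
  R [set x | U x /\ f x != 0] (fun x => (f x)^-1).
Proof.
move=> OU rf x [Ux fx]; have [V [g [oV Vx rg fg]]] := rf x Ux.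
exists [set x | V x /\ g x != 0], (fun x => (g x)^-1); split.
- exact: opens_neq0.
- by split=> //; rewrite -fg.
- exact: regV.
- by move=> y [Uy _] [Vy _]; rewrite fg.
Qed.

Definition sub : space := Space sub_opens_sub sub_opensT sub_opensI
  sub_opens_bigcup sub_reg_cst sub_regD sub_regM sub_reg_local sub_opens_neq0
  sub_regV.
End Sub.

(* Polynomial functions in the coordinates x`_0, x`_1, ... of a point.  On k^n
   the coordinates x`_i with n <= i are 0, so these are the polynomial
   functions in n variables. *)
Inductive polyfun : (pt -> k) -> Prop :=
| polyfun_cst c : polyfun (fun=> c)
| polyfun_coord (i : nat) : polyfun (fun x => x`_i)
| polyfunD p q : polyfun p -> polyfun q -> polyfun (fun x => p x + q x)
| polyfunM p q : polyfun p -> polyfun q -> polyfun (fun x => p x * q x).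

Section Affine.
Variable n : nat.
Let P : set pt := [set x | size x = n].
(* Complements of the common zero loci of sets S of polynomials. *)
Let O : set (set pt) := [set U | exists2 S, S `<=` polyfun &
  U = [set x | size x = n /\ exists2 p, S p & p x != 0]].
Let R (U : set pt) : set (pt -> k) := [set f | forall x, U x ->
  exists V p q, [/\ O V, V x, polyfun p, polyfun q &
    forall y, U y -> V y -> q y != 0 /\ f y = p y / q y]].

Lemma aff_opensP U : O U <-> U `<=` P /\
  forall x, U x -> exists p, [/\ polyfun p, p x != 0 &
    forall y, size y = n -> p y != 0 -> U y].
Proof.
split=> [[S Sp ->]|[UP H]].
  split=> [x []//|x [_ [p Spp px]]]; exists p; split=> //; first exact: Sp.
  by move=> y sy py; split=> //; exists p.
exists [set p | polyfun p /\ forall y, size y = n -> p y != 0 -> U y].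
  by move=> p [].
apply/seteqP; split=> [x Ux|x [sx [p [_ pU] px]]]; last exact: pU.
split; first exact: UP.
by have [p [pp px pU]] := H x Ux; exists p.
Qed.

Fact aff_opens_sub U : O U -> U `<=` P.
Proof. by move=> /aff_opensP[]. Qed.

Fact aff_opensT : O P.
Proof.
apply/aff_opensP; split=> // x Px; exists (fun=> 1); split => //.
  exact: polyfun_cst.
exact: oner_neq0.
Qed.

Fact aff_opensI U V : O U -> O V -> O (U `&` V).
Proof.
move=> /aff_opensP[UP HU] /aff_opensP[VP HV]; apply/aff_opensP; split.
  by move=> x [/UP].
move=> x [/HU[p [pp px pU]] /HV[q [qq qx qV]]].
exists (fun x => p x * q x); split.
- exact: polyfunM.
- by rewrite mulf_neq0.
- by move=> y sy; rewrite mulf_eq0 negb_or => /andP[/pU + /qV]; split; auto.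
Qed.

Fact aff_opens_bigcup (F : set (set pt)) :
  F `<=` O -> O (\bigcup_(U in F) U).
Proof.
move=> FO; apply/aff_opensP; split.
  by move=> x [U /FO/aff_opensP[UP _] /UP].
move=> x [U FU Ux]; have /aff_opensP[_ /(_ x Ux)[p [pp px pU]]] := FO _ FU.
by exists p; split=> // y sy py; exists U => //; apply: pU.
Qed.

Fact aff_reg_cst U c : O U -> R U (fun=> c).
Proof.
move=> OU x Ux; exists P, (fun=> c), (fun=> 1); split=> //.
- exact: aff_opensT.
- exact: aff_opens_sub Ux.
- exact: polyfun_cst.
- exact: polyfun_cst.
- by move=> y _ _; rewrite oner_neq0 divr1.
Qed.

Fact aff_regD U f g : O U -> R U f -> R U g -> R U (fun x => f x + g x).
Proof.
move=> OU rf rg x Ux.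
have [V [p [q [oV Vx pp pq H]]]] := rf x Ux.
have [V' [p' [q' [oV' V'x pp' pq' H']]]] := rg x Ux.
exists (V `&` V'), (fun x => p x * q' x + p' x * q x), (fun x => q x * q' x).
split=> //.
- exact: aff_opensI.
- by apply: polyfunD; apply: polyfunM.
- exact: polyfunM.
- move=> y Uy [/(H y Uy)[qy ->] /(H' y Uy)[q'y ->]].
  by rewrite mulf_neq0 // addf_div.
Qed.

Fact aff_regM U f g : O U -> R U f -> R U g -> R U (fun x => f x * g x).
Proof.
move=> OU rf rg x Ux.
have [V [p [q [oV Vx pp pq H]]]] := rf x Ux.
have [V' [p' [q' [oV' V'x pp' pq' H']]]] := rg x Ux.
exists (V `&` V'), (fun x => p x * p' x), (fun x => q x * q' x).
split=> //.
- exact: aff_opensI.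
- exact: polyfunM.
- exact: polyfunM.
- move=> y Uy [/(H y Uy)[qy ->] /(H' y Uy)[q'y ->]].
  by rewrite mulf_neq0 // mulf_div.
Qed.

Fact aff_reg_local U f : O U ->
  (forall x, U x -> exists V g, [/\ O V, V x, R V g &
       forall y, U y -> V y -> f y = g y]) -> R U f.
Proof.
move=> OU H x Ux; have [V [g [oV Vx rg fg]]] := H x Ux.
have [V' [p [q [oV' V'x pp pq H']]]] := rg x Vx.
exists (V `&` V'), p, q; split=> //; first exact: aff_opensI.
by move=> y Uy [Vy V'y]; rewrite fg //; apply: H'.
Qed.

Fact aff_opens_neq0 U f : O U -> R U f -> O [set x | U x /\ f x != 0].
Proof.
move=> OU rf; apply/aff_opensP; split => [x [Ux _]|x [Ux fx]].
  exact: aff_opens_sub Ux.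
have [V [p [q [oV Vx pp pq H]]]] := rf x Ux.
have /aff_opensP[_ /(_ x (conj Ux Vx))[r [pr rx rUV]]] := aff_opensI OU oV.
exists (fun x => r x * p x); split; first exact: polyfunM.
  have [_ fE] := H x Ux Vx; move: fx; rewrite fE mulf_eq0 negb_or => /andP[px _].
  by rewrite mulf_neq0.
move=> y sy; rewrite mulf_eq0 negb_or => /andP[/rUV-/(_ sy)[Uy Vy] py].
have [qy fE] := H y Uy Vy.
by split=> //; rewrite fE mulf_neq0 ?invr_eq0.
Qed.

Fact aff_regV U f : O U -> R U f ->
  R [set x | U x /\ f x != 0] (fun x => (f x)^-1).
Proof.
move=> OU rf x [Ux fx]; have [V [p [q [oV Vx pp pq H]]]] := rf x Ux.
exists V, q, p; split=> // y [Uy fy] Vy; have [qy fE] := H y Uy Vy.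
by move: fy; rewrite fE invf_div mulf_eq0 negb_or => /andP[].
Qed.

Definition affine_space : space := Space aff_opens_sub aff_opensT aff_opensI
  aff_opens_bigcup aff_reg_cst aff_regD aff_regM aff_reg_local aff_opens_neq0
  aff_regV.
End Affine.

Definition affine (X : space) : Prop := exists n (W : set pt),
  closed_in (affine_space n) W /\ isomorphic X (sub (affine_space n) W).

Definition separated (X : space) : Prop :=
  forall (T : space) phi psi, morphism T X phi -> morphism T X psi ->
    closed_in T [set t | phi t = psi t].

Definition is_variety (X : space) : Prop := separated X /\
  exists n (U : 'I_n -> set pt),
    (forall i, opens X (U i) /\ affine (sub X (U i))) /\
    forall x, X x -> exists i, U i x.

Record variety := Variety {
  variety_space :> space;
  variety_axiom : is_variety variety_space }.

(* The universal property of products in the category of varieties; maps are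
   compared on points only, their values elsewhere being irrelevant. *)
Definition is_product (X Y P : variety) (p q : pt -> pt) : Prop :=
  [/\ morphism P X p, morphism P Y q &
    forall (T : variety) f g, morphism T X f -> morphism T Y g ->
    exists2 h, morphism T P h /\
        forall t, T t -> p (h t) = f t /\ q (h t) = g t &
      forall h', morphism T P h' ->
        (forall t, T t -> p (h' t) = f t /\ q (h' t) = g t) ->
        forall t, T t -> h' t = h t].

Lemma morphism_id (X : space) : morphism X X id.
Proof.
split=> // U oU; have -> : points X `&` id @^-1` U = U.
  by apply/seteqP; split=> [x []//|x Ux]; split=> //; apply: (opens_sub oU).
by split.
Qed.

Lemma morphism_comp (X Y Z : space) f g :
  morphism X Y f -> morphism Y Z g -> morphism X Z (g \o f).
Proof.
move=> [fX fU] [gY gU]; split=> [x Xx|U oU]; first exact/gY/fX.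
have [oV rV] := gU U oU; have [oW rW] := fU _ oV.
have E : points X `&` (g \o f) @^-1` U =
         points X `&` f @^-1` (points Y `&` g @^-1` U).
  apply/seteqP; split=> [x [Xx Ux]|x [Xx [_ Ux]]]; split=> //.
  by split=> //; apply: fX.
by rewrite E; split=> // h rh; exact: rW _ (rV _ rh).
Qed.

Lemma isomorphic_refl X : isomorphic X X.
Proof. by exists id, id; split=> //; apply: morphism_id. Qed.

Lemma isomorphic_sym X Y : isomorphic X Y -> isomorphic Y X.
Proof. by move=> [f [g [mf mg fg gf]]]; exists g, f. Qed.

Lemma isomorphic_trans X Y Z :
  isomorphic X Y -> isomorphic Y Z -> isomorphic X Z.
Proof.
move=> [f [g [mf mg fg gf]]] [f' [g' [mf' mg' fg' gf']]].
exists (f' \o f), (g \o g'); split.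
- exact: morphism_comp mf mf'.
- exact: morphism_comp mg' mg.
- by move=> x Xx /=; rewrite fg' ?fg //; apply: mf.1.
- by move=> z Zz /=; rewrite gf ?gf' //; apply: mg'.1.
Qed.

Lemma morphism_incl X W : morphism (sub X W) X id.
Proof.
split=> [x []//|U oU].
have -> : points (sub X W) `&` id @^-1` U = U `&` W.
  apply/seteqP; split=> [x [[]]//|x [Ux Wx]]; split=> //; split=> //.
  exact: (opens_sub oU).
split; first by exists U.
by move=> f rf /= x [Ux Wx]; exists U, f.
Qed.

Lemma morphism_sub (T X : space) (W : set pt) (f : pt -> pt) :
  morphism T X f -> (forall t, T t -> W (f t)) -> morphism T (sub X W) f.
Proof.
move=> [fX fU] fW; split=> [t Tt|_ [U oU ->]].
  by split; [apply: fX|apply: fW].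
have E V : points T `&` f @^-1` (V `&` W) = points T `&` f @^-1` V.
  apply/seteqP; split=> [x [Tx []]//|x [Tx Vx]]; split=> //.
  by split=> //; apply: fW.
rewrite E; have [oV rV] := fU U oU; split=> // g rg; apply: reg_local => //.
move=> x [Tx Ux]; have [V [h [oV' Vx rh gh]]] := rg _ (conj Ux (fW _ Tx)).
have [oV'' rV'] := fU V oV'.
exists (points T `&` f @^-1` V), (h \o f); split=> //; first exact: rV'.
by move=> y [Ty Uy] [_ Vy] /=; apply: gh => //; split=> //; apply: fW.
Qed.

Lemma polyfun_reg n p : polyfun p -> reg (affine_space n) (affine_space n) p.
Proof.
move=> pp /= x Px; exists (points (affine_space n)), p, (fun=> 1); split=> //.
- exact: aff_opensT.
- exact: polyfun_cst.
- by move=> y _ _; rewrite oner_neq0 divr1.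
Qed.

Arguments polyfun_reg n [p] _.

Lemma polyfun_opens n p : polyfun p ->
  opens (affine_space n) [set x | size x = n /\ p x != 0].
Proof.
by move=> pp; exact: opens_neq0 (opensT (affine_space n)) (polyfun_reg n pp).
Qed.

Lemma polyfun_closed n (S : set (pt -> k)) : S `<=` polyfun ->
  closed_in (affine_space n) [set x | forall p, S p -> p x = 0].
Proof.
move=> Sp; exists S => //; apply/seteqP; split=> x [sx H]; split=> //.
  apply: contrapT => H'; apply: H => p Spp; apply: contrapT => /eqP px.
  by apply: H'; exists p.
by case: H => p Spp px /(_ p Spp) E; rewrite E eqxx in px.
Qed.

Lemma reg_polyfun (X : space) (f : pt -> pt) p :
  (forall i, reg X X (fun x => (f x)`_i)) -> polyfun p -> reg X X (p \o f).
Proof.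
move=> rf; elim=> [c|i|q r _ IHq _ IHr|q r _ IHq _ IHr].
- exact/reg_cst/opensT.
- exact: rf.
- by apply: regD => //; apply: opensT.
- by apply: regM => //; apply: opensT.
Qed.

Lemma morphism_affine (X : space) n (f : pt -> pt) : (forall x, X x -> size (f x) = n) ->
  (forall i, reg X X (fun x => (f x)`_i)) -> morphism X (affine_space n) f.
Proof.
move=> sf rf; split=> // U oU.
have oV : opens X (points X `&` f @^-1` U).
  apply: opens_local => x [Xx Ux].
  have /aff_opensP[_ /(_ _ Ux)[p [pp px pU]]] := oU.
  exists [set x | X x /\ p (f x) != 0]; split=> //.
    by apply: (opens_neq0 (opensT X)); apply: reg_polyfun pp.
  by move=> y [Xy py]; split=> //; apply: pU => //; apply: sf.
split=> // g rg; apply: reg_local => // x [Xx Ux].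
have [V [p [q [oV' Vx pp pq H]]]] := rg _ Ux.
have [qx _] := H _ Ux Vx.
have rq := reg_polyfun rf pq; have rp := reg_polyfun rf pp.
have oW := opens_neq0 (opensT X) rq.
have oW' : opens X (points X `&` f @^-1` V).
  apply: opens_local => y [Xy Vy].
  have /aff_opensP[_ /(_ _ Vy)[r [pr ry rV]]] := oV'.
  exists [set x | X x /\ r (f x) != 0]; split=> //.
    by apply: (opens_neq0 (opensT X)); apply: reg_polyfun pr.
  by move=> z [Xz rz]; split=> //; apply: rV => //; apply: sf.
exists ((points X `&` f @^-1` V) `&` [set x | X x /\ (q \o f) x != 0]),
  (fun x => (p \o f) x * ((q \o f) x)^-1).
have oI := opensI oW' oW.
split=> //; last by move=> y [Xy Uy] [[_ Vy] [_ qy]] /=; case: (H _ Uy Vy).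
apply: (reg_restrict oW oI (@subIsetr _ _ _)).
apply: regM => //; last exact: regV (opensT X) rq.
by apply: reg_restrict rp => //; [apply: opensT|move=> y []].
Qed.

Lemma reg_morphism (X Y : space) (f : pt -> pt) (g : pt -> k) :
  morphism X Y f -> reg Y Y g -> reg X X (g \o f).
Proof.
move=> [fX fU] rg; have [_ /(_ _ rg)] := fU _ (opensT Y).
suff -> : points X `&` f @^-1` points Y = points X by [].
by apply/seteqP; split=> [x []//|x Xx]; split=> //; apply: fX.
Qed.

Lemma coord_closed (X : space) n (f g : pt -> pt) : morphism X (affine_space n) f ->
  morphism X (affine_space n) g -> closed_in X [set x | f x = g x].
Proof.
move=> mf mg; apply: opens_local => x [Xx fgx].
have [i fgi] : exists i, (f x)`_i - (g x)`_i != 0.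
  apply: contrapT => H; apply: fgx; apply: (@eq_from_nth _ 0).
    by rewrite (mf.1 _ Xx) (mg.1 _ Xx).
  move=> i _; apply: contrapT => /eqP fgi; apply: H; exists i.
  by rewrite subr_eq0.
have rfg : reg X X (fun y => (f y)`_i + (fun=> -1) y * (g y)`_i).
  apply: (regD (opensT X)).
    exact: reg_morphism mf (polyfun_reg _ (polyfun_coord i)).
  apply: (regM (opensT X)); first exact/reg_cst/opensT.
  exact: reg_morphism mg (polyfun_reg _ (polyfun_coord i)).
exists [set y | X y /\ (f y)`_i + (fun=> -1) y * (g y)`_i != 0]; split.
- exact: opens_neq0 (opensT X) rfg.
- by split=> //; rewrite mulN1r.
- by move=> y [Xy H]; split=> // E; move: H; rewrite E mulN1r subrr eqxx.
Qed.

Lemma affine_is_variety X : affine X -> is_variety X.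
Proof.
move=> [n [W [cW iX]]]; split.
  move=> T f g mf mg; have [h [h' [mh mh' hK h'K]]] := iX.
  have mi := morphism_comp mh (morphism_incl _ _).
  have := coord_closed (morphism_comp mf mi) (morphism_comp mg mi).
  rewrite /closed_in; congr opens; apply/seteqP; split=> t [Tt H]; split=> //.
    by move=> E; apply: H => /=; rewrite E.
  move=> /= E; apply: H; rewrite /= -(hK (f t)) ?E ?hK //.
    exact: mg.1.
  exact: mf.1.
exists 1, (fun=> points X); split=> [_|x Xx]; last by exists ord0.
split; first exact: opensT.
exists n, W; split=> //; apply: isomorphic_trans iX.
exists id, id; split=> //; first exact: morphism_incl.
exact: morphism_sub (morphism_id X) _.
Qed.

Lemma polyfun_take n p : polyfun p -> polyfun (p \o take n).
Proof.
elim=> [c|i|q r _ IHq _ IHr|q r _ IHq _ IHr].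
- exact: polyfun_cst.
- case: (ltnP i n) => lin.
    suff -> : (fun x : pt => x`_i) \o take n = (fun x : pt => x`_i).
      exact: polyfun_coord.
    by apply/funext => x /=; rewrite nth_take.
  suff -> : (fun x : pt => x`_i) \o take n = (fun=> 0) by exact: polyfun_cst.
  apply/funext => x /=; rewrite nth_default // size_take.
  by case: ltnP => // sx; apply: leq_trans lin.
- exact: polyfunD IHq IHr.
- exact: polyfunM IHq IHr.
Qed.

Lemma affine_principal n (W : set pt) f : closed_in (affine_space n) W ->
  polyfun f -> affine (sub (affine_space n) [set x | W x /\ f x != 0]).
Proof.
move=> [S Sp WE] pf; set X := sub _ _.
pose S' := [set q | (exists2 p, S p & q = p \o take n) \/
  q = fun x => f (take n x) * x`_n + (fun=> -1) x].
have S'p : S' `<=` polyfun.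
  move=> q [[p Spp ->]|->]; first exact/polyfun_take/Sp.
  apply: polyfunD; last exact: polyfun_cst.
  by apply: polyfunM; [apply: polyfun_take pf|apply: polyfun_coord].
pose W' : set pt := [set x | forall q, S' q -> q x = 0].
exists n.+1, W'; split; first exact: polyfun_closed.
have sX x : X x -> size x = n by case.
have WP x : size x = n -> W x <-> forall p, S p -> p x = 0.
  move=> sx; split=> [Wx p Spp|H].
    apply: contrapT => /eqP px.
    suff : (points (affine_space n) `\` W) x by case.
    by rewrite WE; split=> //; exists p.
  apply: contrapT => nWx.
  have [_ [p Spp]] : [set x | size x = n /\ exists2 p, S p & p x != 0] x.
    by rewrite -WE; split.
  by rewrite H // eqxx.
have rc i : reg X X (fun x => x`_i).
  exact: reg_morphism (morphism_incl _ _) (polyfun_reg n (polyfun_coord i)).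
have rf : reg X X f := reg_morphism (morphism_incl _ _) (polyfun_reg n pf).
have rfV : reg X X (fun x => (f x)^-1).
  have := regV (opensT X) rf; congr (reg X _ _).
  by apply/seteqP; split=> [x []//|x Xx]; split=> //; case: Xx => _ [].
exists (fun x => rcons x (f x)^-1), (take n); split.
- apply: morphism_sub.
    apply: morphism_affine => [x Xx|i]; first by rewrite size_rcons sX.
    case: (ltngtP i n) => Hi.
    + by apply: reg_ext (rc i) => [|x Xx]; [apply: opensT|rewrite nth_rcons sX // Hi].
    + apply: (@reg_ext _ _ _ (fun=> 0)); [exact: opensT| |exact/reg_cst/opensT].
      by move=> x Xx; rewrite nth_default // size_rcons sX.
    + apply: reg_ext rfV; first exact: opensT.
      by move=> x Xx; rewrite nth_rcons sX // Hi ltnn eqxx.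
  move=> x Xx q; have sx := sX x Xx; have [_ [Wx fx]] := Xx.
  have E : take n (rcons x (f x)^-1) = x by rewrite -sx -cats1 take_size_cat.
  move=> [[p Spp ->]|->] /=; rewrite E; first by apply: (WP x sx).1.
  by rewrite nth_rcons sx ltnn eqxx divff // subrr.
- apply: morphism_sub.
    apply: morphism_affine => [x [sx _]|i].
      by rewrite size_take /= sx ltnSn.
    have := reg_morphism (morphism_incl (affine_space n.+1) W')
      (polyfun_reg n.+1 (polyfun_take n (polyfun_coord i))).
    by [].
  move=> x [/= sx W'x].
  have sx' : size (take n x) = n by rewrite size_take sx ltnSn.
  split; first by apply/(WP _ sx') => p Spp; apply: (W'x (p \o take n)); left; exists p.
  have := W'x _ (or_intror erefl) => /=; apply: contra_eq_neq => ->.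
  by rewrite mul0r add0r oppr_eq0 oner_neq0.
- by move=> x /sX sx; rewrite -sx -cats1 take_size_cat.
- move=> x [/= sx W'x]; have := W'x _ (or_intror erefl) => /= /eqP.
  rewrite subr_eq0 => /eqP E.
  have f0 : f (take n x) != 0.
    by apply: contra_eq_neq E => ->; rewrite mul0r eq_sym oner_neq0.
  have -> : (f (take n x))^-1 = x`_n.
    by apply: (mulfI f0); rewrite E divff.
  by rewrite -take_nth ?sx // -sx take_size.
Qed.

Lemma affine_closed n (W : set pt) : closed_in (affine_space n) W ->
  affine (sub (affine_space n) W).
Proof. by move=> cW; exists n, W; split=> //; apply: isomorphic_refl. Qed.

Lemma affine_affine_space n : affine (affine_space n).
Proof.
exists n, setT; split.
  rewrite /closed_in setDT; have := polyfun_opens n (polyfun_cst 0).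
  by congr opens; apply/seteqP; split=> x // []; rewrite eqxx.
exists id, id; split=> //; last exact: morphism_incl.
exact: morphism_sub (morphism_id _) _.
Qed.

Definition affine_space_variety n : variety :=
  Variety (affine_is_variety (affine_affine_space n)).

Definition closed_subvariety n W (cW : closed_in (affine_space n) W) : variety :=
  Variety (affine_is_variety (affine_closed cW)).

Definition principal_subvariety n W (cW : closed_in (affine_space n) W) f
    (pf : polyfun f) : variety :=
  Variety (affine_is_variety (affine_principal cW pf)).

End Spaces.

(* The commutative ring generated by G subject to relations. *)
Section Presentation.
Variable G : Type.

Inductive rexpr : Type :=
| Gen of G
| Zero
| One
| Opp of rexpr
| Add of rexpr & rexpr
| Mul of rexpr & rexpr.

Variable rel : rexpr -> rexpr -> Prop.

(* The least congruence containing rel and the commutative ring axioms. *)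
Inductive cong : rexpr -> rexpr -> Prop :=
| cong_rel a b : rel a b -> cong a b
| cong_refl a : cong a a
| cong_sym a b : cong a b -> cong b a
| cong_trans a b c : cong a b -> cong b c -> cong a c
| cong_opp a a' : cong a a' -> cong (Opp a) (Opp a')
| cong_add a a' b b' : cong a a' -> cong b b' -> cong (Add a b) (Add a' b')
| cong_mul a a' b b' : cong a a' -> cong b b' -> cong (Mul a b) (Mul a' b')
| cong_addA a b c : cong (Add a (Add b c)) (Add (Add a b) c)
| cong_addC a b : cong (Add a b) (Add b a)
| cong_add0 a : cong (Add Zero a) a
| cong_addN a : cong (Add (Opp a) a) Zero
| cong_mulA a b c : cong (Mul a (Mul b c)) (Mul (Mul a b) c)
| cong_mulC a b : cong (Mul a b) (Mul b a)
| cong_mul1 a : cong (Mul One a) a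
| cong_mulDl a b c : cong (Mul (Add a b) c) (Add (Mul a c) (Mul b c)).

HB.instance Definition _ := gen_eqMixin rexpr.
HB.instance Definition _ := gen_choiceMixin rexpr.

Definition congb (a b : rexpr) : bool := `[< cong a b >].

Fact congb_refl : reflexive congb.
Proof. by move=> a; apply/asboolP/cong_refl. Qed.

Fact congb_sym : symmetric congb.
Proof. by move=> a b; apply/asboolP/asboolP => /cong_sym. Qed.

Fact congb_trans : transitive congb.
Proof.
by move=> b a c /asboolP ab /asboolP bc; apply/asboolP/(cong_trans ab bc).
Qed.

Canonical congb_equiv := EquivRel congb congb_refl congb_sym congb_trans.

Definition presented := {eq_quot congb_equiv}%qT.
HB.instance Definition _ := Choice.on presented.

Definition class_of (a : rexpr) : presented := \pi_({eq_quot congb_equiv})%qT a.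

Lemma class_ofP a b : class_of a = class_of b <-> cong a b.
Proof.
split=> [/(eqmodP congb_equiv)/asboolP//|H].
by apply/(eqmodP congb_equiv)/asboolP.
Qed.

Lemma class_of_ind (P : presented -> Prop) :
  (forall a, P (class_of a)) -> forall x, P x.
Proof. by move=> H x; rewrite -[x]reprK; apply: H. Qed.

Let repr_of (x : presented) : rexpr := repr (x : {eq_quot congb_equiv}%qT).

Let repr_cong a : cong (repr_of (class_of a)) a.
Proof. by apply/class_ofP; rewrite /class_of /repr_of reprK. Qed.

Definition pres_opp (x : presented) := class_of (Opp (repr_of x)).
Definition pres_add (x y : presented) := class_of (Add (repr_of x) (repr_of y)).
Definition pres_mul (x y : presented) := class_of (Mul (repr_of x) (repr_of y)).

Let pres_oppE a : pres_opp (class_of a) = class_of (Opp a).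
Proof. by apply/class_ofP/cong_opp. Qed.

Let pres_addE a b : pres_add (class_of a) (class_of b) = class_of (Add a b).
Proof. by apply/class_ofP/cong_add. Qed.

Let pres_mulE a b : pres_mul (class_of a) (class_of b) = class_of (Mul a b).
Proof. by apply/class_ofP/cong_mul. Qed.

Fact pres_addA : associative pres_add.
Proof.
elim/class_of_ind => a; elim/class_of_ind => b; elim/class_of_ind => c.
by rewrite !pres_addE; apply/class_ofP/cong_addA.
Qed.

Fact pres_addC : commutative pres_add.
Proof.
elim/class_of_ind => a; elim/class_of_ind => b.
by rewrite !pres_addE; apply/class_ofP/cong_addC.
Qed.

Fact pres_add0 : left_id (class_of Zero) pres_add.
Proof.
by elim/class_of_ind => a; rewrite !pres_addE; apply/class_ofP/cong_add0.
Qed.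

Fact pres_addN : left_inverse (class_of Zero) pres_opp pres_add.
Proof.
elim/class_of_ind => a; rewrite pres_oppE pres_addE.
exact/class_ofP/cong_addN.
Qed.

HB.instance Definition _ :=
  GRing.isZmodule.Build presented pres_addA pres_addC pres_add0 pres_addN.

Fact pres_mulA : associative pres_mul.
Proof.
elim/class_of_ind => a; elim/class_of_ind => b; elim/class_of_ind => c.
by rewrite !pres_mulE; apply/class_ofP/cong_mulA.
Qed.

Fact pres_mulC : commutative pres_mul.
Proof.
elim/class_of_ind => a; elim/class_of_ind => b.
by rewrite !pres_mulE; apply/class_ofP/cong_mulC.
Qed.

Fact pres_mul1 : left_id (class_of One) pres_mul.
Proof.
by elim/class_of_ind => a; rewrite !pres_mulE; apply/class_ofP/cong_mul1.
Qed.

Fact pres_mulDl : left_distributive pres_mul +%R.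
Proof.
elim/class_of_ind => a; elim/class_of_ind => b; elim/class_of_ind => c.
rewrite [class_of a + _]pres_addE !pres_mulE [class_of _ + _]pres_addE.
exact/class_ofP/cong_mulDl.
Qed.

HB.instance Definition _ := GRing.Zmodule_isComPzRing.Build presented
  pres_mulA pres_mulC pres_mul1 pres_mulDl.

Lemma class_ofD a b : class_of (Add a b) = class_of a + class_of b.
Proof. by rewrite -pres_addE. Qed.

Lemma class_ofM a b : class_of (Mul a b) = class_of a * class_of b.
Proof. by rewrite -pres_mulE. Qed.

Lemma class_ofN a : class_of (Opp a) = - class_of a.
Proof. by rewrite -pres_oppE. Qed.

Lemma class_of0 : class_of Zero = 0. Proof. by []. Qed.

Lemma class_of1 : class_of One = 1. Proof. by []. Qed.

End Presentation.

Arguments Zero {G}.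
Arguments One {G}.
Arguments class_of {G} rel a.

(* A with inverses adjoined to the elements of S: the ring generated by the
   elements of A (subject to the relations that hold in A) and one further
   generator for each element of S. *)
Section Localization.
Variables (A : comPzRingType) (S : set A).

Inductive loc_gen : Type := Elt of A | Inv (s : A) of S s.

Inductive loc_rel : rexpr loc_gen -> rexpr loc_gen -> Prop :=
| loc_rel1 : loc_rel (Gen (Elt 1)) One
| loc_relD a b : loc_rel (Gen (Elt (a + b))) (Add (Gen (Elt a)) (Gen (Elt b)))
| loc_relM a b : loc_rel (Gen (Elt (a * b))) (Mul (Gen (Elt a)) (Gen (Elt b)))
| loc_relV s (Ss : S s) : loc_rel (Mul (Gen (Elt s)) (Gen (Inv Ss))) One.

Definition localization : Type := presented loc_rel.
HB.instance Definition _ := GRing.ComPzRing.on localization.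

Definition to_loc (a : A) : localization := class_of loc_rel (Gen (Elt a)).

Fact to_loc_zmod_morphism : zmod_morphism to_loc.
Proof.
have D a b : to_loc (a + b) = to_loc a + to_loc b.
  by rewrite /to_loc -class_ofD; apply/class_ofP/cong_rel/loc_relD.
move=> a b; apply: (addIr (to_loc b)); rewrite -D.
by rewrite !subrK.
Qed.

Fact to_loc_monoid_morphism : monoid_morphism to_loc.
Proof.
split=> [|a b]; first exact/class_ofP/cong_rel/loc_rel1.
by rewrite /to_loc -class_ofM; apply/class_ofP/cong_rel/loc_relM.
Qed.

HB.instance Definition _ :=
  GRing.isZmodMorphism.Build A localization to_loc to_loc_zmod_morphism.
HB.instance Definition _ :=
  GRing.isMonoidMorphism.Build A localization to_loc to_loc_monoid_morphism.

Lemma to_loc_inv s : S s -> exists t, to_loc s * t = 1.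
Proof.
move=> Ss; exists (class_of loc_rel (Gen (Inv Ss))).
by rewrite /to_loc -class_ofM; apply/class_ofP/cong_rel/loc_relV.
Qed.
End Localization.

(* The inverse of a unit, and 0 on non-units.  The classes [G_d] and the
   elements (L)_d inverted below are units of the ring in which they live, since
   [GL_n] is the product of the L^n - L^i for 0 <= i < n. *)
Definition minv {A : comPzRingType} (x : A) : A := xget 0 [set y | x * y = 1].

Definition zexp {A : comPzRingType} (x : A) (z : int) : A :=
  match z with Posz n => x ^+ n | Negz n => minv x ^+ n.+1 end.

Lemma mul_inv {A : comPzRingType} (x y : A) : x * y = 1 -> x * minv x = 1.
Proof. by move=> xy; rewrite /minv; case: xgetP => [z _|/(_ y)]. Qed.

Lemma inv_unique {A : comPzRingType} (x y : A) : x * y = 1 -> minv x = y.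
Proof.
move=> xy; rewrite -[minv x]mul1r -xy [x * y]mulrC -mulrA.
by rewrite (mul_inv xy) mulr1.
Qed.

Lemma zexpD {A : comPzRingType} (x : A) (m n : int) : x * minv x = 1 ->
  zexp x (m + n) = zexp x m * zexp x n.
Proof.
move=> xV.
have H (a b : nat) : zexp x (a%:Z - b%:Z) = x ^+ a * minv x ^+ b.
  have [ba|ab] := leqP b a.
    rewrite -{2}(subnK ba) exprD -mulrA -exprMn xV expr1n mulr1.
    by rewrite subzn.
  rewrite -{2}(subnK (ltnW ab)) exprD [minv x ^+ _ * _]mulrC mulrA -exprMn xV.
  rewrite expr1n mul1r -opprB subzn ?(ltnW ab) //.
  by case: (b - a)%N (subn_gt0 a b) => [|c] //; rewrite ab.
have [a [b ->]] : exists a b : nat, m = a%:Z - b%:Z.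
  by case: m => c; [exists c, 0%N; rewrite subr0|exists 0%N, c.+1; rewrite sub0r NegzE].
have [c [d ->]] : exists a b : nat, n = a%:Z - b%:Z.
  by case: n => c; [exists c, 0%N; rewrite subr0|exists 0%N, c.+1; rewrite sub0r NegzE].
have -> : a%:Z - b%:Z + (c%:Z - d%:Z) = (a + c)%N%:Z - (b + d)%N%:Z.
  by rewrite !PoszD opprD addrACA.
by rewrite !H !exprD mulrACA.
Qed.

(* K_0 is presented as a ring rather than as an abelian group carrying a
   multiplication: since [X][Y] = [X x Y] and 1 = [point] are among the
   relations, this gives the same ring. *)
Section Motives.
Variable k : closedFieldType.

Inductive K0_rel : rexpr (variety k) -> rexpr (variety k) -> Prop :=
| K0_iso (X Y : variety k) : isomorphic X Y -> K0_rel (Gen X) (Gen Y)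
| K0_scissor (X Z U : variety k) (W : set (seq k)) : closed_in X W ->
    isomorphic Z (sub X W) -> isomorphic U (sub X (~` W)) ->
    K0_rel (Gen X) (Add (Gen Z) (Gen U))
| K0_product (X Y P : variety k) (p q : seq k -> seq k) : is_product X Y P p q ->
    K0_rel (Gen P) (Mul (Gen X) (Gen Y))
| K0_point : K0_rel (Gen (affine_space_variety k 0)) One.

Definition K0 : Type := presented K0_rel.
HB.instance Definition _ := GRing.ComPzRing.on K0.

Definition K0_class (X : variety k) : K0 := class_of K0_rel (Gen X).

Definition K0_L : K0 := K0_class (affine_space_variety k 1).

Definition mot_den : set K0 :=
  [set s | s = K0_L \/ exists2 i, (1 <= i)%N & s = 1 - K0_L ^+ i].

Definition Mot : Type := localization mot_den.
HB.instance Definition _ := GRing.ComPzRing.on Mot.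

Definition motive (X : variety k) : Mot := to_loc mot_den (K0_class X).

Definition LL : Mot := motive (affine_space_variety k 1).

Lemma LL_inv : LL * minv LL = 1.
Proof.
have [t tE] := @to_loc_inv _ mot_den K0_L (or_introl erefl).
exact: (@mul_inv Mot _ t).
Qed.

End Motives.

Record quiver := Quiver {
  vertex : finType;
  arrow : finType;
  source : arrow -> vertex;
  target : arrow -> vertex }.

Definition dimvec (Q : quiver) : Type := {ffun vertex Q -> nat}.
HB.instance Definition _ Q := GRing.Nmodule.on (dimvec Q).

Definition euler (Q : quiver) (d e : dimvec Q) : int :=
  \sum_i (d i * e i)%N%:Z - \sum_a (d (source a) * e (target a))%N%:Z.

Section TwistedSeries.
Variables (k : closedFieldType) (Q : quiver).

Lemma eulerDl (d d' e : dimvec Q) : euler (d + d') e = euler d e + euler d' e.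
Proof.
rewrite /euler addrACA -opprD -!big_split /=.
by congr (_ - _); apply: eq_bigr => i _; rewrite ffunE mulnDl PoszD.
Qed.

Lemma eulerDr (d e e' : dimvec Q) : euler d (e + e') = euler d e + euler d e'.
Proof.
rewrite /euler addrACA -opprD -!big_split /=.
by congr (_ - _); apply: eq_bigr => i _; rewrite ffunE mulnDr PoszD.
Qed.

Definition dimvec_of_ord N (e : {ffun vertex Q -> 'I_N}) : dimvec Q :=
  [ffun i => nat_of_ord (e i)].

(* All pairs (e, e') with e + e' = d, each once. *)
Definition splittings (d : dimvec Q) : seq (dimvec Q * dimvec Q) :=
  let E := enum {: {ffun vertex Q -> 'I_(\max_i d i).+1}} in
  [seq p <- [seq (dimvec_of_ord e, dimvec_of_ord e') | e <- E, e' <- E]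
  | p.1 + p.2 == d].

Lemma mem_splittings d p : (p \in splittings d) = (p.1 + p.2 == d).
Proof.
rewrite mem_filter andb_idr // => /eqP pd; apply/allpairsP.
have H1 i : (p.1 i < (\max_i d i).+1)%N.
  by rewrite ltnS (leq_trans _ (leq_bigmax i)) // -pd ffunE leq_addr.
have H2 i : (p.2 i < (\max_i d i).+1)%N.
  by rewrite ltnS (leq_trans _ (leq_bigmax i)) // -pd ffunE leq_addl.
exists ([ffun i => Ordinal (H1 i)], [ffun i => Ordinal (H2 i)]).
rewrite !mem_enum; split=> //=; rewrite [LHS]surjective_pairing.
by congr pair; apply/ffunP => i; rewrite !ffunE.
Qed.

Lemma splittings_uniq d : uniq (splittings d).
Proof.
apply: filter_uniq; apply: allpairs_uniq; rewrite ?enum_uniq //.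
move=> [e f] [e' f'] _ _ /= [ee ff]; congr pair; apply/ffunP => i; apply: val_inj.
  by move/ffunP/(_ i): ee; rewrite !ffunE.
by move/ffunP/(_ i): ff; rewrite !ffunE.
Qed.

Definition twps : Type := dimvec Q -> Mot k.

Implicit Types f g h : twps.

Definition tw_zero : twps := fun=> 0.
Definition tw_opp f : twps := fun d => - f d.
Definition tw_add f g : twps := fun d => f d + g d.
Definition tmon (d : dimvec Q) : twps := fun e => (e == d)%:R.
Definition tw_one : twps := tmon 0.
Definition tw_mul f g : twps := fun d =>
  \sum_(p <- splittings d) zexp (LL k) (- euler p.1 p.2) * f p.1 * g p.2.

HB.instance Definition _ := gen_eqMixin twps.
HB.instance Definition _ := gen_choiceMixin twps.

Fact tw_addA : associative tw_add.
Proof. by move=> f g h; apply/funext => d; apply: addrA. Qed.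
Fact tw_addC : commutative tw_add.
Proof. by move=> f g; apply/funext => d; apply: addrC. Qed.
Fact tw_add0 : left_id tw_zero tw_add.
Proof. by move=> f; apply/funext => d; apply: add0r. Qed.
Fact tw_addN : left_inverse tw_zero tw_opp tw_add.
Proof. by move=> f; apply/funext => d; apply: addNr. Qed.

Lemma zexp_LND (x y : int) :
  zexp (LL k) (- (x + y)) = zexp (LL k) (- x) * zexp (LL k) (- y).
Proof. by rewrite opprD; apply/zexpD/LL_inv. Qed.

Fact tw_mulA : associative tw_mul.
Proof.
move=> f g h; apply/funext => d; rewrite /tw_mul.
pose T (t : dimvec Q * dimvec Q * dimvec Q) :=
  zexp (LL k) (- (euler t.1.1 t.1.2 + euler t.1.1 t.2 + euler t.1.2 t.2)) *
  f t.1.1 * g t.1.2 * h t.2.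
transitivity (\sum_(t <- [seq (p.1, r.1, r.2) | p <- splittings d,
                            r <- splittings p.2]) T t).
  rewrite big_allpairs_dep; apply: eq_big_seq => p.
  rewrite mem_splittings => /eqP _.
  rewrite mulr_sumr; apply: eq_big_seq => r; rewrite mem_splittings => /eqP rp.
  rewrite /T /= -rp eulerDr (zexp_LND (_ + euler p.1 r.2) (euler r.1 r.2)).
  by rewrite -!mulrA; congr (_ * _); rewrite mulrCA.
transitivity (\sum_(t <- [seq (r.1, r.2, p.2) | p <- splittings d,
                            r <- splittings p.1]) T t); last first.
  rewrite big_allpairs_dep; apply: eq_big_seq => p.
  rewrite mem_splittings => /eqP _.
  rewrite mulr_sumr mulr_suml; apply: eq_big_seq => r.
  rewrite mem_splittings => /eqP rp.
  rewrite /T /= -rp eulerDl -addrA (zexp_LND (euler r.1 r.2) (_ + euler r.2 p.2)).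
  rewrite [zexp _ (- euler r.1 r.2) * _]mulrC.
  by rewrite !mulrA.
apply: perm_big; apply: uniq_perm.
- apply: allpairs_uniq_dep; first exact: splittings_uniq.
    by move=> p _; exact: splittings_uniq.
  move=> _ _ /allpairsPdep[p [r [_ rp ->]]] /allpairsPdep[p' [r' [_ rp' ->]]] /= E.
  move: rp rp'; rewrite !mem_splittings => /eqP rp /eqP rp' {T}.
  case: p p' r r' rp rp' E => [p1 p2] [p1' p2'] [r1 r2] [r1' r2'] /= <- <-.
  by case=> -> -> ->.
- apply: allpairs_uniq_dep; first exact: splittings_uniq.
    by move=> p _; exact: splittings_uniq.
  move=> _ _ /allpairsPdep[p [r [_ rp ->]]] /allpairsPdep[p' [r' [_ rp' ->]]] /= E.
  move: rp rp'; rewrite !mem_splittings => /eqP rp /eqP rp' {T}.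
  case: p p' r r' rp rp' E => [p1 p2] [p1' p2'] [r1 r2] [r1' r2'] /= <- <-.
  by case=> -> -> ->.
- move=> [[a b] c]; apply/allpairsPdep/allpairsPdep => -[[p1 p2] [[r1 r2] []]];
    rewrite !mem_splittings /= => /eqP pd /eqP rp [-> -> ->].
    exists (p1 + r1, r2), (p1, r1); rewrite !mem_splittings /= eqxx.
    by rewrite -addrA rp pd eqxx.
  exists (r1, r2 + p2), (r2, p2); rewrite !mem_splittings /= eqxx.
  by rewrite addrA rp pd eqxx.
Qed.

Lemma big_splittings0 (F : dimvec Q * dimvec Q -> Mot k) d :
  (forall p, p.1 + p.2 = d -> p.1 != 0 -> F p = 0) ->
  \sum_(p <- splittings d) F p = F (0, d).
Proof.
move=> F0; rewrite (bigD1_seq (0, d)) ?splittings_uniq ?mem_splittings ?add0r //=.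
rewrite big_seq_cond big1 ?addr0 // => -[a b]; rewrite mem_splittings /=.
case/andP => /eqP abd nab; apply: F0 => //=; apply: contraNneq nab => a0.
by rewrite -abd a0 add0r eqxx.
Qed.

Lemma big_splittingsr (F : dimvec Q * dimvec Q -> Mot k) d :
  (forall p, p.1 + p.2 = d -> p.2 != 0 -> F p = 0) ->
  \sum_(p <- splittings d) F p = F (d, 0).
Proof.
move=> F0; rewrite (bigD1_seq (d, 0)) ?splittings_uniq ?mem_splittings ?addr0 //=.
rewrite big_seq_cond big1 ?addr0 // => -[a b]; rewrite mem_splittings /=.
case/andP => /eqP abd nab; apply: F0 => //=; apply: contraNneq nab => a0.
by rewrite -abd a0 addr0 eqxx.
Qed.

Lemma euler0l (d : dimvec Q) : euler 0 d = 0.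
Proof. by apply: (addrI (euler 0 d)); rewrite -eulerDl !addr0. Qed.

Lemma euler0r (d : dimvec Q) : euler d 0 = 0.
Proof. by apply: (addrI (euler d 0)); rewrite -eulerDr !addr0. Qed.

Fact tw_mul1 : left_id tw_one tw_mul.
Proof.
move=> f; apply/funext => d; rewrite /tw_mul big_splittings0 /tw_one /tmon.
  by rewrite /= euler0l oppr0 eqxx !mul1r.
by move=> [a b] /= _ /negPf ->; rewrite mulr0 mul0r.
Qed.

Fact tw_1mul : right_id tw_one tw_mul.
Proof.
move=> f; apply/funext => d; rewrite /tw_mul big_splittingsr /tw_one /tmon.
  by rewrite /= euler0r oppr0 eqxx mulr1 mul1r.
by move=> [a b] /= _ /negPf ->; rewrite mulr0.
Qed.

Fact tw_mulDl : left_distributive tw_mul tw_add.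
Proof.
move=> f g h; apply/funext => d; rewrite /tw_mul /tw_add -big_split /=.
by apply: eq_bigr => p _; rewrite mulrDr mulrDl.
Qed.

Fact tw_mulDr : right_distributive tw_mul tw_add.
Proof.
move=> f g h; apply/funext => d; rewrite /tw_mul /tw_add -big_split /=.
by apply: eq_bigr => p _; rewrite mulrDr.
Qed.

HB.instance Definition _ := GRing.isPzRing.Build twps tw_addA tw_addC tw_add0
  tw_addN tw_mulA tw_mul1 tw_1mul tw_mulDl tw_mulDr.

Lemma twps_mulE f g d : (f * g) d =
  \sum_(p <- splittings d) zexp (LL k) (- euler p.1 p.2) * f p.1 * g p.2.
Proof. by []. Qed.

Lemma tmonM d e :
  tmon d * tmon e = fun c => zexp (LL k) (- euler d e) * tmon (d + e) c.
Proof.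
apply/funext => c; rewrite twps_mulE /tmon [c == _]eq_sym.
have [<-|ne] := eqVneq; last first.
  rewrite mulr0 big_seq big1 // => -[a b]; rewrite mem_splittings /= => /eqP abc.
  have [ad|_] := eqVneq a d; last by rewrite mulr0 mul0r.
  have [be|_] := eqVneq b e; last by rewrite mulr0.
  by rewrite -abc ad be eqxx in ne.
rewrite (bigD1_seq (d, e)) ?splittings_uniq ?mem_splittings //= !eqxx !mulr1.
rewrite big1 ?addr0 // => -[a b]; rewrite xpair_eqE /= negb_and.
by case/orP => /negPf ->; rewrite mulr0 ?mul0r.
Qed.

End TwistedSeries.

Section Representations.
Variables (k : closedFieldType) (Q : quiver) (d : dimvec Q).
Notation pt := (seq k).

Definition rep_coord : finType :=
  {a : arrow Q & ('I_(d (target a)) * 'I_(d (source a)))%type}.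

Definition gl_coord : finType :=
  {i : vertex Q & ('I_(d i) * 'I_(d i))%type}.

Definition rep_dim : nat := #|rep_coord|.
Definition gl_dim : nat := #|gl_coord|.

(* R_d: a point lists the entries of the matrices V_a, V_a acting on columns. *)
Definition rep_space : space k := affine_space k rep_dim.

Definition rep_mx (x : pt) (a : arrow Q) : 'M[k]_(d (target a), d (source a)) :=
  \matrix_(r, c) x`_(enum_rank (Tagged _ (r, c) : rep_coord)).

Definition rep_zero : pt := nseq rep_dim 0.

Definition orbit (x : pt) : set pt := [set y | size y = rep_dim /\
  exists2 g : (forall i, 'M[k]_(d i)), (forall i, g i \in unitmx) &
    forall a, rep_mx y a =
      g (target a) *m rep_mx x a *m invmx (g (source a))].

(* Closure in the Zariski topology (for orbits over the complex numbers it
   agrees with the closure in the usual topology). *)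
Definition nullset : set pt :=
  [set x | size x = rep_dim /\ closure_in rep_space (orbit x) rep_zero].

(* The group G_d, as the open subset of the affine space of all families of
   square matrices where the product of the determinants is nonzero. *)
Definition gl_mx (x : pt) (i : vertex Q) : 'M[k]_(d i) :=
  \matrix_(r, c) x`_(enum_rank (Tagged _ (r, c) : gl_coord)).

Definition gl_det (x : pt) : k := \prod_i \det (gl_mx x i).

Lemma gl_detE x : gl_det x != 0 <-> forall i, gl_mx x i \in unitmx.
Proof.
split=> [/prodf_neq0 H i|H]; first by rewrite unitmxE unitfE H.
by apply/prodf_neq0 => i _; rewrite -unitfE -unitmxE.
Qed.

Lemma polyfun_sum (I : finType) (p : I -> pt -> k) :
  (forall i, polyfun (p i)) -> polyfun (fun x => \sum_i p i x).
Proof.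
move=> pp; pose f (s : seq I) := fun x => \sum_(i <- s) p i x.
rewrite -/(f (index_enum I)); elim: (index_enum I) => [|i s IHs].
  by have -> : f [::] = fun=> 0; [apply/funext => x; rewrite /f big_nil|exact: polyfun_cst].
have -> : f (i :: s) = fun x => p i x + f s x.
  by apply/funext => x; rewrite /f big_cons.
exact: polyfunD.
Qed.

Lemma polyfun_prod (I : finType) (p : I -> pt -> k) :
  (forall i, polyfun (p i)) -> polyfun (fun x => \prod_i p i x).
Proof.
move=> pp; pose f (s : seq I) := fun x => \prod_(i <- s) p i x.
rewrite -/(f (index_enum I)); elim: (index_enum I) => [|i s IHs].
  by have -> : f [::] = fun=> 1; [apply/funext => x; rewrite /f big_nil|exact: polyfun_cst].
have -> : f (i :: s) = fun x => p i x * f s x.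
  by apply/funext => x; rewrite /f big_cons.
exact: polyfunM.
Qed.

Lemma polyfun_mulmx m n q (A : pt -> 'M[k]_(m, n)) (B : pt -> 'M[k]_(n, q)) :
  (forall i j, polyfun (fun x => A x i j)) ->
  (forall i j, polyfun (fun x => B x i j)) ->
  forall i j, polyfun (fun x => (A x *m B x) i j).
Proof.
move=> pA pB i j.
have -> : (fun x => (A x *m B x) i j) = fun x => \sum_l A x i l * B x l j.
  by apply/funext => x; rewrite mxE.
by apply: polyfun_sum => l; apply: polyfunM.
Qed.

Lemma polyfun_det n (A : pt -> 'M[k]_n) :
  (forall i j, polyfun (fun x => A x i j)) -> polyfun (fun x => \det (A x)).
Proof.
move=> pA; apply: polyfun_sum => s; apply: polyfunM; first exact: polyfun_cst.
exact: polyfun_prod.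
Qed.

Lemma polyfun_rep_mx a i j : polyfun (fun x => rep_mx x a i j).
Proof.
rewrite (_ : (fun x => _) = fun x => x`_(enum_rank (Tagged _ (i, j) : rep_coord))).
  exact: polyfun_coord.
by apply/funext => x; rewrite mxE.
Qed.

Lemma polyfun_gl_det : polyfun gl_det.
Proof.
apply: polyfun_prod => i; apply: polyfun_det => r c.
rewrite (_ : (fun x => _) = fun x => x`_(enum_rank (Tagged _ (r, c) : gl_coord))).
  exact: polyfun_coord.
by apply/funext => x; rewrite mxE.
Qed.

Lemma setT_closed (X : space k) : closed_in X setT.
Proof.
rewrite /closed_in setDT.
have -> : set0 = \bigcup_(U in (set0 : set (set pt))) U by rewrite bigcup_set0.
exact: opens_bigcup.
Qed.

Definition GL_variety : variety k :=
  principal_subvariety (setT_closed (affine_space k gl_dim)) polyfun_gl_det.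

Lemma GL_variety_points x : GL_variety x <->
  size x = gl_dim /\ forall i, gl_mx x i \in unitmx.
Proof. by rewrite -gl_detE; split=> [[? []]|[]]. Qed.

Definition rep_pt (M : forall a : arrow Q, 'M[k]_(d (target a), d (source a))) : pt :=
  [seq M (tag c) (tagged c).1 (tagged c).2 | c <- enum rep_coord].

Lemma size_rep_pt M : size (rep_pt M) = rep_dim.
Proof. by rewrite size_map -cardE. Qed.

Lemma nth_rep_pt M (c : rep_coord) :
  (rep_pt M)`_(enum_rank c) = M (tag c) (tagged c).1 (tagged c).2.
Proof.
rewrite (nth_map c) -?cardE ?ltn_ord //.
by rewrite -[nth _ _ _]/(nth c (enum rep_coord) (enum_rank c)) nth_enum_rank.
Qed.

Lemma rep_ptK M a : rep_mx (rep_pt M) a = M a.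
Proof. by apply/matrixP => r c; rewrite mxE nth_rep_pt. Qed.

Lemma rep_mxK x : size x = rep_dim -> rep_pt (rep_mx x) = x.
Proof.
move=> sx; apply: (@eq_from_nth _ 0) => [|i]; rewrite size_rep_pt // => lti.
have -> : i = enum_rank (enum_val (Ordinal lti)) by rewrite enum_valK.
rewrite nth_rep_pt mxE; congr (x`_ (nat_of_ord (enum_rank _))).
by case: enum_val => a [r c].
Qed.

Lemma rep_mx0 a : rep_mx rep_zero a = 0.
Proof. by apply/matrixP => r c; rewrite !mxE nth_nseq if_same. Qed.

Definition gact (g : forall i, 'M[k]_(d i)) (M : forall a, _) a :
    'M[k]_(d (target a), d (source a)) :=
  g (target a) *m M a *m invmx (g (source a)).

Lemma orbitP x y : size x = rep_dim -> orbit x y <->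
  exists2 g : (forall i, 'M[k]_(d i)), (forall i, g i \in unitmx) &
    y = rep_pt (gact g (rep_mx x)).
Proof.
move=> sx; split=> [[sy [g gU H]]|[g gU ->]].
  exists g => //; rewrite -[LHS](rep_mxK sy); congr rep_pt.
  by apply: functional_extensionality_dep => a; apply: H.
split; first exact: size_rep_pt.
by exists g => // a; rewrite rep_ptK.
Qed.

Lemma nullsetP x : size x = rep_dim -> nullset x <->
  forall p, polyfun p ->
  (forall g, (forall i, g i \in unitmx) -> p (rep_pt (gact g (rep_mx x))) = 0) ->
  p rep_zero = 0.
Proof.
move=> sx; split=> [[_ [_ H]] p pp p0|H]; last first.
  split=> //; split=> [|U oU U0]; first by rewrite /= size_nseq.
  have /aff_opensP[_ /(_ _ U0)[p [pp /eqP p0 pU]]] := oU.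
  apply: contrapT => nE; apply: p0; apply: H => // g gU.
  apply: contrapT => /eqP pg; apply: nE.
  exists (rep_pt (gact g (rep_mx x))); split; first by apply/(orbitP _ sx); exists g.
  by apply: pU => //; apply: size_rep_pt.
apply: contrapT => /eqP pz.
have := H _ (polyfun_opens rep_dim pp) _.
case; first by split=> //; rewrite size_nseq.
move=> y [/(orbitP _ sx)[g gU ->] [_]].
by rewrite p0 ?eqxx.
Qed.

(* The total space: the direct sum of the vector spaces at the vertices. *)
Let T : finType := {i : vertex Q & 'I_(d i)}.
Let N := #|T|.
Let P (i : vertex Q) : 'M[k]_(d i, N) :=
  \matrix_(r, t) (t == enum_rank (Tagged (fun i => 'I_(d i)) r))%:R.

Fact PPt i : P i *m (P i)^T = 1%:M.
Proof.
apply/matrixP => r s; rewrite !mxE.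
rewrite (bigD1 (enum_rank (Tagged (fun i => 'I_(d i)) r : T))) //= !mxE eqxx mul1r.
rewrite big1 => [|t /negPf nt]; last by rewrite !mxE nt mul0r.
by rewrite addr0 (inj_eq enum_rank_inj) eq_Tagged.
Qed.

Fact PPt0 i j : i != j -> P i *m (P j)^T = 0.
Proof.
move=> ij; apply/matrixP => r s; rewrite !mxE big1 // => t _; rewrite !mxE.
case: eqP => [->|]; last by rewrite mul0r.
case: eqP => [/enum_rank_inj E|]; last by rewrite mulr0.
by move/(congr1 tag): E => /= E; rewrite E eqxx in ij.
Qed.

Fact PtP : \sum_i (P i)^T *m P i = 1%:M.
Proof.
apply/matrixP => s t; rewrite summxE mxE.
pose F (i : vertex Q) (r : 'I_(d i)) : k :=
  (s == enum_rank (Tagged (fun i => 'I_(d i)) r : T))%:R *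
  (t == enum_rank (Tagged (fun i => 'I_(d i)) r : T))%:R.
transitivity (\sum_i \sum_(r : 'I_(d i)) F i r).
  by apply: eq_bigr => i _; rewrite mxE; apply: eq_bigr => r _; rewrite !mxE.
rewrite sig_big_dep /= (bigD1 (enum_val s)) //= big1 ?addr0; last first.
  move=> [i r] /= nx; rewrite /F /=; case: eqP => [E|]; last by rewrite mul0r.
  by rewrite E enum_rankK eqxx in nx.
rewrite /F; have -> : Tagged (fun i => 'I_(d i)) (tagged (enum_val s)) = enum_val s.
  by case: (enum_val s).
by rewrite enum_valK eqxx mul1r eq_sym.
Qed.

Let emb (K : forall i, 'M[k]_(d i)) : 'M[k]_N := \sum_i (P i)^T *m K i *m P i.
Let arr (M : forall a : arrow Q, 'M[k]_(d (target a), d (source a))) a : 'M[k]_N :=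
  (P (target a))^T *m M a *m P (source a).

Fact emb_Pt K i : emb K *m (P i)^T = (P i)^T *m K i.
Proof.
rewrite mulmx_suml (bigD1 i) //= -!mulmxA PPt mulmx1 big1 ?addr0 // => j ji.
by rewrite -!mulmxA PPt0 // !mulmx0.
Qed.

Fact P_emb K i : P i *m emb K = K i *m P i.
Proof.
rewrite mulmx_sumr (bigD1 i) //= !mulmxA PPt mul1mx big1 ?addr0 // => j ji.
by rewrite !mulmxA PPt0 1?eq_sym // !mul0mx.
Qed.

Fact embM K L : emb K *m emb L = emb (fun i => K i *m L i).
Proof.
rewrite {2}/emb mulmx_sumr; apply: eq_bigr => i _.
by rewrite !mulmxA emb_Pt.
Qed.

Fact emb1 : emb (fun=> 1%:M) = 1%:M.
Proof. by rewrite -PtP; apply: eq_bigr => i _; rewrite mulmx1. Qed.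

(* Elements of the algebra spanned by nonempty words in the arrows. *)
Inductive word_comb : Type :=
| Arr of arrow Q
| WAdd of word_comb & word_comb
| WMul of word_comb & word_comb
| WScale of k & word_comb.

Fixpoint weval M (e : word_comb) : 'M[k]_N :=
  match e with
  | Arr a => arr M a
  | WAdd e f => weval M e + weval M f
  | WMul e f => weval M e *m weval M f
  | WScale c e => c *: weval M e
  end.

Let wdet M e : k := \det (1%:M - weval M e).

Fact weval_gact g M e : (forall i, g i \in unitmx) ->
  weval (gact g M) e = emb g *m weval M e *m emb (fun i => invmx (g i)).
Proof.
move=> gU; have VK : emb (fun i => invmx (g i)) *m emb g = 1%:M.
  rewrite embM -emb1; congr emb; apply: functional_extensionality_dep => i.
  by rewrite mulVmx.
elim: e => [a|e IHe f IHf|e IHe f IHf|c e IHe] /=.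
- by rewrite /arr /gact !mulmxA emb_Pt -!mulmxA P_emb.
- by rewrite IHe IHf mulmxDr mulmxDl.
- rewrite IHe IHf -!mulmxA; congr (_ *m (_ *m _)); rewrite !mulmxA.
  by rewrite VK mul1mx.
- by rewrite IHe -scalemxAr scalemxAl.
Qed.

Fact wdet_gact g M e : (forall i, g i \in unitmx) ->
  wdet (gact g M) e = wdet M e.
Proof.
move=> gU; rewrite /wdet weval_gact //.
have KV : emb g *m emb (fun i => invmx (g i)) = 1%:M.
  rewrite embM -emb1; congr emb; apply: functional_extensionality_dep => i.
  by rewrite mulmxV.
rewrite -{1}KV -{1}[emb g]mulmx1 -mulmxBl -mulmxBr !det_mulmx mulrAC.
by rewrite -det_mulmx KV det1 mul1r.
Qed.

Fact polyfun_wdet e : polyfun (fun x => wdet (rep_mx x) e).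
Proof.
have pE i j : polyfun (fun x => weval (rep_mx x) e i j).
  elim: e i j => [a|e IHe f IHf|e IHe f IHf|c e IHe] i j /=.
  - apply: polyfun_mulmx => [{}i {}j|s t]; last exact: polyfun_cst.
    apply: polyfun_mulmx => [s t|s t]; first exact: polyfun_cst.
    exact: polyfun_rep_mx.
  - rewrite (_ : (fun x => _) = fun x => weval (rep_mx x) e i j + weval (rep_mx x) f i j).
      exact: polyfunD.
    by apply/funext => x; rewrite mxE.
  - exact: polyfun_mulmx.
  - rewrite (_ : (fun x => _) = fun x => (fun=> c) x * weval (rep_mx x) e i j).
      by apply: polyfunM => //; apply: polyfun_cst.
    by apply/funext => x; rewrite mxE.
apply: polyfun_det => i j.
rewrite (_ : (fun x => _) = fun x => (fun=> (1%:M : 'M[k]_N) i j) x +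
   (fun=> -1) x * weval (rep_mx x) e i j).
  apply: polyfunD; first exact: polyfun_cst.
  by apply: polyfunM; [apply: polyfun_cst|].
by apply/funext => x; rewrite !mxE mulN1r.
Qed.

Let nilset : set pt := [set x | forall e, wdet (rep_mx x) e = 1].

Fact nilset_closed : closed_in rep_space nilset.
Proof.
pose S := [set p | exists e, p = fun x => wdet (rep_mx x) e + (fun=> -1) x].
have -> : nilset = [set x | forall p, S p -> p x = 0].
  apply/seteqP; split=> [x Hx p [e ->]|x Hx e]; first by rewrite Hx subrr.
  have /eqP := Hx (fun x => wdet (rep_mx x) e + (fun=> -1) x) (ex_intro _ e erefl).
  by rewrite subr_eq0 => /eqP.
apply: polyfun_closed => p [e ->]; apply: polyfunD; last exact: polyfun_cst.
exact: polyfun_wdet.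
Qed.

Fact wdet0 e : wdet (rep_mx rep_zero) e = 1.
Proof.
rewrite /wdet (_ : weval _ _ = 0) ?subr0 ?det1 //.
elim: e => [a|e IHe f IHf|e IHe f IHf|c e IHe] /=.
- by rewrite /arr rep_mx0 mulmx0 mul0mx.
- by rewrite IHe IHf addr0.
- by rewrite IHe mul0mx.
- by rewrite IHe scaler0.
Qed.

Fact nullset_nilset x : nullset x -> nilset x.
Proof.
move=> nx e; have [sx _] := nx; have := (nullsetP sx).1 nx.
move=> /(_ (fun y => wdet (rep_mx y) e + (fun=> - wdet (rep_mx x) e) y)).
rewrite /= wdet0 => H; apply/esym/eqP; rewrite -subr_eq0; apply/eqP; apply: H.
  by apply: polyfunD; [apply: polyfun_wdet|apply: polyfun_cst].
move=> g gU; rewrite (_ : rep_mx (rep_pt _) = gact g (rep_mx x)).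
  by rewrite wdet_gact // subrr.
by apply: functional_extensionality_dep => a; rewrite rep_ptK.
Qed.

Fact linear_rowspace (S : 'rV[k]_N -> Prop) :
  S 0 -> (forall c u v, S u -> S v -> S (c *: u + v)) ->
  exists A : 'M[k]_N, forall u, S u <-> (u <= A)%MS.
Proof.
move=> S0 SL.
pose R (r : nat) := exists2 A : 'M[k]_N, (forall u, (u <= A)%MS -> S u) & \rank A = r.
have R0 : exists r, `[< R r >].
  exists 0%N; apply/asboolP; exists 0; last exact: mxrank0.
  by move=> u; rewrite submx0 => /eqP ->.
have RN r : `[< R r >] -> (r <= N)%N by move=> /asboolP[A _ <-]; apply: rank_leq_row.
case: (ex_maxnP R0 RN) => r /asboolP[A AS rA] rmax; exists A => u; split; last exact: AS.
move=> Su; pose B : 'M[k]_N := (A + <<u>>)%MS.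
have BS v : (v <= B)%MS -> S v.
  case/sub_addsmxP => -[a b] /= ->; rewrite addrC.
  have : (b *m <<u>>%MS <= u)%MS by rewrite (submx_trans (submxMl _ _)) ?genmxE.
  case/sub_rVP => c ->; apply: SL => //; apply: AS; exact: submxMl.
have : (\rank B <= r)%N by apply: rmax; apply/asboolP; exists B.
rewrite -rA => rB; have : (B <= A)%MS by rewrite -(geq_leqif (mxrank_leqif_sup (addsmxSl _ _))).
by apply: submx_trans; rewrite (submx_trans _ (addsmxSr _ _)) ?genmxE.
Qed.

(* If all 1 - e are invertible, a proper subspace U stable under the arrows is
   strictly contained in the space of vectors mapped to U by all arrows. *)
Fact nil_step M (U : 'M[k]_N) : (forall e, wdet M e = 1) ->
  (forall a, (U *m arr M a <= U)%MS) -> (\rank U < N)%N ->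
  exists w : 'rV[k]_N, ~~ (w <= U)%MS /\ forall a, (w *m arr M a <= U)%MS.
Proof.
move=> det1M Ust rU.
have Ust' e : (U *m weval M e <= U)%MS.
  elim: e => [a|e IHe f IHf|e IHe f IHf|c e IHe] //=.
  - by rewrite mulmxDr addmx_sub.
  - by rewrite mulmxA (submx_trans (submxMr _ IHe)).
  - by rewrite -scalemxAr scalemx_sub.
suff H r (X : 'M[k]_N) : (\rank X <= r)%N -> (U < X)%MS ->
    (forall a, (X *m arr M a <= X)%MS) ->
    exists w : 'rV[k]_N, ~~ (w <= U)%MS /\ forall a, (w *m arr M a <= U)%MS.
  apply: (H N 1%:M); first exact: rank_leq_row.
    rewrite /ltmx submx1 /=; apply: contraL rU => /mxrankS.
    by rewrite mxrank1 -leqNgt.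
  by move=> a; apply: submx1.
elim: r X => [|r IHr] X rX UX Xst.
  move: rX UX; rewrite leqn0 mxrank_eq0 => /eqP ->.
  by rewrite /ltmx sub0mx andbF.
have [E|] := pselect (forall a, (X *m arr M a <= U)%MS).
  have /row_subPn[i wU] : ~~ (X <= U)%MS by move: UX; rewrite /ltmx => /andP[].
  exists (row i X); split=> // a; apply: submx_trans (E a).
  by rewrite submxMr // row_sub.
move=> /existsNP[a /negP XaU]; case/row_subPn: XaU => i; rewrite row_mul.
set w := row i X => waU.
have wX : (w <= X)%MS by rewrite row_sub.
have Xst' e : (X *m weval M e <= X)%MS.
  elim: e => [b|e IHe f IHf|e IHe f IHf|c e IHe] //=.
  - by rewrite mulmxDr addmx_sub.
  - by rewrite mulmxA (submx_trans (submxMr _ IHe)).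
  - by rewrite -scalemxAr scalemx_sub.
have [X' X'P] : exists A : 'M[k]_N, forall u,
    (exists2 v, (v <= U)%MS & exists e, u = v + w *m weval M e) <-> (u <= A)%MS.
  apply: linear_rowspace.
    exists 0; first exact: sub0mx.
    by exists (WScale 0 (Arr a)); rewrite /= scale0r mulmx0 addr0.
  move=> c u v [u' u'U [e ->]] [v' v'U [f ->]]; exists (c *: u' + v').
    by rewrite addmx_sub ?scalemx_sub.
  by exists (WAdd (WScale c e) f); rewrite /= mulmxDr -scalemxAr scalerDr addrACA.
have UX' : (U < X')%MS.
  rewrite /ltmx; apply/andP; split.
    apply/row_subP => j; apply/X'P; exists (row j U); first exact: row_sub.
    by exists (WScale 0 (Arr a)); rewrite /= scale0r mulmx0 addr0.
  apply: contra waU; apply: submx_trans; apply/X'P.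
  by exists 0; [exact: sub0mx|exists (Arr a); rewrite /= add0r].
have X'st b : (X' *m arr M b <= X')%MS.
  apply/row_subP => j; rewrite row_mul; apply/X'P.
  have /X'P[v vU [e ->]] := row_sub j X'.
  exists (v *m arr M b); first exact: submx_trans (submxMr _ vU) (Ust b).
  by exists (WMul e (Arr b)); rewrite /= mulmxDl mulmxA.
have X'X : (X' <= X)%MS.
  apply/row_subP => j; have /X'P[v vU [e ->]] := row_sub j X'.
  rewrite addmx_sub //; first by apply: submx_trans vU _; move: UX => /andP[].
  by rewrite (submx_trans (submxMr _ wX)).
have [lt|ge] := ltnP (\rank X') (\rank X).
  by apply: (IHr X') => //; rewrite -ltnS (leq_trans lt).
have XX' : (X <= X')%MS by rewrite -(geq_leqif (mxrank_leqif_sup X'X)).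
have /X'P[u uU [e wE]] := submx_trans wX XX'.
pose B : 'M[k]_N := 1%:M - weval M e.
have BU : B \in unitmx by rewrite unitmxE -[\det B]/(wdet M e) det1M unitr1.
have UB : (U *m B <= U)%MS by rewrite mulmxBr mulmx1 addmx_sub // eqmx_opp.
have UB' : (U <= U *m B)%MS.
  rewrite -(geq_leqif (mxrank_leqif_sup UB)) mxrankMfree //.
  by rewrite row_free_unit.
have wB : w *m B = u by rewrite mulmxBr mulmx1 {1}wE addrK.
have /submxP[D uD] := submx_trans uU UB'.
have wU : (w <= U)%MS.
  rewrite -[w](mulmxK BU) wB uD mulmxA mulmxK //; exact: submxMl.
by case/negP: waU; apply: submx_trans (submxMr _ wU) (Ust a).
Qed.

Fact polyfun_line p (A B : forall a : arrow Q, 'M[k]_(d (target a), d (source a))) :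
  polyfun p ->
  exists r : {poly k}, forall t, p (rep_pt (fun a => A a + t *: B a)) = r.[t].
Proof.
elim=> [c|i|q s _ [rq IHq] _ [rs IHs]|q s _ [rq IHq] _ [rs IHs]].
- by exists c%:P => t; rewrite hornerC.
- have [lti|gei] := ltnP i rep_dim; last first.
    by exists 0 => t; rewrite nth_default ?size_rep_pt // horner0.
  have -> : i = enum_rank (enum_val (Ordinal lti)) by rewrite enum_valK.
  move: (enum_val _) => c; exists ((A (tag c) (tagged c).1 (tagged c).2)%:P +
    (B (tag c) (tagged c).1 (tagged c).2)%:P * 'X) => t.
  by rewrite nth_rep_pt !mxE hornerD hornerC hornerM hornerC hornerX mulrC.
- by exists (rq + rs) => t; rewrite hornerD IHq IHs.
- by exists (rq * rs) => t; rewrite hornerM IHq IHs.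
Qed.

Fact poly_at0 (r : {poly k}) : (forall t, t != 0 -> r.[t] = 0) -> r.[0] = 0.
Proof.
move=> r0; have [->|rn0] := eqVneq r 0; first exact: horner0.
have : size (r * 'X + 1%:P) != 1.
  by rewrite size_MXaddC (negPf rn0) eqSS size_poly_eq0.
case/closed_rootP => t; rewrite rootE hornerD hornerM hornerX hornerC.
have [->|t0] := eqVneq t 0; first by rewrite mulr0 add0r oner_eq0.
by rewrite (r0 t t0) mul0r add0r oner_eq0.
Qed.

Fact line_at0 p (A B : forall a : arrow Q, 'M[k]_(d (target a), d (source a))) :
  polyfun p -> (forall t, t != 0 -> p (rep_pt (fun a => A a + t *: B a)) = 0) ->
  p (rep_pt A) = 0.
Proof.
move=> pp H; have [r rE] := polyfun_line A B pp.
have -> : A = fun a => A a + 0 *: B a.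
  by apply: functional_extensionality_dep => a; rewrite scale0r addr0.
by rewrite rE; apply: poly_at0 => t t0; rewrite -rE H.
Qed.

Let is_socle M (S : 'M[k]_N) := forall u : 'rV[k]_N,
  (forall a, u *m arr M a = 0) <-> (u <= S)%MS.

Fact socle_sub M S n (X : 'M[k]_(n, N)) : is_socle M S ->
  (forall a, X *m arr M a = 0) -> (X <= S)%MS.
Proof.
by move=> SP H; apply/row_subP => i; apply/SP => a; rewrite -row_mul H row0.
Qed.

Fact socle_arr M S n (X : 'M[k]_(n, N)) a : is_socle M S ->
  (X <= S)%MS -> X *m arr M a = 0.
Proof.
move=> SP XS; apply/row_matrixP => i; rewrite row_mul row0.
exact: ((SP _).2 (submx_trans (row_sub _ _) XS)).
Qed.

Fact arrE M a : P (target a) *m arr M a *m (P (source a))^T = M a.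
Proof. by rewrite !mulmxA PPt mul1mx -mulmxA PPt mulmx1. Qed.

Fact socle_full M S : is_socle M S -> (N <= \rank S)%N -> M = fun=> 0.
Proof.
move=> SP rS; apply: functional_extensionality_dep => a.
have S1 : (1%:M <= S)%MS by rewrite sub1mx /row_full eqn_leq rS rank_leq_row.
by rewrite -arrE -[arr M a]mul1mx (socle_arr a SP S1) mulmx0 mul0mx.
Qed.

Section Degeneration.
Variables (M : forall a : arrow Q, 'M[k]_(d (target a), d (source a))).
Variables (S : 'M[k]_N) (SP : is_socle M S).

Let Si i : 'M[k]_(N, d i) := S *m (P i)^T.
Let F i : 'M[k]_(d i) := pinvmx (Si i) *m Si i.

Fact socle_graded i : (Si i *m P i <= S)%MS.
Proof.
apply: (socle_sub SP) => a; rewrite /arr.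
have [->|ne] := eqVneq i (target a).
  have <- := socle_arr a SP (submx_refl S).
  by rewrite /arr !mulmxA -[Si _ *m P _ *m _]mulmxA PPt mulmx1.
by rewrite !mulmxA -[Si _ *m _ *m _]mulmxA PPt0 // mulmx0 !mul0mx.
Qed.

Fact SiF i : Si i *m F i = Si i.
Proof. by rewrite /F mulmxA mulmxKpV. Qed.

Fact F_idem i : F i *m F i = F i.
Proof. by rewrite {1}/F -mulmxA SiF. Qed.

Fact FM a : F (target a) *m M a = 0.
Proof.
have E : Si (target a) *m M a = S *m arr M a *m (P (source a))^T.
  by rewrite /arr /Si !mulmxA -[_ *m P (source a) *m _]mulmxA PPt mulmx1.
by rewrite /F -mulmxA E (socle_arr a SP) // mul0mx mulmx0.
Qed.

Fact S_emb : S *m emb F = S.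
Proof.
rewrite -[RHS]mulmx1 -PtP !mulmx_sumr; apply: eq_bigr => i _.
transitivity (Si i *m F i *m P i); first by rewrite /Si !mulmxA.
by rewrite SiF /Si mulmxA.
Qed.

Let M' a := M a *m (1%:M - F (source a)).

Fact arrM' a : arr M' a = arr M a *m (1%:M - emb F).
Proof.
rewrite /arr /M' -!mulmxA mulmxBr mulmx1 P_emb.
by rewrite [(1%:M - _) *m _]mulmxBl mul1mx.
Qed.

Let gt t i : 'M[k]_(d i) := t^-1 *: F i + (1%:M - F i).

Fact F1F i : F i *m (1%:M - F i) = 0.
Proof. by rewrite mulmxBr mulmx1 F_idem subrr. Qed.

Fact FF1 i : (1%:M - F i) *m F i = 0.
Proof. by rewrite mulmxBl mul1mx F_idem subrr. Qed.

Fact gtV t i : t != 0 -> gt t i *m gt t^-1 i = 1%:M.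
Proof.
move=> t0; rewrite /gt invrK.
have BB : (1%:M - F i) *m (1%:M - F i) = 1%:M - F i.
  by rewrite {1}mulmxBl mul1mx F1F subr0.
have AB := F1F i; have BA := FF1 i; have AA := F_idem i.
have S1 : F i + (1%:M - F i) = 1%:M by rewrite addrC subrK.
move: (F i) (1%:M - F i) AA AB BA BB S1 => A B AA AB BA BB S1.
rewrite mulmxDl !mulmxDr -!scalemxAl -!scalemxAr AA AB BA BB.
by rewrite !scaler0 add0r addr0 scalerA mulVf // scale1r.
Qed.

Fact gt_unit t i : t != 0 -> gt t i \in unitmx.
Proof. by move=> t0; case/mulmx1_unit: (gtV i t0). Qed.

Fact gt_inv t i : t != 0 -> invmx (gt t i) = gt t^-1 i.
Proof.
by move=> t0; rewrite -[LHS]mulmx1 -(gtV i t0) mulmxA mulVmx ?mul1mx ?gt_unit.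
Qed.

Fact gact_gt t : t != 0 ->
  gact (gt t) M = fun a => M' a + t *: (M a *m F (source a)).
Proof.
move=> t0; apply: functional_extensionality_dep => a.
rewrite /gact gt_inv // {1}/gt mulmxDl -scalemxAl mulmxBl FM mul1mx.
rewrite scaler0 add0r subr0 /gt invrK mulmxDr -scalemxAr addrC.
by rewrite /M'.
Qed.

Fact wdetM' : (forall e, wdet M e = 1) -> forall e, wdet M' e = 1.
Proof.
move=> H e; apply/eqP; rewrite -subr_eq0; apply/eqP.
have := @line_at0 (fun x => wdet (rep_mx x) e + (fun=> -1) x) M'
  (fun a => M a *m F (source a)).
have E X : rep_mx (rep_pt X) = X.
  by apply: functional_extensionality_dep => a; rewrite rep_ptK.
rewrite /= E; apply.
  by apply: polyfunD; [apply: polyfun_wdet|apply: polyfun_cst].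
move=> t t0; rewrite E -gact_gt // wdet_gact; last by move=> i; apply: gt_unit.
by rewrite H subrr.
Qed.

Fact invmx_mul n (A B : 'M[k]_n) : A \in unitmx -> B \in unitmx ->
  invmx (A *m B) = invmx B *m invmx A.
Proof.
move=> AU BU; have ABU : A *m B \in unitmx by rewrite unitmx_mul AU.
rewrite -[LHS]mulmx1 -[1%:M](mulmxV AU) -{2}[A](mulmxK BU) -!mulmxA.
by rewrite [A *m (B *m _)]mulmxA mulKmx.
Qed.

Fact orbitM' p : polyfun p ->
  (forall g, (forall i, g i \in unitmx) -> p (rep_pt (gact g M)) = 0) ->
  forall g, (forall i, g i \in unitmx) -> p (rep_pt (gact g M')) = 0.
Proof.
move=> pp H g gU.
apply: (@line_at0 p _ (gact g (fun a => M a *m F (source a))) pp) => t t0.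
have := H (fun i => g i *m gt t i) _.
rewrite (_ : gact _ _ = gact g (gact (gt t) M)).
  rewrite gact_gt // => H1.
  rewrite -[RHS]H1; last by move=> i; rewrite unitmx_mul gU gt_unit.
  congr (p (rep_pt _)); apply: functional_extensionality_dep => a.
  by rewrite /gact mulmxDr mulmxDl -scalemxAr -scalemxAl.
apply: functional_extensionality_dep => a.
by rewrite /gact invmx_mul ?gt_unit // !mulmxA.
Qed.

Fact socleM' : (forall e, wdet M e = 1) -> (\rank S < N)%N ->
  exists2 S', is_socle M' S' & (\rank S < \rank S')%N.
Proof.
move=> detM rS.
have [S' S'P] : exists S' : 'M[k]_N, is_socle M' S'.
  apply: linear_rowspace => [a|c u v Hu Hv a]; first exact: mul0mx.
  by rewrite mulmxDl -scalemxAl Hu Hv scaler0 addr0.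
have [a|w [wS wP]] := nil_step detM _ rS.
  by rewrite (socle_arr a SP) // sub0mx.
exists S' => //; apply: rank_ltmx.
have SS' : (S <= S')%MS.
  by apply: (socle_sub S'P) => a; rewrite arrM' mulmxA (socle_arr a SP) ?mul0mx.
rewrite /ltmx SS' /=; apply: contra wS; apply: submx_trans; apply/S'P => a.
rewrite arrM' mulmxA mulmxBr mulmx1; have /submxP[D ->] := wP a.
by rewrite -mulmxA S_emb subrr.
Qed.

End Degeneration.

Fact nilset_orbit m M S : (forall e, wdet M e = 1) -> is_socle M S ->
  (N - \rank S <= m)%N -> forall p, polyfun p ->
  (forall g, (forall i, g i \in unitmx) -> p (rep_pt (gact g M)) = 0) ->
  p rep_zero = 0.
Proof.
elim: m M S => [|m IHm] M S detM SP rS p pp p0;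
    have [NS|SN] := leqP N (\rank S).
- have -> : rep_zero = rep_pt (gact (fun=> 1%:M) M).
    rewrite -[LHS]rep_mxK ?size_nseq //; congr rep_pt.
    apply: functional_extensionality_dep => a.
    by rewrite rep_mx0 /gact (socle_full SP NS) mulmx0 mul0mx.
  by apply: p0 => i; apply: unitmx1.
- by move: rS; rewrite leqn0 subn_eq0 leqNgt SN.
- have -> : rep_zero = rep_pt (gact (fun=> 1%:M) M).
    rewrite -[LHS]rep_mxK ?size_nseq //; congr rep_pt.
    apply: functional_extensionality_dep => a.
    by rewrite rep_mx0 /gact (socle_full SP NS) mulmx0 mul0mx.
  by apply: p0 => i; apply: unitmx1.
have [S' S'P rS'] := socleM' SP detM SN.
apply: (IHm _ S' (wdetM' SP detM) S'P) (orbitM' SP pp p0) => //.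
rewrite -ltnS (leq_trans _ rS) // ltn_sub2l //.
Qed.

Fact nullset_closed : closed_in rep_space nullset.
Proof.
have := nilset_closed; rewrite /closed_in; congr opens.
apply/seteqP; split=> x [sx nx]; split=> // H; apply: nx.
  exact: nullset_nilset.
apply/(nullsetP sx).
have [S SP] : exists S, is_socle (rep_mx x) S.
  apply: linear_rowspace => [a|c u v Hu Hv a]; first exact: mul0mx.
  by rewrite mulmxDl -scalemxAl Hu Hv scaler0 addr0.
exact: nilset_orbit H SP (leqnn _).
Qed.

Definition nullcone : variety k := closed_subvariety nullset_closed.


Lemma nullcone_points x : nullcone x <-> nullset x.
Proof. by split=> [[]|nx] //; split=> //; case: nx. Qed.

End Representations.

Definition qpoch {A : comPzRingType} (q : A) (n : nat) : A :=
  \prod_(1 <= i < n.+1) (1 - q ^+ i).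

Definition qpochd {A : comPzRingType} (Q : quiver) (q : A) (d : dimvec Q) : A :=
  \prod_i qpoch q (d i).

Lemma qpochd_inv (k : closedFieldType) (Q : quiver) (d : dimvec Q) :
  qpochd (LL k) d * minv (qpochd (LL k) d) = 1.
Proof.
pose isunit (x : Mot k) := exists y, x * y = 1.
suff [y yE] : isunit (qpochd (LL k) d) by apply: mul_inv yE.
have M (x y : Mot k) : isunit x -> isunit y -> isunit (x * y).
  by move=> [x' xE] [y' yE]; exists (x' * y'); rewrite mulrACA xE yE mulr1.
have U1 : isunit 1 by exists 1; rewrite mulr1.
apply: (big_ind isunit) => // i _; rewrite /qpoch big_nat_cond.
apply: (big_ind isunit) => // j /andP[/andP[j1 _] _].
have [y yE] := @to_loc_inv _ (@mot_den k) (1 - K0_L k ^+ j)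
  (or_intror (ex_intro2 _ _ j j1 erefl)).
by exists y; rewrite -[RHS]yE rmorphB rmorph1 rmorphXn.
Qed.

(* The series with coefficient a d at t^d, i.e. the sum of the a d t^d. *)
Definition twseries (k : closedFieldType) (Q : quiver) (a : dimvec Q -> Mot k) :
  twps k Q := a.

(* Main.v *)
(* Count pairs (M, W), where M is in the nullcone and W is a family of
   f_i-dimensional spaces of linear forms on the V_i vanishing on the images of
   all arrows.  For fixed W the representation M has block form [A B; 0 0] with
   A in the nullcone for e = d - f and B arbitrary, so such pairs contribute the
   (f, e) term of the product of the two series, taken in the opposite order.
   For fixed M with cokernel dimensions s_i the weighted sum over W factors into
   alternating q-binomial sums, one for each vertex, which vanish as soon as
   some s_i > 0; nilpotency gives such an i when d <> 0.

   Grassmannians are avoided by replacing W with a full frame g in G_d whose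
   last rows span W, and the local triviality of the bundles involved by cutting
   the base into pieces on which each minor is zero or nowhere zero. *)

Require Import Defs.
From mathcomp Require Import all_boot all_order all_algebra.
From mathcomp Require Import reals complex.
From mathcomp Require Import boolp classical_sets.
Import Defs.

Set Implicit Arguments.
Unset Strict Implicit.
Unset Printing Implicit Defensive.

Import GRing.Theory.
Local Open Scope classical_set_scope.
Local Open Scope ring_scope.

(** * Locally closed sets and their classes *)

(** The order is reversed because minus the Euler form of f and e contains the number of entries of
    B, which maps the f-part at each source to the e-part at each target. The remaining factors
    L^(-sum f_i e_i) and 1/[GL_e] cancel the choices of the first e rows of the frame, once the
    identity has been multiplied by the unit [G_d]. What is left at each vertex is 1/(L)_f times the
    product of the L^s - L^l for l < f, that is, (-1)^f L^(f(f-1)/2) times a q-binomial coefficient;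
    the signs come from the factors 1 - L^i of (L)_f.

    The Grothendieck ring offers only isomorphism, scissor and product relations, so every bundle
    has to be trivialised by an explicit pair of inverse regular maps. Nilpotency is used in the
    form det(1 - w) = 1 for all combinations w of nonempty words in the arrows: this is polynomial,
    invariant under conjugation, and passes to the block A by det(1 - XY) = det(1 - YX). *)

Arguments polyfun_cst {k} c.
Arguments polyfun_reg {k} n [p] _.
Arguments polyfun_coord {k} i.

Section Coordinates.
Variable k : closedFieldType.

(* A type identified with the affine space k^n by a choice of coordinates. *)
Structure cspace := CSpace {
  csort :> Type;
  cdim : nat;
  cenc : csort -> seq k;
  cdec : seq k -> csort;
  size_cenc : forall x, size (cenc x) = cdim;
  cencK : cancel cenc cdec;
  cdecK : forall s, size s = cdim -> cenc (cdec s) = s }.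

(** A single fraction on all of [W] suffices: the inverses that occur are those of determinants, and
    the bases are cut until these vanish nowhere. *)
Definition rfun (T : cspace) (W : set T) (f : T -> k) : Prop :=
  exists p q, [/\ polyfun p, polyfun q &
    forall x, W x -> q (cenc x) != 0 /\ f x = p (cenc x) / q (cenc x)].

Definition rmap (T T' : cspace) (W : set T) (phi : T -> T') : Prop :=
  forall i, rfun W (fun x => (cenc (phi x))`_i).

(* Locally closed sets: the equations [S] may be infinite in number, but the
   open part is covered by finitely many principal opens. *)
Definition lc (T : cspace) (W : set T) : Prop :=
  exists (S : set (seq k -> k)) (I : finType) (F : I -> seq k -> k),
  [/\ S `<=` @polyfun k, forall i, polyfun (F i) &
      forall x, W x <-> (forall p, S p -> p (cenc x) = 0) /\
                        exists i, F i (cenc x) != 0].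

Definition space_of (T : cspace) (W : set T) : space k :=
  sub (affine_space k (cdim T)) [set y | W (cdec T y)].

(* The class of [W] in the ring of motives; junk value 0 if [W] is no variety. *)
Definition cl (T : cspace) (W : set T) : Mot k :=
  if pselect (is_variety (space_of W)) is left H then motive (Variety H) else 0.

(** * Fractions with nowhere vanishing denominator *)

Section RegularFunctions.
Variables (T : cspace) (W : set T).
Implicit Types f g : T -> k.

Lemma rfun_ext f g : (forall x, W x -> f x = g x) -> rfun W g -> rfun W f.
Proof.
move=> fg [p [q [pp pq H]]]; exists p, q; split=> // x Wx.
by have [? <-] := H x Wx; rewrite fg.
Qed.

Lemma rfun_sub (V : set T) f : W `<=` V -> rfun V f -> rfun W f.
Proof.
by move=> WV [p [q [pp pq H]]]; exists p, q; split=> // x /WV/H.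
Qed.

Lemma rfun_poly p : polyfun p -> rfun W (fun x => p (cenc x)).
Proof.
move=> pp; exists p, (fun=> 1); split=> //; first exact: polyfun_cst.
by move=> x _; rewrite oner_neq0 divr1.
Qed.

Lemma rfun_cst c : rfun W (fun=> c).
Proof. exact: (@rfun_poly (fun=> c)) (polyfun_cst c). Qed.

Lemma rfunD f g : rfun W f -> rfun W g -> rfun W (fun x => f x + g x).
Proof.
move=> [p [q [pp pq H]]] [p' [q' [pp' pq' H']]].
exists (fun x => p x * q' x + p' x * q x), (fun x => q x * q' x); split.
- by apply: polyfunD; apply: polyfunM.
- exact: polyfunM.
- move=> x Wx; have [q0 ->] := H x Wx; have [q0' ->] := H' x Wx.
  by rewrite mulf_neq0 // addf_div.
Qed.

Lemma rfunM f g : rfun W f -> rfun W g -> rfun W (fun x => f x * g x).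
Proof.
move=> [p [q [pp pq H]]] [p' [q' [pp' pq' H']]].
exists (fun x => p x * p' x), (fun x => q x * q' x); split; try exact: polyfunM.
move=> x Wx; have [q0 ->] := H x Wx; have [q0' ->] := H' x Wx.
by rewrite mulf_neq0 // mulf_div.
Qed.

Lemma rfunN f : rfun W f -> rfun W (fun x => - f x).
Proof.
move=> rf; apply: (@rfun_ext _ (fun x => (-1) * f x)) => [x _|].
  by rewrite mulN1r.
by apply: rfunM => //; apply: rfun_cst.
Qed.

Lemma rfunV f : rfun W f -> (forall x, W x -> f x != 0) ->
  rfun W (fun x => (f x)^-1).
Proof.
move=> [p [q [pp pq H]]] f0; exists q, p; split=> // x Wx.
have [q0 fE] := H x Wx; have := f0 x Wx; rewrite fE invf_div mulf_eq0 negb_or.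
by case/andP.
Qed.

Lemma rfun_big (I : Type) (r : seq I) (P : pred I) (F : I -> T -> k) :
  (forall i, rfun W (F i)) -> rfun W (fun x => \sum_(i <- r | P i) F i x).
Proof.
move=> H; elim: r => [|i r IHr].
  by apply: (@rfun_ext _ (fun=> 0)) => [x _|]; [rewrite big_nil|apply: rfun_cst].
apply: (@rfun_ext _ (fun x => (if P i then F i x else 0) +
                              \sum_(j <- r | P j) F j x)).
  by move=> x _; rewrite big_cons; case: ifP; rewrite ?add0r.
by apply: rfunD => //; case: (P i) => //; apply: rfun_cst.
Qed.

Lemma rfun_prod (I : Type) (r : seq I) (P : pred I) (F : I -> T -> k) :
  (forall i, rfun W (F i)) -> rfun W (fun x => \prod_(i <- r | P i) F i x).
Proof.
move=> H; elim: r => [|i r IHr].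
  by apply: (@rfun_ext _ (fun=> 1)) => [x _|]; [rewrite big_nil|apply: rfun_cst].
apply: (@rfun_ext _ (fun x => (if P i then F i x else 1) *
                              \prod_(j <- r | P j) F j x)).
  by move=> x _; rewrite big_cons; case: ifP; rewrite ?mul1r.
by apply: rfunM => //; case: (P i) => //; apply: rfun_cst.
Qed.

Lemma rmap_polyfun (T' : cspace) (phi : T -> T') p :
  rmap W phi -> polyfun p -> rfun W (fun x => p (cenc (phi x))).
Proof.
move=> rphi; elim=> [c|i|q r _ IHq _ IHr|q r _ IHq _ IHr].
- exact: rfun_cst.
- exact: rphi.
- exact: rfunD.
- exact: rfunM.
Qed.

Lemma rfun_comp (T' : cspace) (W' : set T') (phi : T -> T') (g' : T' -> k) :
  rmap W phi -> (forall x, W x -> W' (phi x)) -> rfun W' g' ->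
  rfun W (fun x => g' (phi x)).
Proof.
move=> rphi WW' [p [q [pp pq H]]].
apply: (@rfun_ext _ (fun x => p (cenc (phi x)) * (q (cenc (phi x)))^-1)).
  by move=> x /WW'/H[].
apply: rfunM; first exact: rmap_polyfun.
by apply: rfunV; [apply: rmap_polyfun|move=> x /WW'/H[]].
Qed.

Lemma rmap_id : rmap W id.
Proof. by move=> i; apply: (rfun_poly (polyfun_coord i)). Qed.

Lemma rmap_cst (T' : cspace) (c : T') : rmap W (fun=> c).
Proof. by move=> i; apply: rfun_cst. Qed.

End RegularFunctions.

Lemma rmap_comp (T T' T'' : cspace) (W : set T) (W' : set T') (phi : T -> T')
    (psi : T' -> T'') : rmap W phi -> (forall x, W x -> W' (phi x)) ->
  rmap W' psi -> rmap W (fun x => psi (phi x)).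
Proof. by move=> rphi WW' rpsi i; apply: rfun_comp rphi WW' (rpsi i). Qed.

Lemma rmap_sub (T T' : cspace) (W V : set T) (phi : T -> T') :
  W `<=` V -> rmap V phi -> rmap W phi.
Proof. by move=> WV H i; apply: rfun_sub (H i). Qed.

Section LocallyClosed.
Variable T : cspace.
Implicit Types W V : set T.

Lemma lcT : lc (@setT T).
Proof.
exists set0, unit, (fun _ _ => 1); split=> //; first by move=> _; apply: polyfun_cst.
by move=> x; split=> // _; split=> //; exists tt; apply: oner_neq0.
Qed.

Lemma rfun_choice W (J : Type) (g : J -> T -> k) : (forall j, rfun W (g j)) ->
  exists pq : J -> (seq k -> k) * (seq k -> k), forall j,
    [/\ polyfun (pq j).1, polyfun (pq j).2 & forall x, W x ->
      (pq j).2 (cenc x) != 0 /\ g j x = (pq j).1 (cenc x) / (pq j).2 (cenc x)].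
Proof.
move=> rg; pose P j (pq : (seq k -> k) * (seq k -> k)) :=
  [/\ polyfun pq.1, polyfun pq.2 & forall x, W x ->
    pq.2 (cenc x) != 0 /\ g j x = pq.1 (cenc x) / pq.2 (cenc x)].
have [|pq pqP] := @choice _ _ P; last by exists pq.
by move=> j; have [p [q H]] := rg j; exists (p, q).
Qed.

Lemma lc0 : lc (@set0 T).
Proof.
exists set0, void, (fun _ _ => 0); split=> //.
by move=> x; split=> [[]|[_ [[]]]].
Qed.

Lemma lc_zero W (J : Type) (g : J -> T -> k) : lc W ->
  (forall j, rfun W (g j)) -> lc [set x | W x /\ forall j, g j x = 0].
Proof.
move=> [S [I [F [Sp pF WE]]]] rg.
have [pq pqP] := rfun_choice rg.
exists (S `|` [set p | exists j, p = (pq j).1]), I, F; split=> //.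
  by move=> p [/Sp//|[j ->]]; have [] := pqP j.
move=> x; split=> [[Wx gx]|[H1 H2]].
  have [H1 H2] := (WE x).1 Wx; split=> // p [/H1//|[j ->]].
  have [_ _ /(_ x Wx)[q0]] := pqP j; rewrite gx => /esym/eqP.
  by rewrite mulf_eq0 invr_eq0 (negPf q0) orbF => /eqP.
have Wx : W x by apply/WE; split=> // p Sp'; apply: H1; left.
split=> // j; have [_ _ /(_ x Wx)[_ ->]] := pqP j.
by rewrite (H1 (pq j).1) ?mul0r //; right; exists j.
Qed.

Lemma lc_neq0 W (J : finType) (g : J -> T -> k) : lc W ->
  (forall j, rfun W (g j)) -> lc [set x | W x /\ exists j, g j x != 0].
Proof.
move=> [S [I [F [Sp pF WE]]]] rg.
have [pq pqP] := rfun_choice rg.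
exists S, (I * J)%type, (fun ij x => F ij.1 x * (pq ij.2).1 x); split=> //.
  by move=> [i j] /=; apply: polyfunM => //; have [] := pqP j.
move=> x; split=> [[Wx [j gx]]|[H1 [[i j] /=]]].
  have [H1 [i Fi]] := (WE x).1 Wx; split=> //; exists (i, j) => /=.
  have [_ _ /(_ x Wx)[q0 gE]] := pqP j; move: gx; rewrite gE mulf_eq0 negb_or.
  by case/andP => p0 _; rewrite mulf_neq0.
rewrite mulf_eq0 negb_or => /andP[Fi pj].
have Wx : W x by apply/WE; split=> //; exists i.
split=> //; exists j; have [_ _ /(_ x Wx)[q0 ->]] := pqP j.
by rewrite mulf_neq0 ?invr_eq0.
Qed.

Lemma lc_zero1 W g : lc W -> rfun W g -> lc [set x | W x /\ g x = 0].
Proof.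
move=> lW rg; have := lc_zero lW (fun _ : unit => rg).
congr lc; apply/seteqP; split=> x [Wx H]; split=> //; exact: H tt.
Qed.

Lemma lc_neq01 W g : lc W -> rfun W g -> lc [set x | W x /\ g x != 0].
Proof.
move=> lW rg; have := lc_neq0 lW (fun _ : unit => rg).
congr lc; apply/seteqP; split=> x [Wx]; first by case=> _ H; split.
by move=> H; split=> //; exists tt.
Qed.

Lemma lc_preim (T' : cspace) (W' : set T') (phi : T -> T') :
  rmap setT phi -> lc W' -> lc [set x | W' (phi x)].
Proof.
move=> rphi [S [I [F [Sp pF WE]]]].
have l1 := @lc_zero setT {p | S p} (fun p x => sval p (cenc (phi x))) lcT
  (fun p => rmap_polyfun rphi (Sp _ (svalP p))).
have := lc_neq0 l1 (fun i => rmap_polyfun (rmap_sub (@subsetT _ _) rphi) (pF i)).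
congr lc; apply/seteqP; split=> x /=.
  move=> [[_ H1] H2]; apply/WE; split=> // p Spp; exact: (H1 (exist _ p Spp)).
by move=> /WE[H1 H2]; split=> //; split=> // -[p Spp] /=; apply: H1.
Qed.

Lemma lcI W V : lc W -> lc V -> lc (W `&` V).
Proof.
move=> lW [S [I [F [Sp pF VE]]]].
have l1 := @lc_zero W {p | S p} (fun p x => sval p (cenc x)) lW
  (fun p => rfun_poly _ (Sp _ (svalP p))).
have := lc_neq0 l1 (fun i => rfun_poly _ (pF i)).
congr lc; apply/seteqP; split=> x /=.
  move=> [[Wx H1] H2]; split=> //; apply/VE; split=> // p Spp.
  exact: (H1 (exist _ p Spp)).
by move=> [Wx /VE[H1 H2]]; split=> //; split=> // -[p Spp] /=; apply: H1.
Qed.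

End LocallyClosed.

(** * Motivic classes: invariance and cutting *)

Section Spaces.

Lemma sub_affine_separated n (W : set (seq k)) : separated (sub (affine_space k n) W).
Proof.
move=> T f g mf mg.
exact: coord_closed (morphism_comp mf (morphism_incl _ _))
                    (morphism_comp mg (morphism_incl _ _)).
Qed.

Lemma iso_sub_sub (X : space k) (W V U : set (seq k)) :
  (forall x, X x -> (W x /\ V x) <-> U x) ->
  isomorphic (sub (sub X W) V) (sub X U).
Proof.
move=> H; exists id, id; split=> //.
  apply: morphism_sub.
    exact: morphism_comp (morphism_incl _ _) (morphism_incl _ _).
  by move=> x [[Xx Wx] Vx]; apply/H.
apply: morphism_sub; first apply: morphism_sub; first exact: morphism_incl.
  by move=> x [Xx /(H x Xx)[]].
by move=> x [Xx /(H x Xx)[]].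
Qed.

Lemma space_rfun (T : cspace) (W : set T) f : rfun W f ->
  reg (space_of W) (space_of W) (fun y => f (cdec T y)).
Proof.
move=> [p [q [pp pq H]]]; have oT := opensT (space_of W).
have rp r : polyfun r -> reg (space_of W) (space_of W) r.
  move=> pr; exact: reg_morphism (morphism_incl _ _) (polyfun_reg _ pr).
apply: (@reg_ext _ _ _ _ (fun y => p y * (q y)^-1)) => //.
  by move=> y [sy Wy]; have [_ ->] := H _ Wy; rewrite cdecK.
apply: regM; [exact: oT|exact: rp|].
have := regV oT (rp _ pq); congr (reg _ _ _).
apply/seteqP; split=> [y []//|y Xy]; split=> //.
by have [sy Wy] := Xy; have [] := H _ Wy; rewrite cdecK.
Qed.

Lemma space_rmap (T T' : cspace) (W : set T) (W' : set T') (phi : T -> T') :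
  rmap W phi -> (forall x, W x -> W' (phi x)) ->
  morphism (space_of W) (space_of W') (fun y => cenc (phi (cdec T y))).
Proof.
move=> rphi WW'; apply: morphism_sub.
  apply: morphism_affine => [x _|i]; first exact: size_cenc.
  exact: space_rfun (rphi i).
by move=> y [sy Wy] /=; rewrite cencK; apply: WW'.
Qed.

(** The closed set [Z] of the equations is covered, as far as [W] reaches, by finitely many
    principal opens, each affine because the inverse of F_i can be adjoined as a coordinate. *)
Lemma lc_variety (T : cspace) (W : set T) : lc W -> is_variety (space_of W).
Proof.
move=> [S [I [F [Sp pF WE]]]]; split; first exact: sub_affine_separated.
pose Z : set (seq k) := [set x | forall p, S p -> p x = 0].
exists #|I|, (fun j => [set y | space_of W y /\ F (enum_val j) y != 0]); split.
  move=> j; split.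
    apply: opens_neq0; first exact: opensT.
    exact: reg_morphism (morphism_incl _ _) (polyfun_reg _ (pF _)).
  have cZ : closed_in (affine_space k (cdim T)) Z by apply: polyfun_closed.
  have [n [V [cV iV]]] := affine_principal cZ (pF (enum_val j)).
  exists n, V; split=> //; apply: isomorphic_trans iV.
  apply: iso_sub_sub => y sy /=; split=> [[/WE[H _] [_ Fy]]|[Zy Fy]].
    by split=> // p /H; rewrite cdecK.
  have Wy : W (cdec T y).
    by apply/WE; rewrite cdecK //; split=> //; exists (enum_val j).
  by split.
move=> y Xy; have [/= sy /WE[_]] := Xy; rewrite cdecK // => -[i Fi].
by exists (enum_rank i); split=> //; rewrite enum_rankK.
Qed.

Lemma motive_iso (X Y : variety k) : isomorphic X Y -> motive X = motive Y.
Proof.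
by move=> i; congr to_loc; apply/class_ofP/cong_rel/K0_iso.
Qed.

(** [cl] uses whatever proof of [is_variety] is returned by [pselect]; isomorphism invariance makes
    the value independent of it. *)
Lemma clE (T : cspace) (W : set T) (X : variety k) : lc W ->
  isomorphic X (space_of W) -> cl W = motive X.
Proof.
move=> /lc_variety v i; rewrite /cl; case: pselect => // H.
exact/motive_iso/isomorphic_sym.
Qed.

Lemma cl_iso (T T' : cspace) (W : set T) (W' : set T') (phi : T -> T')
    (psi : T' -> T) : lc W -> lc W' -> rmap W phi -> rmap W' psi ->
  (forall x, W x -> W' (phi x) /\ psi (phi x) = x) ->
  (forall y, W' y -> W (psi y) /\ phi (psi y) = y) -> cl W = cl W'.
Proof.
move=> lW lW' rphi rpsi H H'.
have v' := lc_variety lW'; rewrite [RHS](@clE _ _ (Variety v')) //; last first.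
  exact: isomorphic_refl.
apply: clE => //; apply: isomorphic_sym.
exists (fun y => cenc (phi (cdec T y))), (fun y => cenc (psi (cdec T' y))); split.
- by apply: space_rmap => // x /H[].
- by apply: space_rmap => // x /H'[].
- by move=> y [sy /H[_ E]]; rewrite cencK E cdecK.
- by move=> y [sy /H'[_ E]]; rewrite cencK E cdecK.
Qed.

Lemma cl_split (T : cspace) (W : set T) (J : finType) (g : J -> T -> k) :
  lc W -> (forall j, rfun W (g j)) ->
  cl W = cl [set x | W x /\ forall j, g j x = 0] +
         cl [set x | W x /\ exists j, g j x != 0].
Proof.
move=> lW rg; have l1 := lc_zero lW rg; have l2 := lc_neq0 lW rg.
rewrite (@clE _ _ (Variety (lc_variety lW)) lW (isomorphic_refl _)).
rewrite (@clE _ _ (Variety (lc_variety l1)) l1 (isomorphic_refl _)).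
rewrite (@clE _ _ (Variety (lc_variety l2)) l2 (isomorphic_refl _)).
rewrite /motive -rmorphD /=; congr to_loc.
rewrite /K0_class -class_ofD; apply/class_ofP/cong_rel.
apply: (@K0_scissor _ _ _ _ [set y | forall j, g j (cdec T y) = 0]).
- rewrite /closed_in; apply: opens_local => y [Xy /existsNP[j /eqP gy]].
  exists [set z | space_of W z /\ g j (cdec T z) != 0]; split=> //.
    by apply: opens_neq0 (opensT _) _; apply: space_rfun.
  by move=> z [Xz gz]; split=> // /(_ j) E; rewrite E eqxx in gz.
- exact/isomorphic_sym/iso_sub_sub.
- apply/isomorphic_sym/iso_sub_sub => y sy /=; split=> -[Wy].
    by move=> /existsNP[j /eqP gy]; split=> //; exists j.
  by move=> [j gy]; split=> // /(_ j) E; rewrite E eqxx in gy.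
Qed.

Lemma cl_split1 (T : cspace) (W : set T) g : lc W -> rfun W g ->
  cl W = cl [set x | W x /\ g x = 0] + cl [set x | W x /\ g x != 0].
Proof.
move=> lW rg; rewrite (cl_split lW (fun _ : unit => rg)).
congr (_ + _); congr cl; apply/seteqP; split=> x [Wx].
- by move=> H; split=> //; apply: H tt.
- by move=> H; split.
- by case=> _ H; split.
- by move=> H; split=> //; exists tt.
Qed.

(** For empty [W] both pieces of a cut are [W] again, so its class c satisfies c = c + c. *)
Lemma cl0 (T : cspace) (W : set T) : (forall x, ~ W x) -> cl W = 0.
Proof.
move=> W0; have lW : lc W.
  have -> : W = set0 by apply/seteqP; split=> x; [move=> /W0[]|].
  exact: lc0.
have := cl_split1 lW (rfun_cst W 0).
have E (V : set T) : (forall x, ~ V x) -> V = W.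
  by move=> V0; apply/seteqP; split=> x; [move=> /V0[]|move=> /W0[]].
rewrite (E [set x | W x /\ _]) => [|x [/W0]//].
rewrite (E [set x | W x /\ _]) => [/eqP|x [/W0]//].
by rewrite -[X in X == _]addr0 (inj_eq (addrI _)) eq_sym => /eqP.
Qed.

End Spaces.

Section Product.
Variables T T' : cspace.

Let enc (z : T * T') := cenc z.1 ++ cenc z.2.
Let dec s := (cdec T (take (cdim T) s), cdec T' (drop (cdim T) s)).

Fact size_prod_enc z : size (enc z) = (cdim T + cdim T')%N.
Proof. by rewrite size_cat !size_cenc. Qed.

Fact prod_encK : cancel enc dec.
Proof.
move=> [x y]; rewrite /dec /enc /= take_size_cat ?size_cenc //.
by rewrite drop_size_cat ?size_cenc // !cencK.
Qed.

Fact prod_decK s : size s = (cdim T + cdim T')%N -> enc (dec s) = s.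
Proof.
move=> ss; rewrite /enc /dec /= !cdecK ?cat_take_drop //.
  by rewrite size_drop ss addKn.
by rewrite size_takel // ss leq_addr.
Qed.

Canonical prod_cspace := CSpace size_prod_enc prod_encK prod_decK.

Lemma rmap_fst (W : set (T * T')) : @rmap prod_cspace T W fst.
Proof.
move=> i; have [lti|gei] := ltnP i (cdim T); last first.
  apply: (@rfun_ext _ _ _ (fun=> 0)); last exact: rfun_cst.
  by move=> x _; rewrite nth_default // size_cenc.
apply: rfun_ext (rfun_poly W (polyfun_coord i)) => x _.
by rewrite /= /enc nth_cat size_cenc lti.
Qed.

Lemma rmap_snd (W : set (T * T')) : @rmap prod_cspace T' W snd.
Proof.
move=> i; apply: rfun_ext (rfun_poly W (polyfun_coord (cdim T + i))) => x _.
by rewrite /= /enc nth_cat size_cenc ltnNge leq_addr /= addKn.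
Qed.

Lemma rmap_pair (X : cspace) (W : set X) (f : X -> T) (g : X -> T') :
  rmap W f -> rmap W g -> rmap W (fun x => (f x, g x) : prod_cspace).
Proof.
move=> rf rg i; have [lti|gei] := ltnP i (cdim T).
  by apply: rfun_ext (rf i) => x _; rewrite /= /enc nth_cat size_cenc lti.
apply: rfun_ext (rg (i - cdim T)%N) => x _.
by rewrite /= /enc nth_cat size_cenc ltnNge gei.
Qed.

(** Concatenation of points, with [take] and [drop] as projections, has the universal property that
    the product relation asks for. *)
Lemma cl_prod (W : set T) (W' : set T') : lc W -> lc W' ->
  cl [set z : T * T' | W z.1 /\ W' z.2] = cl W * cl W'.
Proof.
move=> lW lW'; set P := [set z | _].
have lP : @lc prod_cspace P.
  apply: (@lcI prod_cspace [set z | W z.1] [set z | W' z.2]).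
    exact: (lc_preim (rmap_fst _) lW).
  exact: (lc_preim (rmap_snd _) lW').
rewrite (@clE _ _ (Variety (lc_variety lW)) lW (isomorphic_refl _)).
rewrite (@clE _ _ (Variety (lc_variety lW')) lW' (isomorphic_refl _)).
rewrite (@clE _ _ (Variety (lc_variety lP)) lP (isomorphic_refl _)).
rewrite /motive -rmorphM /=; congr to_loc.
rewrite /K0_class -class_ofM; apply/class_ofP/cong_rel.
have PE y : space_of P y -> [/\ size y = (cdim T + cdim T')%N,
    space_of W (take (cdim T) y) & space_of W' (drop (cdim T) y)].
  move=> [sy [Wy W'y]]; split=> //; split=> //=.
    by rewrite size_takel // sy leq_addr.
  by rewrite size_drop sy addKn.
have rc i : reg (space_of P) (space_of P) (fun y => y`_i).
  exact: reg_morphism (morphism_incl _ _) (polyfun_reg _ (polyfun_coord i)).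
apply: (@K0_product _ _ _ _ (take (cdim T)) (drop (cdim T))); split.
- apply: morphism_sub => [|y /PE[_ []]//].
  apply: morphism_affine => [y /PE[_ []]//|i].
  have [lti|gei] := ltnP i (cdim T).
    by apply: reg_ext (rc i) => [|y _]; [apply: opensT|rewrite nth_take].
  apply: (@reg_ext _ _ _ _ (fun=> 0)); [exact: opensT| |exact/reg_cst/opensT].
  by move=> y /PE[_ [/= sy _] _]; rewrite nth_default // sy.
- apply: morphism_sub => [|y /PE[_ _ []]//].
  apply: morphism_affine => [y /PE[_ _ []]//|i].
  apply: reg_ext (rc (cdim T + i)%N) => [|y _]; first exact: opensT.
  by rewrite nth_drop.
move=> X f g mf mg; exists (fun t => f t ++ g t).
  split; last first.
    move=> t Xt; have [/= sf _] := mf.1 _ Xt.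
    by rewrite take_size_cat // drop_size_cat.
  apply: morphism_sub.
    apply: morphism_affine => [t Xt|i].
      have [/= sf _] := mf.1 _ Xt; have [/= sg _] := mg.1 _ Xt.
      by rewrite size_cat sf sg.
    have rW (V : cspace) (U : set V) j :
        reg (space_of U) (space_of U) (fun y => y`_j).
      exact: reg_morphism (morphism_incl _ _) (polyfun_reg _ (polyfun_coord j)).
    have [lti|gei] := ltnP i (cdim T).
      apply: reg_ext (reg_morphism mf (rW _ _ i)) => [|t Xt]; first exact: opensT.
      by have [/= sf _] := mf.1 _ Xt; rewrite nth_cat sf lti.
    apply: reg_ext (reg_morphism mg (rW _ _ (i - cdim T)%N)) => [|t Xt].
      exact: opensT.
    by have [/= sf _] := mf.1 _ Xt; rewrite nth_cat sf ltnNge gei.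
  move=> t Xt; have [/= sf Wf] := mf.1 _ Xt; have [/= sg Wg] := mg.1 _ Xt.
  by split; rewrite /= ?take_size_cat ?drop_size_cat.
move=> h mh hE t Xt; have [ht1 ht2] := hE t Xt.
by rewrite -[h t](cat_take_drop (cdim T)) ht1 ht2.
Qed.

End Product.
End Coordinates.

(** * Coordinates on matrix spaces *)

Section MatrixFamilies.
Variables (k : closedFieldType) (I : finType) (m n : I -> nat).

Definition mxfam : Type := forall i, 'M[k]_(m i, n i).

(** The coordinates are enumerated as in [rep_pt], [rep_mx] and [gl_mx], so that the nullcone and
    the group have the same ambient space and the same decoding as matrix families, by
    conversion. *)
Let coord : finType := {i : I & ('I_(m i) * 'I_(n i))%type}.

Let enc (M : mxfam) : seq k :=
  [seq M (tag c) (tagged c).1 (tagged c).2 | c <- enum coord].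

Let dec (x : seq k) : mxfam :=
  fun i => \matrix_(r, c) x`_(enum_rank (Tagged _ (r, c) : coord)).

Fact size_fam_enc M : size (enc M) = #|coord|.
Proof. by rewrite size_map -cardE. Qed.

Fact nth_fam_enc M (c : coord) :
  (enc M)`_(enum_rank c) = M (tag c) (tagged c).1 (tagged c).2.
Proof.
rewrite (nth_map c) -?cardE ?ltn_ord //.
by rewrite -[nth _ _ _]/(nth c (enum coord) (enum_rank c)) nth_enum_rank.
Qed.

Fact fam_encK : cancel enc dec.
Proof.
move=> M; apply: functional_extensionality_dep => i.
by apply/matrixP => r c; rewrite mxE nth_fam_enc.
Qed.

Fact fam_decK x : size x = #|coord| -> enc (dec x) = x.
Proof.
move=> sx; apply: (@eq_from_nth _ 0) => [|i]; rewrite size_fam_enc // => lti.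
have -> : i = enum_rank (enum_val (Ordinal lti)) by rewrite enum_valK.
rewrite nth_fam_enc mxE; congr (x`_ (nat_of_ord (enum_rank _))).
by case: enum_val => a [r c].
Qed.

Canonical mxfam_cspace : cspace k := CSpace size_fam_enc fam_encK fam_decK.

Lemma cdim_mxfam : cdim mxfam_cspace = (\sum_i m i * n i)%N.
Proof.
by rewrite /= card_tagged sumnE big_map big_enum /=; apply: eq_bigr => i _;
  rewrite card_prod !card_ord.
Qed.

Lemma rmap_famP (T : cspace k) (W : set T) (phi : T -> mxfam) :
  rmap W phi <-> forall i r c, rfun W (fun x => phi x i r c).
Proof.
split=> [H i r c|H j].
  apply: rfun_ext (H (enum_rank (Tagged _ (r, c) : coord))) => x _.
  by rewrite [RHS]nth_fam_enc.
have [lti|gei] := ltnP j #|coord|; last first.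
  apply: (@rfun_ext _ _ _ _ (fun=> 0)); last exact: rfun_cst.
  by move=> x _; rewrite nth_default // size_cenc.
pose c := enum_val (Ordinal lti).
apply: rfun_ext (H (tag c) (tagged c).1 (tagged c).2) => x _.
have -> : j = enum_rank c by rewrite enum_valK.
by rewrite [LHS]nth_fam_enc.
Qed.

End MatrixFamilies.

Section Matrices.
Variable k : closedFieldType.

Section Coord.
Variables m n : nat.

Let enc (A : 'M[k]_(m, n)) : seq k :=
  cenc ((fun=> A) : @mxfam k unit (fun=> m) (fun=> n)).
Let dec (x : seq k) : 'M[k]_(m, n) :=
  cdec (@mxfam_cspace k unit (fun=> m) (fun=> n)) x tt.

Fact size_mx_enc A : size (enc A) = (m * n)%N.
Proof. by rewrite size_cenc cdim_mxfam big_const card_unit /= addn0. Qed.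

Fact mx_encK : cancel enc dec.
Proof. by move=> A; rewrite /dec /enc cencK. Qed.

Fact mx_decK x : size x = (m * n)%N -> enc (dec x) = x.
Proof.
move=> sx; rewrite /enc /dec.
have -> : (fun=> cdec (@mxfam_cspace k unit (fun=> m) (fun=> n)) x tt) =
          cdec (@mxfam_cspace k unit (fun=> m) (fun=> n)) x.
  by apply: functional_extensionality_dep => -[].
by rewrite cdecK // cdim_mxfam sx big_const card_unit /= addn0.
Qed.

Canonical mx_cspace : cspace k := CSpace size_mx_enc mx_encK mx_decK.
End Coord.

Definition rmx (T : cspace k) (W : set T) m n (A : T -> 'M[k]_(m, n)) : Prop :=
  forall i j, rfun W (fun x => A x i j).

Lemma rmap_mxP (T : cspace k) (W : set T) m n (A : T -> 'M[k]_(m, n)) :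
  rmap W A <-> rmx W A.
Proof.
have := @rmap_famP k unit (fun=> m) (fun=> n) T W (fun x => fun=> A x).
by move=> H; split=> [/H H1 i j|H1]; [apply: (H1 tt)|apply/H => _].
Qed.

Section Operations.
Variables (T : cspace k) (W : set T).

Lemma rmx_cst m n (A : 'M[k]_(m, n)) : rmx W (fun=> A).
Proof. by move=> i j; apply: rfun_cst. Qed.

Lemma rmx_ext m n (A B : T -> 'M[k]_(m, n)) :
  (forall x, W x -> A x = B x) -> rmx W B -> rmx W A.
Proof. by move=> AB r i j; apply: rfun_ext (r i j) => x /AB ->. Qed.

Lemma rmxD m n (A B : T -> 'M[k]_(m, n)) :
  rmx W A -> rmx W B -> rmx W (fun x => A x + B x).
Proof.
move=> rA rB i j; apply: rfun_ext (rfunD (rA i j) (rB i j)) => x _.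
by rewrite mxE.
Qed.

Lemma rmxN m n (A : T -> 'M[k]_(m, n)) : rmx W A -> rmx W (fun x => - A x).
Proof.
by move=> rA i j; apply: rfun_ext (rfunN (rA i j)) => x _; rewrite mxE.
Qed.

Lemma rmxB m n (A B : T -> 'M[k]_(m, n)) :
  rmx W A -> rmx W B -> rmx W (fun x => A x - B x).
Proof. by move=> rA rB; apply: rmxD => //; apply: rmxN. Qed.

Lemma rmxM m n p (A : T -> 'M[k]_(m, n)) (B : T -> 'M[k]_(n, p)) :
  rmx W A -> rmx W B -> rmx W (fun x => A x *m B x).
Proof.
move=> rA rB i j.
apply: (@rfun_ext _ _ _ _ (fun x => \sum_l A x i l * B x l j)) => [x _|].
  by rewrite mxE.
by apply: rfun_big => l; apply: rfunM.
Qed.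

Lemma rfun_det n (A : T -> 'M[k]_n) : rmx W A -> rfun W (fun x => \det (A x)).
Proof.
move=> rA; apply: rfun_big => s; apply: rfunM; first exact: rfun_cst.
by apply: rfun_prod => i; apply: rA.
Qed.

Lemma rmx_mxsub m n m' n' (f : 'I_m' -> 'I_m) (g : 'I_n' -> 'I_n)
    (A : T -> 'M[k]_(m, n)) : rmx W A -> rmx W (fun x => mxsub f g (A x)).
Proof. by move=> rA i j; apply: rfun_ext (rA (f i) (g j)) => x _; rewrite mxE. Qed.

Lemma rmx_inv n (A : T -> 'M[k]_n) : rmx W A ->
  (forall x, W x -> A x \in unitmx) -> rmx W (fun x => invmx (A x)).
Proof.
move=> rA uA i j.
apply: (@rfun_ext _ _ _ _ (fun x => (\det (A x))^-1 *
   ((-1) ^+ (j + i) * \det (row' j (col' i (A x)))))) => [x Wx|].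
  by rewrite /invmx uA // !mxE.
apply: rfunM.
  by apply: rfunV => [|x /uA]; [apply: rfun_det|rewrite unitmxE unitfE].
apply: rfunM; first exact: rfun_cst.
by apply: rfun_det => r c; apply: rfun_ext (rA (lift j r) (lift i c)) => x _;
  rewrite !mxE.
Qed.

Lemma rmx_col_mx m1 m2 n (A : T -> 'M[k]_(m1, n)) (B : T -> 'M[k]_(m2, n)) :
  rmx W A -> rmx W B -> rmx W (fun x => col_mx (A x) (B x)).
Proof.
move=> rA rB i j; case: (splitP i) => [r iE|r iE].
  apply: rfun_ext (rA r j) => x _; rewrite mxE; case: splitP => s sE.
    by congr (A x _ _); apply: val_inj; rewrite /= -sE.
  by have := ltn_ord r; rewrite -iE sE ltnNge leq_addr.
apply: rfun_ext (rB r j) => x _; rewrite mxE; case: splitP => s sE.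
  by have := ltn_ord s; rewrite -sE iE ltnNge leq_addr.
congr (B x _ _); apply: val_inj; apply/eqP.
by rewrite -(eqn_add2l m1) -iE -sE.
Qed.

Lemma rmx_sub (V : set T) m n (A : T -> 'M[k]_(m, n)) :
  W `<=` V -> rmx V A -> rmx W A.
Proof. by move=> WV r i j; apply: rfun_sub WV (r i j). Qed.

Lemma rmx_comp (T' : cspace k) (W' : set T') (phi : T -> T') m n
    (A : T' -> 'M[k]_(m, n)) : rmap W phi -> (forall x, W x -> W' (phi x)) ->
  rmx W' A -> rmx W (fun x => A (phi x)).
Proof. by move=> rphi H rA i j; apply: (rfun_comp rphi H (rA i j)). Qed.

End Operations.

Lemma rmx_fam (I : finType) (m n : I -> nat) (T : cspace k) (W : set T)
    (phi : T -> mxfam k m n) i :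
  rmap W phi -> rmx W (fun x => phi x i).
Proof. by move=> /rmap_famP H r c; apply: H. Qed.

Lemma rmx_fst (T T' : cspace k) (W : set T) (V : set (T * T')) m n
    (A : T -> 'M[k]_(m, n)) :
  (forall z, V z -> W z.1) -> rmx W A -> rmx V (fun z => A z.1).
Proof. by move=> VW; apply: rmx_comp VW; apply: rmap_fst. Qed.

Lemma rmx_snd (T : cspace k) m n (V : set (T * 'M[k]_(m, n))) :
  rmx V (fun z => z.2).
Proof. exact/(rmap_mxP V (fun z => z.2))/rmap_snd. Qed.

Lemma lc_fst (T T' : cspace k) (W : set T) :
  lc W -> lc [set z : T * T' | W z.1].
Proof. exact: lc_preim (rmap_fst _). Qed.

End Matrices.

Arguments lc_fst {k T T' W}.

(** * Affine spaces and trivial bundles *)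

Section AffineClasses.
Variable k : closedFieldType.

Let aff n : Mot k := motive (affine_space_variety k n).

Let cl_aff (T : cspace k) : cl (@setT T) = aff (cdim T).
Proof.
apply: clE; first exact: lcT.
exists id, id; split=> //; last exact: morphism_incl.
exact: morphism_sub (morphism_id _) _.
Qed.

Let affD m n : aff (m + n) = aff m * aff n.
Proof.
have := cl_prod (@lcT k (mx_cspace k 1 m)) (@lcT k (mx_cspace k 1 n)).
rewrite !cl_aff /= !mul1n => <-; rewrite -[in LHS](mul1n m) -[in LHS](mul1n n).
rewrite -[LHS](cl_aff (prod_cspace (mx_cspace k 1 m) (mx_cspace k 1 n))).
by congr cl; apply/seteqP; split.
Qed.

Lemma cl_setT (T : cspace k) : cl (@setT T) = LL k ^+ cdim T.
Proof.
rewrite cl_aff; elim: (cdim T) => [|n IHn]; last by rewrite -add1n affD IHn exprS.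
rewrite expr0 /aff /motive.
have -> : K0_class (affine_space_variety k 0) = 1.
  by apply/class_ofP/cong_rel/K0_point.
exact: rmorph1.
Qed.

Lemma cl_prodT (T T' : cspace k) (W : set T) : lc W ->
  cl [set z : T * T' | W z.1] = cl W * LL k ^+ cdim T'.
Proof.
move=> lW; rewrite -cl_setT -cl_prod //; last exact: lcT.
by congr cl; apply/seteqP; split=> x // [].
Qed.

End AffineClasses.

(** * Systems of linear equations over a base *)

Section Minors.
Variable F : fieldType.

Lemma rowsub_1 m n r (f : 'I_r -> 'I_m) (A : 'M[F]_(m, n)) :
  rowsub f 1%:M *m A = rowsub f A.
Proof. by rewrite mul_rowsub_mx mul1mx. Qed.

Lemma colsub_1 m n r (g : 'I_r -> 'I_n) (A : 'M[F]_(m, n)) :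
  A *m colsub g 1%:M = colsub g A.
Proof. by rewrite -{1}[A]mxsub_id -mxsub_mul mulmx1. Qed.

Lemma mxsub_1 m n p q (f : 'I_p -> 'I_m) (g : 'I_q -> 'I_n) (A : 'M[F]_(m, n)) :
  rowsub f 1%:M *m A *m colsub g 1%:M = mxsub f g A.
Proof. by rewrite rowsub_1 colsub_1; apply/matrixP => i j; rewrite !mxE. Qed.

(** Independent rows are selected, and then independent columns of the resulting matrix. *)
Lemma unit_minor m n r (A : 'M[F]_(m, n)) : \rank A = r ->
  exists (f : {ffun 'I_r -> 'I_m}) (g : {ffun 'I_r -> 'I_n}),
    mxsub f g A \in unitmx.
Proof.
move=> <-; set f := maxrankfun A; have fA : row_full (rowsub f A)^T.
  by rewrite /row_full mxrank_tr; exact: maxrowsub_free.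
exists [ffun i => f i], [ffun i => fullrankfun fA i].
have := fullrowsub_unit fA; rewrite -unitmx_tr; congr (_ \in unitmx).
by apply/matrixP => i j; rewrite !mxE !ffunE.
Qed.

Lemma minor_rank m n r (A : 'M[F]_(m, n)) (f : 'I_r -> 'I_m) (g : 'I_r -> 'I_n) :
  mxsub f g A \in unitmx -> (r <= \rank A)%N.
Proof.
move=> u; rewrite -(mxrank_unit u) -mxsub_1.
exact: leq_trans (mxrankM_maxl _ _) (mxrankM_maxr _ _).
Qed.

Lemma row_free_minor m n (A : 'M[F]_(m, n)) :
  row_free A <-> exists g : {ffun 'I_m -> 'I_n}, \det (colsub g A) != 0.
Proof.
split=> [/eqP/unit_minor[f [g]]|[g]]; last first.
  rewrite -unitfE -unitmxE => /minor_rank.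
  by rewrite /row_free eqn_leq rank_leq_row => ->.
move=> u; exists g; rewrite -unitfE -unitmxE.
have : rowsub f 1%:M *m colsub g A \in unitmx.
  by rewrite rowsub_1; move: u; congr (_ \in unitmx); apply/matrixP => i j; rewrite !mxE.
by rewrite unitmx_mul => /andP[].
Qed.

(* For [A] of rank [r] and an invertible [r]-minor [P *m A *m R], the matrix
   [H = A R (P A R)^-1 P] is a projection with the same left kernel as [A]. *)
Lemma minor_proj m n r (A : 'M[F]_(m, n)) (P : 'M_(r, m)) (R : 'M_(n, r)) :
  \rank A = r -> P *m A *m R \in unitmx ->
  A *m R *m invmx (P *m A *m R) *m P *m A = A.
Proof.
move=> rA u; have sub : ((A *m R)^T <= A^T)%MS by rewrite trmx_mul submxMl.
have : (A^T <= (A *m R)^T)%MS.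
  rewrite -(geq_leqif (mxrank_leqif_sup sub)) !mxrank_tr rA.
  by rewrite -{1}(mxrank_unit u) -mulmxA mxrankM_maxr.
case/submxP => D /(congr1 trmx); rewrite trmxK trmx_mul trmxK => AE.
have E : P *m A = P *m A *m R *m D^T by rewrite -(mulmxA P A) -mulmxA -AE.
by set X := invmx _; rewrite -(mulmxA _ P A) E mulmxA mulmxKV // -AE.
Qed.

(** For a right inverse [P'] of [P], the matrix 1 - P' P is idempotent with left kernel the row
    space of [P], hence of rank m - r; in a rank factorisation C D of it, D C = 1 by idempotency.
    Keeping [c] as a variable equal to m - r avoids casts. *)
Lemma compl_idem m r (P : 'M[F]_(r, m)) : row_free P ->
  exists (c : nat) (C : 'M[F]_(m, c)) (D : 'M[F]_(c, m)) (P' : 'M[F]_(m, r)),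
    [/\ (c = m - r)%N, D *m C = 1%:M, P *m C = 0 & C *m D = 1%:M - P' *m P].
Proof.
move=> fP; have /row_freeP[P' PP'] := fP.
set E := 1%:M - P' *m P; have PE : P *m E = 0.
  by rewrite /E mulmxBr mulmx1 mulmxA PP' mul1mx subrr.
have EE : E *m E = E by rewrite {1}/E mulmxBl mul1mx -mulmxA PE mulmx0 subr0.
have DC : row_base E *m col_base E = 1%:M.
  apply: (row_full_inj (col_base_full E)); rewrite mulmx1 mulmxA.
  apply: (row_free_inj (row_base_free E)); rewrite -mulmxA.
  by rewrite !mulmx_base.
exists (\rank E), (col_base E), (row_base E), P'; split=> //.
- have kE : (kermx E :=: P)%MS.
    apply/eqmxP; rewrite [X in _ && X]sub_kermx PE eqxx andbT.
    have : kermx E *m E = 0 by apply: mulmx_ker.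
    rewrite {2}/E mulmxBr mulmx1 mulmxA => /eqP; rewrite subr_eq0 => /eqP ->.
    exact: submxMl.
  have := mxrank_ker E; rewrite kE (eqP fP) => ->.
  by rewrite subKn ?rank_leq_row.
- by rewrite -[_ *m _]mulmx1 -DC mulmxA -[_ *m _ *m row_base E]mulmxA mulmx_base PE mul0mx.
- exact: mulmx_base.
Qed.
End Minors.

Section Devissage.
Variable k : closedFieldType.

(* Splitting along the zero loci of finitely many functions reduces an additive
   identity to pieces where each function vanishes identically or nowhere. *)
Lemma devissage (T : cspace k) (W0 : set T) (J : finType) (g : J -> T -> k)
    (Phi : set T -> Mot k) :
  lc W0 -> (forall j, rfun W0 (g j)) ->
  (forall W h, W `<=` W0 -> lc W -> rfun W h ->
    Phi W = Phi [set x | W x /\ h x = 0] + Phi [set x | W x /\ h x != 0]) ->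
  (forall W, W `<=` W0 -> lc W ->
    (forall j, (forall x, W x -> g j x = 0) \/ (forall x, W x -> g j x != 0)) ->
    Phi W = 0) ->
  Phi W0 = 0.
Proof.
move=> lW0 rg add van.
suff H (s : seq J) W : W `<=` W0 -> lc W ->
    (forall j, j \notin s ->
      (forall x, W x -> g j x = 0) \/ (forall x, W x -> g j x != 0)) ->
    Phi W = 0.
  by apply: (H (enum J)) => // j; rewrite mem_enum.
elim: s W => [|j s IHs] W WW0 lW const; first by apply: van => // j; apply: const.
have rj : rfun W (g j) := rfun_sub WW0 (rg j).
rewrite (add _ _ WW0 lW rj) !IHs ?addr0 //.
- by move=> x [/WW0].
- exact: lc_neq01.
- move=> i is_; have [->|ij] := eqVneq i j; first by right=> x [].
  have [|H|H] := const i; first by rewrite inE negb_or ij.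
    by left=> x [/H].
  by right=> x [/H].
- by move=> x [/WW0].
- exact: lc_zero1.
- move=> i is_; have [->|ij] := eqVneq i j; first by left=> x [].
  have [|H|H] := const i; first by rewrite inE negb_or ij.
    by left=> x [/H].
  by right=> x [/H].
Qed.

(** For fixed [R], the class of the part of [R] over [W] is additive in [W], as [devissage]
    requires. *)
Lemma cl_over_split (T T' : cspace k) (R : set (T * T')) (W : set T) h :
  lc R -> lc W -> rfun W h ->
  cl [set z : T * T' | W z.1 /\ R z] =
  cl [set z : T * T' | (W z.1 /\ h z.1 = 0) /\ R z] +
  cl [set z : T * T' | (W z.1 /\ h z.1 != 0) /\ R z].
Proof.
move=> lR lW rh.
have lWR : lc [set z : T * T' | W z.1 /\ R z].
  exact: lcI (lc_preim (rmap_fst _) lW) lR.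
have rh' : rfun [set z : T * T' | W z.1 /\ R z] (fun z => h z.1).
  by apply: rfun_comp rh; [apply: rmap_fst|move=> z []].
rewrite (cl_split1 lWR rh').
congr (_ + _); congr cl; apply/seteqP; split=> z /= [] => [[? ?] ?|[? ?] ?];
  by split.
Qed.

Section LcMatrices.
Variables (T : cspace k) (W : set T).

Lemma lc_eqmx m n (A B : T -> 'M[k]_(m, n)) : lc W -> rmx W A -> rmx W B ->
  lc [set x | W x /\ A x = B x].
Proof.
move=> lW rA rB.
have := @lc_zero _ _ W _ (fun ij x => (A x - B x) ij.1 ij.2) lW
  (fun ij => rmxB rA rB ij.1 ij.2).
congr lc; apply/seteqP; split=> x [Wx H]; split=> //.
  by apply/eqP; rewrite -subr_eq0; apply/eqP/matrixP => i j; rewrite (H (i, j)) mxE.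
by move=> [i j]; rewrite /= H subrr mxE.
Qed.

Lemma lc_row_free m n (A : T -> 'M[k]_(m, n)) : lc W -> rmx W A ->
  lc [set x | W x /\ row_free (A x)].
Proof.
move=> lW rA.
have := @lc_neq0 _ _ W _ (fun (g : {ffun 'I_m -> 'I_n}) x => \det (colsub g (A x)))
  lW (fun g => rfun_det (rmx_mxsub id g rA)).
by congr lc; apply/seteqP; split=> x [Wx H]; split=> //; apply/row_free_minor.
Qed.

Lemma cl_split_row_free m n (A : T -> 'M[k]_(m, n)) : lc W -> rmx W A ->
  cl W = cl [set x | W x /\ ~ row_free (A x)] + cl [set x | W x /\ row_free (A x)].
Proof.
move=> lW rA.
rewrite (@cl_split _ _ W _ (fun (g : {ffun 'I_m -> 'I_n}) x => \det (colsub g (A x)))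
  lW (fun g => rfun_det (rmx_mxsub id g rA))).
congr (_ + _); congr cl; apply/seteqP; split=> x [Wx H]; split=> //.
- by move=> /row_free_minor[g]; rewrite H eqxx.
- move=> g; apply: contrapT => /eqP gx; apply: H; apply/row_free_minor.
  by exists g.
- exact/row_free_minor.
- exact/row_free_minor.
Qed.

Lemma lc_not_row_free m n (A : T -> 'M[k]_(m, n)) : lc W -> rmx W A ->
  lc [set x | W x /\ ~ row_free (A x)].
Proof.
move=> lW rA.
have := @lc_zero _ _ W _ (fun (g : {ffun 'I_m -> 'I_n}) x => \det (colsub g (A x)))
  lW (fun g => rfun_det (rmx_mxsub id g rA)).
congr lc; apply/seteqP; split=> x [Wx H]; split=> //.
  by move=> /row_free_minor[g]; rewrite H eqxx.
move=> g; apply: contrapT => /eqP gx; apply: H; apply/row_free_minor.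
by exists g.
Qed.
End LcMatrices.

(** Each fibre is an affine space of dimension n - r; as the rank is constant, cutting along the
    r-minors trivialises the family. *)
Lemma cl_affine_system (T : cspace k) (W : set T) n m r (K : T -> 'M[k]_(n, m))
    (b : T -> 'rV[k]_m) : lc W -> rmx W K -> rmx W b ->
  (forall x, W x -> \rank (K x) = r) -> (forall x, W x -> (b x <= K x)%MS) ->
  cl [set z : T * 'rV[k]_n | W z.1 /\ z.2 *m K z.1 = b z.1] =
    cl W * LL k ^+ (n - r).
Proof.
move=> lW rK rb rkK bK.
pose R : set (T * 'rV[k]_n) := [set z | W z.1 /\ z.2 *m K z.1 = b z.1].
have lR : lc R.
  by apply: lc_eqmx; [exact: lc_fst|apply: rmxM; [exact: rmx_snd|]|];
    apply: (rmx_fst (W := W)).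
pose Phi V := cl [set z : T * 'rV[k]_n | V z.1 /\ R z] - cl V * LL k ^+ (n - r).
suff : Phi W = 0.
  move/eqP; rewrite subr_eq0 => /eqP <-; congr cl.
  by apply/seteqP; split=> z /=; [move=> H; split; case: (H)|case].
apply: (@devissage _ W _
  (fun (fg : {ffun 'I_r -> 'I_n} * {ffun 'I_r -> 'I_m}) x =>
    \det (mxsub fg.1 fg.2 (K x)))) => //.
- by move=> fg; apply: rfun_det; apply: rmx_mxsub.
- move=> V h VW lV rh; rewrite /Phi (cl_over_split lR lV rh) (cl_split1 lV rh).
  by rewrite mulrDl opprD addrACA.
move=> V VW lV const.
have [[x0 Vx0]|nV] := pselect (exists x, V x); last first.
  rewrite /Phi !cl0 ?mul0r ?subr0 // => x Vx; apply: nV; first by exists x.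
  by case: Vx => ? _; exists x.1.
(* With an invertible minor the solutions [u] are parametrised by their
   coordinates outside the rows of the minor. *)
have [f [g ufg]] := unit_minor (rkK _ (VW _ Vx0)).
have {}ufg x : V x -> mxsub f g (K x) \in unitmx.
  move=> Vx; have [H|H] := const (f, g).
    by move: ufg; rewrite unitmxE unitfE H ?eqxx.
  by rewrite unitmxE unitfE; apply: H.
pose P : 'M[k]_(r, n) := rowsub f 1%:M; pose G : 'M[k]_(m, r) := colsub g 1%:M.
have uPG x : V x -> P *m K x *m G \in unitmx by rewrite mxsub_1; apply: ufg.
have fP : row_free P.
  have := uPG _ Vx0; rewrite -mulmxA => /mxrank_unit rE.
  by rewrite /row_free eqn_leq rank_leq_row -{1}rE mxrankM_maxl.
have [c [C [D [P' [cE DC PC CD]]]]] := compl_idem fP.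
(* [L x] is a generalised inverse, K L K = K. Hence b L is a particular solution, and 1 - K L
   projects onto the left kernel of [K x]. *)
pose L x := G *m invmx (P *m K x *m G) *m P.
have KLK x : V x -> K x *m L x *m K x = K x.
  by move=> Vx; rewrite /L !mulmxA minor_proj ?uPG ?rkK //; apply: VW.
have PKL x : V x -> P *m (K x *m L x) = P.
  by move=> Vx; rewrite /L !mulmxA mulmxV ?uPG // mul1mx.
have LC x : L x *m C = 0 by rewrite /L -!mulmxA PC !mulmx0.
have rL : rmx V L.
  apply: rmxM; last exact: rmx_cst.
  apply: rmxM; first exact: rmx_cst.
  apply: rmx_inv => //; apply: rmxM; last exact: rmx_cst.
  by apply: rmxM; [apply: rmx_cst|apply: rmx_sub rK].
have rKV : rmx V K by apply: rmx_sub rK.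
have rbV : rmx V b by apply: rmx_sub rb.
rewrite /Phi -cE; apply/eqP; rewrite subr_eq0; apply/eqP.
have := @cl_prodT _ _ (mx_cspace k 1 c) V lV; rewrite /= mul1n => <-.
(* [C] reads off the coordinates of [u] outside the rows of the minor. By L C = 0 they can be
   prescribed freely, and by P K L = P they determine the solution. *)
pose phi (z : T * 'rV[k]_n) : T * 'rV[k]_c := (z.1, z.2 *m C).
pose psi (z : T * 'rV[k]_c) : T * 'rV[k]_n :=
  (z.1, z.2 *m D *m (1%:M - K z.1 *m L z.1) + b z.1 *m L z.1).
apply: (@cl_iso _ _ _ _ _ phi psi).
- exact: (lcI (lc_fst (T' := mx_cspace k 1 n) lV) lR).
- exact: lc_fst.
- apply: rmap_pair; first exact: rmap_fst.
  by apply/rmap_mxP; apply: rmxM; [exact: rmx_snd|exact: rmx_cst].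
- apply: rmap_pair; first exact: rmap_fst.
  apply/rmap_mxP; apply: rmxD; last by apply: rmxM; apply: (rmx_fst (W := V)).
  apply: rmxM.
    apply: rmxM; last exact: rmx_cst.
    exact: rmx_snd.
  by apply: rmxB; [apply: rmx_cst|apply: rmxM; apply: (rmx_fst (W := V))].
- move=> [x u] /= [Vx [Wx uK]]; split=> //; rewrite /psi /phi /=; congr pair.
  rewrite -(mulmxA u C D) CD -uK -[_ *m K x *m _]mulmxA -mulmxA -mulmxDr.
  rewrite mulmxBl mul1mx mulmxBr mulmx1 -[P' *m P *m _]mulmxA PKL //.
  by rewrite subrr subr0 subrK mulmx1.
- move=> [x v] /= Vx; rewrite /psi /phi /=; split; first split=> //.
    split; first exact: VW.
    rewrite /= mulmxDl -mulmxA mulmxBl mul1mx KLK // subrr mulmx0 add0r.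
    have /submxP[d ->] := bK _ (VW _ Vx).
    by rewrite -(mulmxA d) -(mulmxA d) KLK.
  congr pair; rewrite mulmxDl -(mulmxA (b x)) LC mulmx0 addr0 mulmxBr mulmx1.
  rewrite mulmxBl -(mulmxA (v *m D)) -(mulmxA (K x)) LC !mulmx0 subr0.
  by rewrite -mulmxA DC mulmx1.
Qed.
End Devissage.

(** * Towers of linearly independent rows *)

Section FreeRows.
Variable F : fieldType.

Lemma row_free_col_mx m1 m2 n (A : 'M[F]_(m1, n)) (B : 'M[F]_(m2, n)) :
  row_free (col_mx A B) = (\rank (A + B)%MS == m1 + m2)%N.
Proof. by rewrite /row_free addsmxE. Qed.

Lemma row_free_colP m n (A : 'M[F]_(m, n)) (u : 'rV[F]_n) : row_free A ->
  row_free (col_mx A u) <-> ~ (u <= A)%MS.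
Proof.
rewrite row_free_col_mx => fA; have rA : \rank A = m by exact/eqP.
split=> [/eqP rE uA|nuA].
  have := mxrankS (_ : A + u <= A)%MS; rewrite addsmx_sub submx_refl uA => /(_ isT).
  by rewrite rE rA addn1 ltnn.
have /rank_ltmx lt : (A < A + u)%MS.
  rewrite /ltmx addsmxSl /=; apply/negP => H; apply: nuA.
  by apply: submx_trans H; apply: addsmxSr.
rewrite eqn_leq; apply/andP; split; last by move: lt; rewrite rA addn1.
apply: leq_trans (mxrank_adds_leqif A u) _.
by rewrite rA leq_add2l rank_leq_row.
Qed.

Lemma row_free_col_mxl m1 m2 n (A : 'M[F]_(m1, n)) (B : 'M[F]_(m2, n)) :
  row_free (col_mx A B) -> row_free A.
Proof.
rewrite row_free_col_mx => /eqP rE; rewrite /row_free eqn_leq rank_leq_row /=.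
rewrite -(leq_add2r m2) -rE (leq_trans (mxrank_adds_leqif A B)) //.
by rewrite leq_add2l rank_leq_row.
Qed.
End FreeRows.

(* A splitting of an n-dimensional space into parts of dimensions e and f, with
   projections J, K and inclusions J', K'. *)
Record frame (F : fieldType) (e f n : nat) := Frame {
  fr_J : 'M[F]_(e, n); fr_K : 'M[F]_(f, n);
  fr_J' : 'M[F]_(n, e); fr_K' : 'M[F]_(n, f);
  fr_JJ : fr_J *m fr_J' = 1%:M; fr_KK : fr_K *m fr_K' = 1%:M;
  fr_JK : fr_J *m fr_K' = 0; fr_KJ : fr_K *m fr_J' = 0;
  fr_1 : fr_J' *m fr_J + fr_K' *m fr_K = 1%:M }.

(** The sizes need only add up to [n] provably: the substitution is made here once, and later
    arguments use the equations of the record instead of casts. *)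
Lemma frame_of (F : fieldType) e f n : (e + f)%N = n -> frame F e f n.
Proof.
move=> <-.
apply: (@Frame F e f _ (row_mx 1%:M 0) (row_mx 0 1%:M)
                       (col_mx 1%:M 0) (col_mx 0 1%:M));
  rewrite ?mul_row_col ?mulmx0 ?mul0mx ?mulmx1 ?addr0 ?add0r //.
by rewrite !mul_col_row !mulmx0 !mul0mx !mulmx1 add_block_mx !addr0 !add0r -scalar_mx_block.
Qed.

Section Towers.
Variable k : closedFieldType.
Local Notation L := (LL k).

Section Rows.
Variables (T : cspace k) (W : set T) (n : nat).
Hypothesis lW : lc W.

Lemma cl_span j (U : T -> 'M[k]_(j, n)) : rmx W U ->
  (forall x, W x -> row_free (U x)) ->
  cl [set z : T * 'rV[k]_n | W z.1 /\ (z.2 <= U z.1)%MS] = cl W * L ^+ j.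
Proof.
move=> rU fU; set Z := [set z | _].
have lZ : lc Z.
  have := @lc_not_row_free _ _ [set z : T * 'rV[k]_n | W z.1] _ _
    (fun z => col_mx (U z.1) z.2) (lc_fst lW) (rmx_col_mx (rmx_fst (fun _ => id) rU) (rmx_snd _)).
  congr lc; apply/seteqP; split=> z [Wz H]; split=> //.
    by apply: contrapT => H'; apply/H/row_free_colP => //; apply: fU.
  by move/row_free_colP => /(_ (fU _ Wz)).
(* The coefficients [c] with [c *m U = u] are unique, so the graph of
   [c |-> c *m U] has the same class as [Z]. *)
have := @cl_affine_system _ _ Z _ _ j (fun z => U z.1) (fun z => z.2) lZ.
rewrite subnn expr0 mulr1 => <- //; last 4 first.
- by apply: rmx_fst rU => z [].
- exact: rmx_snd.
- by move=> z [/fU/eqP].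
- by move=> z [_].
have := @cl_prodT _ _ (mx_cspace k 1 j) W lW; rewrite /= mul1n => <-.
pose phi (z : (T * 'rV[k]_n) * 'rV[k]_j) : T * 'rV[k]_j := (z.1.1, z.2).
pose psi (z : T * 'rV[k]_j) : (T * 'rV[k]_n) * 'rV[k]_j := ((z.1, z.2 *m U z.1), z.2).
apply: (@cl_iso _ _ _ _ _ phi psi).
- apply: lc_eqmx; first exact: lc_fst.
    apply: rmxM; first exact: rmx_snd.
    apply: (@rmx_comp _ _ _ _ Z fst _ _ (fun z => U z.1)) => //; first exact: rmap_fst.
    by apply: rmx_fst rU => z [].
  apply: (@rmx_comp _ _ _ _ setT fst _ _ (fun z => z.2)) => //.
    exact: rmap_fst.
  exact: rmx_snd.
- exact: lc_fst lW.
- apply: rmap_pair; last exact: rmap_snd.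
  by apply: (@rmap_comp _ _ _ _ _ setT) => //; apply: rmap_fst.
- apply: rmap_pair; last exact: rmap_snd.
  apply: rmap_pair; first exact: rmap_fst.
  by apply/rmap_mxP; apply: rmxM; [apply: rmx_snd|apply: rmx_fst rU].
- by move=> [[x u] c] /= [[Wx _] uE]; split=> //; rewrite /psi /= uE.
- by move=> [x c] /= Wx; do !split=> //=; apply: submxMl.
Qed.

(** The new row ranges over the left kernel of [K], of dimension n - r, minus the span of [U], of
    dimension j, which lies in that kernel because U K = 0. *)
Lemma cl_row m r j (K : T -> 'M[k]_(n, m)) (U : T -> 'M[k]_(j, n)) :
  rmx W K -> rmx W U -> (forall x, W x -> \rank (K x) = r) ->
  (forall x, W x -> row_free (U x)) -> (forall x, W x -> U x *m K x = 0) ->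
  cl [set z : T * 'rV[k]_n |
        (W z.1 /\ z.2 *m K z.1 = 0) /\ row_free (col_mx (U z.1) z.2)] =
    cl W * (L ^+ (n - r) - L ^+ j).
Proof.
move=> rK rU rkK fU UK.
have lZ : lc [set z : T * 'rV[k]_n | W z.1 /\ z.2 *m K z.1 = 0].
  apply: lc_eqmx; [exact: lc_fst|apply: rmxM; [exact: rmx_snd|exact: (rmx_fst (W := W))]|exact: rmx_cst].
have := @cl_split_row_free _ _ _ _ _ (fun z => col_mx (U z.1) z.2) lZ.
have -> : [set x : T * 'rV[k]_n | [set z | W z.1 /\ z.2 *m K z.1 = 0] x /\
    ~ row_free (col_mx (U x.1) x.2)] = [set z | W z.1 /\ (z.2 <= U z.1)%MS].
  apply/seteqP; split=> [z [[Wz _] H]|z [Wz zU]]; split=> //.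
  - by apply: contrapT => H'; apply/H/row_free_colP => //; apply: fU.
  - by split=> //; have /submxP[D ->] := zU; rewrite -mulmxA UK // mulmx0.
  - by move/row_free_colP => /(_ (fU _ Wz)).
rewrite cl_span // (@cl_affine_system _ _ _ _ _ r K (fun=> 0)) //; last 2 first.
- exact: rmx_cst.
- by move=> x _; apply: sub0mx.
have rUu : rmx [set z : T * 'rV[k]_n | W z.1 /\ z.2 *m K z.1 = 0]
    (fun z => col_mx (U z.1) z.2).
  by apply: rmx_col_mx; [apply: rmx_fst rU => z []|apply: rmx_snd].
by move=> /(_ rUu) H; rewrite mulrBr H [X in X - _]addrC addrK.
Qed.
End Rows.

(** Rows are added one at a time, a point together with its first new row serving as base point for
    the others; so [T], [W] and [U] vary in the induction. Local closedness is part of the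
    conclusion because [cl_frame] takes the result as a base in turn. *)
Lemma cl_rows t (T : cspace k) (W : set T) n m r j (K : T -> 'M[k]_(n, m))
    (U : T -> 'M[k]_(j, n)) : lc W ->
  rmx W K -> rmx W U -> (forall x, W x -> \rank (K x) = r) ->
  (forall x, W x -> row_free (U x)) -> (forall x, W x -> U x *m K x = 0) ->
  lc [set z : T * 'M[k]_(t, n) |
        (W z.1 /\ z.2 *m K z.1 = 0) /\ row_free (col_mx (U z.1) z.2)] /\
  cl [set z : T * 'M[k]_(t, n) |
        (W z.1 /\ z.2 *m K z.1 = 0) /\ row_free (col_mx (U z.1) z.2)] =
    cl W * \prod_(l < t) (L ^+ (n - r) - L ^+ (j + l)).
Proof.
have lcY s (T0 : cspace k) (W0 : set T0) j0 (K0 : T0 -> 'M[k]_(n, m))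
    (U0 : T0 -> 'M[k]_(j0, n)) : lc W0 -> rmx W0 K0 -> rmx W0 U0 ->
    lc [set z : T0 * 'M[k]_(s, n) |
        (W0 z.1 /\ z.2 *m K0 z.1 = 0) /\ row_free (col_mx (U0 z.1) z.2)].
  move=> lW rK rU.
  apply: lc_row_free.
    apply: lc_eqmx; first exact: lc_fst.
      by apply: rmxM; [exact: rmx_snd|exact: rmx_fst rK].
    exact: rmx_cst.
  by apply: rmx_col_mx; [apply: rmx_fst rU => z []|apply: rmx_snd].
elim: t T W j K U => [|t IHt] T W j K U lW rK rU rkK fU UK;
    (split; first exact: lcY); have lY := lcY _ _ _ _ _ _ lW rK rU.
  rewrite big_ord0 mulr1.
  apply: (@cl_iso _ (prod_cspace T (mx_cspace k 0 n)) T _ W fst (fun x => (x, 0))) => //.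
  - exact: rmap_fst.
  - by apply: rmap_pair; [apply: rmap_id|apply: rmap_cst].
  - by move=> [x B] [[/= Wx _] _]; split=> //; rewrite [B]flatmx0.
  - move=> x Wx; do !split=> //=; first by rewrite mul0mx.
    by rewrite row_free_col_mx addsmx0 addn0; apply: fU.
pose W' := [set z : T * 'rV[k]_n |
  (W z.1 /\ z.2 *m K z.1 = 0) /\ row_free (col_mx (U z.1) z.2)].
have lW' : lc W' := lcY _ _ _ _ _ _ lW rK rU.
have rK' : rmx W' (fun z => K z.1) by apply: rmx_fst rK => z [[]].
have rU' : rmx W' (fun z => col_mx (U z.1) z.2).
  by apply: rmx_col_mx; [apply: rmx_fst rU => z [[]]|apply: rmx_snd].
have UK' z : W' z -> col_mx (U z.1) z.2 *m K z.1 = 0.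
  by move=> [[Wz zK] _]; rewrite mul_col_mx UK // zK col_mx0.
have [lY' clY'] := IHt _ W' (j + 1)%N (fun z => K z.1)
  (fun z => col_mx (U z.1) z.2) lW' rK' rU' (fun z H => rkK _ H.1.1)
  (fun z H => H.2) UK'.
rewrite big_ord_recl addn0 mulrA -(cl_row lW rK rU rkK fU UK) -/W'.
rewrite (eq_bigr (fun l : 'I_t => L ^+ (n - r) - L ^+ (j + 1 + l))); last first.
  by move=> l _; rewrite lift0 -addnA add1n.
rewrite -clY'.
pose phi (z : T * 'M[k]_(1 + t, n)) : (T * 'rV[k]_n) * 'M[k]_(t, n) :=
  ((z.1, usubmx z.2), dsubmx z.2).
pose psi (z : (T * 'rV[k]_n) * 'M[k]_(t, n)) : T * 'M[k]_(1 + t, n) :=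
  (z.1.1, col_mx z.1.2 z.2).
have free (A : 'M[k]_(j, n)) (u : 'rV_n) (B : 'M_(t, n)) :
    row_free (col_mx A (col_mx u B)) = row_free (col_mx (col_mx A u) B).
  rewrite !row_free_col_mx -(adds_eqmx (eqmx_refl A) (addsmxE u B)).
  by rewrite -(adds_eqmx (addsmxE A u) (eqmx_refl B)) addsmxA addnA.
apply: (@cl_iso _ _ _ _ _ phi psi) => //.
- apply: rmap_pair; first apply: rmap_pair.
  + exact: rmap_fst.
  + apply/rmap_mxP => i i'.
    have /rmap_mxP/(_ (lshift t i) i') := rmap_snd (T := T) (T' := mx_cspace k t.+1 n)
      [set z | (W z.1 /\ z.2 *m K z.1 = 0) /\ row_free (col_mx (U z.1) z.2)].
    by apply: rfun_ext => z _; rewrite mxE.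
  + apply/rmap_mxP => i i'.
    have /rmap_mxP/(_ (rshift 1 i) i') := rmap_snd (T := T) (T' := mx_cspace k t.+1 n)
      [set z | (W z.1 /\ z.2 *m K z.1 = 0) /\ row_free (col_mx (U z.1) z.2)].
    by apply: rfun_ext => z _; rewrite mxE.
- apply: rmap_pair.
    by apply: (@rmap_comp _ _ _ _ _ setT) => //; apply: rmap_fst.
  apply/rmap_mxP; apply: rmx_col_mx.
    apply: (@rmx_comp _ _ _ _ setT fst _ _ (fun z => z.2)) => //.
      exact: rmap_fst.
    exact: rmx_snd.
  exact: rmx_snd.
- move=> [x B]; rewrite -[B](@vsubmxK _ 1); move: (usubmx _) (dsubmx _) => u v.
  have mulE : col_mx u v *m K x = col_mx (u *m K x) (v *m K x) := mul_col_mx u v _.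
  rewrite /phi /psi /= col_mxKu col_mxKd free mulE => -[[Wx]].
  move=> /eqP mK fB; have : col_mx (u *m K x) (v *m K x) == 0 := mK.
  rewrite col_mx_eq0 => /andP[/eqP uK /eqP vK]; split=> //.
  by do !split=> //=; apply: row_free_col_mxl fB.
- move=> [[x u] B] /= [[[[/= Wx uK] _] BK] fB]; rewrite /phi /psi /=.
  rewrite col_mxKu col_mxKd; split=> //; split; last by rewrite free.
  have mulE : col_mx u B *m K x = col_mx (u *m K x) (B *m K x) := mul_col_mx u B _.
  by split=> //; rewrite mulE uK BK col_mx0.
Qed.
End Towers.

(** * Frames with prescribed rows in a kernel *)

Section Frames.
Variable k : closedFieldType.
Local Notation L := (LL k).

Lemma lc_unitmx (T : cspace k) (W : set T) n (A : T -> 'M[k]_n) :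
  lc W -> rmx W A -> lc [set x | W x /\ A x \in unitmx].
Proof.
move=> lW rA; have := lc_row_free lW rA; congr lc.
by apply/seteqP; split=> x /= [Wx]; rewrite row_free_unit.
Qed.

Lemma frame_unit e f n (S : frame k e f n) (g : 'M[k]_n) : (e + f)%N = n ->
  (g \in unitmx) = row_free (col_mx (fr_K S *m g) (fr_J S *m g)).
Proof.
move=> efn; rewrite -row_free_unit -mul_col_mx /row_free.
have -> : \rank (col_mx (fr_K S) (fr_J S) *m g) = \rank g.
  apply/eqP; rewrite eqn_leq mxrankM_maxr /=.
  rewrite -{1}[g]mul1mx -(fr_1 S) addrC -mul_row_col -mulmxA.
  exact: mxrankM_maxr.
by rewrite [(f + e)%N]addnC efn.
Qed.

(** The f rows [fr_K S *m g] are chosen independent in the left kernel of [K], and the e rows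
    [fr_J S *m g] complete them without further equations. Both are cases of [cl_rows]: one starts
    from no rows ([U0]), the other has a system with no columns ([K1]). *)
Lemma cl_frame (T : cspace k) (W : set T) e f n m r (S : frame k e f n)
    (K : T -> 'M[k]_(n, m)) : (e + f)%N = n -> lc W -> rmx W K ->
  (forall x, W x -> \rank (K x) = r) ->
  cl [set z : T * 'M[k]_n |
       (W z.1 /\ z.2 \in unitmx) /\ fr_K S *m z.2 *m K z.1 = 0] =
  cl W * (\prod_(l < f) (L ^+ (n - r) - L ^+ l) *
          \prod_(l < e) (L ^+ n - L ^+ (f + l))).
Proof.
move=> efn lW rK rkK; set Y := [set z | _].
have lY : lc Y.
  apply: lc_eqmx; last exact: rmx_cst.
    by apply: lc_unitmx; [apply: lc_fst|apply: rmx_snd].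
  apply: rmxM; last by apply: rmx_fst rK => z [].
  by apply: rmxM; [apply: rmx_cst|apply: rmx_snd].
pose U0 : T -> 'M[k]_(0, n) := fun=> 0.
have rU0 : rmx W U0 by apply: rmx_cst.
have fU0 x : W x -> row_free (U0 x) by move=> _; rewrite /row_free mxrank0.
have UK0 x : W x -> U0 x *m K x = 0 by move=> _; rewrite mul0mx.
have [lX clX] := cl_rows f lW rK rU0 rkK fU0 UK0.
set X := [set z | _] in lX clX.
pose K1 : T * 'M[k]_(f, n) -> 'M[k]_(n, 0) := fun=> 0.
have rK1 : rmx X K1 by apply: rmx_cst.
have rU1 : rmx X (fun z => z.2) by apply: rmx_snd.
have rkK1 z : X z -> \rank (K1 z) = 0%N by rewrite mxrank0.
have fU1 z : X z -> row_free z.2.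
  by move=> [_]; rewrite row_free_col_mx adds0mx.
have UK1 z : X z -> z.2 *m K1 z = 0 by rewrite mulmx0.
have [lZ clZ] := cl_rows e lX rK1 rU1 rkK1 fU1 UK1.
set Z := [set z | _] in lZ clZ.
rewrite mulrA -clX subn0 in clZ *; rewrite -clZ.
pose phi (z : T * 'M[k]_n) : (T * 'M[k]_(f, n)) * 'M[k]_(e, n) :=
  ((z.1, fr_K S *m z.2), fr_J S *m z.2).
pose psi (z : (T * 'M[k]_(f, n)) * 'M[k]_(e, n)) : T * 'M[k]_n :=
  (z.1.1, fr_J' S *m z.2 + fr_K' S *m z.1.2).
have Kpsi z : fr_K S *m (psi z).2 = z.1.2.
  by rewrite /psi /= mulmxDr !mulmxA fr_KJ fr_KK mul0mx add0r mul1mx.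
have Jpsi z : fr_J S *m (psi z).2 = z.2.
  by rewrite /psi /= mulmxDr !mulmxA fr_JK fr_JJ mul0mx addr0 mul1mx.
apply: (@cl_iso _ _ _ _ _ phi psi) => //.
- apply: rmap_pair; first apply: rmap_pair.
  + exact: rmap_fst.
  + by apply/rmap_mxP; apply: rmxM; [apply: rmx_cst|apply: rmx_snd].
  + by apply/rmap_mxP; apply: rmxM; [apply: rmx_cst|apply: rmx_snd].
- apply: rmap_pair.
    by apply: (@rmap_comp _ _ _ _ _ setT) => //; apply: rmap_fst.
  apply/rmap_mxP; apply: rmxD; apply: rmxM; try exact: rmx_cst.
    exact: rmx_snd.
  apply: (@rmx_comp _ _ _ _ setT fst _ _ (fun z => z.2)) => //.
    exact: rmap_fst.
  exact: rmx_snd.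
- move=> [x g] [[/= Wx]]; rewrite (frame_unit S) // => fg gK; split; last first.
    by rewrite /psi /phi /= !mulmxA -mulmxDl fr_1 mul1mx.
  do !split=> //=; last by rewrite mulmx0.
  by rewrite row_free_col_mx adds0mx; apply: row_free_col_mxl fg.
- move=> z [[[[Wx BK] fB] _] fZ]; split; last first.
    by case: z {Wx BK fB fZ} (Kpsi z) (Jpsi z) => [[x B] C] E1 E2; rewrite /phi E1 E2.
  do !split=> //; last by rewrite Kpsi.
  by rewrite (frame_unit S) // Kpsi Jpsi.
Qed.

Section Family.
Variables (T : cspace k) (W : set T) (I : finType) (d e f m r : I -> nat).
Variables (S : forall i, frame k (e i) (f i) (d i)).
Variable K : forall i, T -> 'M[k]_(d i, m i).
Hypothesis efd : forall i, (e i + f i)%N = d i.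
Hypothesis lW : lc W.
Hypothesis rK : forall i, rmx W (K i).
Hypothesis rkK : forall i x, W x -> \rank (K i x) = r i.

(** Indices are added one at a time. Components outside [s] are pinned to 0, so that all stages lie
    in one coordinate space, [Y [::]] is a copy of [W], and [Y (i :: s)] is a family of frames over
    [Y s] when [i] is not in [s]. *)
Let Y (s : seq I) := [set z : T * mxfam k d d | W z.1 /\ forall i,
  if i \in s then z.2 i \in unitmx /\ fr_K (S i) *m z.2 i *m K i z.1 = 0
  else z.2 i = 0].

Let lY s : lc (Y s).
Proof.
pose cond (V : set (T * mxfam k d d)) i := [set z | V z /\
  if i \in s then z.2 i \in unitmx /\ fr_K (S i) *m z.2 i *m K i z.1 = 0
  else z.2 i = 0].
have lcond V i : lc V -> (forall z, V z -> W z.1) -> lc (cond V i).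
  move=> lV VW; have r2 (U : set (T * mxfam k d d)) : rmx U (fun z => z.2 i).
    exact: (rmx_fam (phi := snd)) (rmap_snd _).
  rewrite /cond; case: (i \in s); last by apply: lc_eqmx; last exact: rmx_cst.
  have := @lc_eqmx _ _ _ _ _ (fun z : T * mxfam k d d => fr_K (S i) *m z.2 i *m K i z.1)
     (fun=> 0) (lc_unitmx lV (r2 V)).
  have -> : [set z : T * mxfam k d d | [set x | V x /\ x.2 i \in unitmx] z /\
    fr_K (S i) *m z.2 i *m K i z.1 = 0] = [set z | V z /\ z.2 i \in unitmx /\
    fr_K (S i) *m z.2 i *m K i z.1 = 0].
    by apply/seteqP; split=> z; [case=> [[? ?] ?]|case=> ? [? ?]]; do !split.
  apply; last exact: rmx_cst.
  apply: rmxM; last by apply: (rmx_fst _ (@rK i)) => z [/VW].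
  by apply: rmxM; [apply: rmx_cst|apply: r2].
have H (t : seq I) : exists V : set (T * mxfam k d d), [/\ lc V, (forall z, V z -> W z.1) & forall z,
    V z <-> W z.1 /\ forall i, i \in t ->
    if i \in s then z.2 i \in unitmx /\ fr_K (S i) *m z.2 i *m K i z.1 = 0
    else z.2 i = 0].
  elim: t => [|i t [V [lV VW VE]]].
    exists [set z | W z.1]; split=> //; first exact: lc_fst.
    by move=> z; split=> [Wz|[]//]; split.
  exists (cond V i); split=> [|z [/VW]//|z]; first exact: lcond.
  split=> [[/VE[Wz H] Hi]|[Wz H]].
    by split=> // j; rewrite inE => /predU1P[->//|/H].
  split; last by apply: H; rewrite inE eqxx.
  by apply/VE; split=> // j jt; apply: H; rewrite inE jt orbT.
have [V [lV _ VE]] := H (enum I); move: lV; congr lc.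
apply/seteqP; split=> z; first by move/VE=> [Wz Hz]; split=> // i; apply: Hz; rewrite mem_enum.
by move=> [Wz Hz]; apply/VE; split=> // i _; apply: Hz.
Qed.

Let cl_Y s : uniq s -> cl (Y s) = cl W * \prod_(i <- s)
  (\prod_(l < f i) (L ^+ (d i - r i) - L ^+ l) *
   \prod_(l < e i) (L ^+ d i - L ^+ (f i + l))).
Proof.
elim: s => [_|i s IHs /= /andP[is_ us]].
  rewrite big_nil mulr1.
  apply: (@cl_iso _ (prod_cspace T (mxfam_cspace k d d)) T _ W fst
    (fun x => (x, fun=> 0))) => //.
  - exact: rmap_fst.
  - by apply: rmap_pair; [apply: rmap_id|apply: rmap_cst].
  - move=> [x g] [/= Wx g0]; split=> //; congr pair.
    by apply: functional_extensionality_dep => i; rewrite g0.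
rewrite big_cons [_ * \prod_(_ <- _) _]mulrC mulrA -IHs //.
have rKY : rmx (Y s) (fun z => K i z.1) by apply: (rmx_fst _ (@rK i)) => z [].
have rkY z : Y s z -> \rank (K i z.1) = r i by move=> [/rkK].
rewrite -(cl_frame (S i) (efd i) (lY s) rKY rkY); set Z := [set z | _].
(* [dfwith] overwrites component [i]: by 0 to land in [Y s], by the frame to come back. *)
pose phi (z : T * mxfam k d d) : (T * mxfam k d d) * 'M[k]_(d i) :=
  ((z.1, dfwith z.2 (0 : 'M_(d i))), z.2 i).
pose psi (z : (T * mxfam k d d) * 'M[k]_(d i)) : T * mxfam k d d :=
  (z.1.1, dfwith z.1.2 z.2).
apply: (@cl_iso _ _ _ _ _ phi psi) => //.
- apply: lc_eqmx; last exact: rmx_cst.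
    by apply: lc_unitmx; [apply: lc_fst; apply: lY|apply: rmx_snd].
  apply: rmxM; last by apply: rmx_fst rKY => z [].
  by apply: rmxM; [apply: rmx_cst|apply: rmx_snd].
- have r2 j : rmx (Y (i :: s)) (fun z => z.2 j).
    exact: (rmx_fam (phi := snd)) (rmap_snd _).
  apply: rmap_pair; last exact/rmap_mxP.
  apply: rmap_pair; first exact: rmap_fst.
  apply/rmap_famP => j; have [<-|ij] := eqVneq i j.
    by apply: rmx_ext (rmx_cst _ 0) => x _; rewrite dfwith_in.
  by apply: rmx_ext (r2 j) => x _; rewrite dfwith_out.
- apply: rmap_pair.
    by apply: (@rmap_comp _ _ _ _ _ setT) => //; apply: rmap_fst.
  apply/rmap_famP => j; have [<-|ij] := eqVneq i j.
    by apply: rmx_ext (rmx_snd _) => x _; rewrite dfwith_in.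
  apply: (@rmx_ext _ _ _ _ _ _ (fun z : (T * mxfam k d d) * 'M[k]_(d i) => z.1.2 j)) => [x _|].
    by rewrite dfwith_out.
  apply: (rmx_fam (phi := fun z : (T * mxfam k d d) * 'M[k]_(d i) => z.1.2)).
  by apply: (@rmap_comp _ _ _ _ _ setT) => //; [apply: rmap_fst|apply: rmap_snd].
- move=> [x g] [/= Wx H]; have := H i; rewrite inE eqxx /= => -[gi gK].
  split; last first.
    rewrite /psi /phi /=; congr pair; apply: functional_extensionality_dep => j.
    have [<-|ij] := eqVneq i j; first by rewrite dfwith_in.
    by rewrite !dfwith_out.
  split=> //; split=> //; split=> //= j; have [<-|ij] := eqVneq i j.
    by rewrite (negPf is_) dfwith_in.
  by have := H j; rewrite inE eq_sym (negPf ij) /= dfwith_out.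
- move=> [[x g] h] [[[/= Wx H] hU] hK]; split; last first.
    rewrite /psi /phi /= dfwith_in; congr (_, _, _).
    apply: functional_extensionality_dep => j.
    have [<-|ij] := eqVneq i j; last by rewrite !dfwith_out.
    by rewrite dfwith_in; have := H i; rewrite (negPf is_).
  split=> //= j; rewrite inE [j == i]eq_sym; have [<-|ij] := eqVneq i j.
    by rewrite /= dfwith_in.
  by have := H j; rewrite dfwith_out.
Qed.

Lemma lc_frames : lc [set z : T * mxfam k d d | W z.1 /\
  forall i, z.2 i \in unitmx /\ fr_K (S i) *m z.2 i *m K i z.1 = 0].
Proof.
have := lY (enum I); congr lc; apply/seteqP; split=> z [Wz H]; split=> // i;
  by have := H i; rewrite mem_enum.
Qed.

Lemma cl_frames : cl [set z : T * mxfam k d d | W z.1 /\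
    forall i, z.2 i \in unitmx /\ fr_K (S i) *m z.2 i *m K i z.1 = 0] =
  cl W * \prod_i (\prod_(l < f i) (L ^+ (d i - r i) - L ^+ l) *
                  \prod_(l < e i) (L ^+ d i - L ^+ (f i + l))).
Proof.
rewrite -big_enum -cl_Y ?enum_uniq //; congr cl.
by apply/seteqP; split=> z [Wz H]; split=> // i; have := H i; rewrite mem_enum.
Qed.
End Family.
End Frames.

(** * Units and the q-binomial identity *)

Section Units.
Variable A : comPzRingType.
Implicit Types x y : A.

Definition isunit x : Prop := exists y, x * y = 1.

Lemma isunitP x : isunit x -> x * minv x = 1.
Proof. by case=> y /mul_inv. Qed.

Lemma isunit1 : isunit 1.
Proof. by exists 1; rewrite mulr1. Qed.

Lemma isunitM x y : isunit x -> isunit y -> isunit (x * y).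
Proof. by move=> [x' xE] [y' yE]; exists (x' * y'); rewrite mulrACA xE yE mulr1. Qed.

Lemma isunit_prod (I : Type) (r : seq I) (P : pred I) (F : I -> A) :
  (forall i, P i -> isunit (F i)) -> isunit (\prod_(i <- r | P i) F i).
Proof. by move=> H; apply: (big_ind isunit) => //; [exact: isunit1|exact: isunitM]. Qed.

Lemma isunitX x n : isunit x -> isunit (x ^+ n).
Proof. by case=> y xy; exists (y ^+ n); rewrite -exprMn xy expr1n. Qed.

Lemma isunitN x : isunit x -> isunit (- x).
Proof. by case=> y xy; exists (- y); rewrite mulrNN. Qed.

Lemma isunit_inj x y z : isunit x -> x * y = x * z -> y = z.
Proof.
case=> x' xx' E; rewrite -[y]mul1r -[z]mul1r -xx' [x * x']mulrC -!mulrA.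
by rewrite E.
Qed.

Lemma minv1 : minv (1 : A) = 1.
Proof. by apply: inv_unique; rewrite mulr1. Qed.

Lemma minvM x y : isunit x -> isunit y -> minv (x * y) = minv x * minv y.
Proof. by move=> /isunitP ux /isunitP uy; apply: inv_unique; rewrite mulrACA ux uy mulr1. Qed.

Lemma minv_prod (I : Type) (r : seq I) (F : I -> A) :
  (forall i, isunit (F i)) -> minv (\prod_(i <- r) F i) = \prod_(i <- r) minv (F i).
Proof.
move=> H; elim: r => [|i r IHr]; first by rewrite !big_nil minv1.
by rewrite !big_cons minvM ?IHr //; apply: isunit_prod.
Qed.

Lemma qpochS (q : A) n : qpoch q n.+1 = qpoch q n * (1 - q ^+ n.+1).
Proof. by rewrite /qpoch big_nat_recr. Qed.

(* The partial sums of the alternating q-binomial sum telescope. *)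
Lemma qbinom_partial (q : A) s n : (forall i, isunit (qpoch q i)) ->
  qpoch q n * \sum_(f < n.+1) minv (qpoch q f) * \prod_(l < f) (q ^+ s - q ^+ l) =
    \prod_(l < n) (q ^+ s - q ^+ l.+1).
Proof.
move=> uq; elim: n => [|n IHn].
  by rewrite big_ord1 !big_ord0 mulr1 isunitP.
rewrite big_ord_recr mulrDr {1}qpochS mulrAC IHn /= mulrA isunitP // mul1r.
rewrite [X in _ + X]big_ord_recl [RHS]big_ord_recr /= [X in _ + X]mulrC -mulrDr.
by congr (_ * _); rewrite expr0 addrC addrA subrK.
Qed.

(** The telescoped product contains the factor with l + 1 = s, which is 0. Terms with f > s vanish,
    so the bound [n] may exceed [s]. *)
Lemma qbinom_sum0 (q : A) s n : (forall i, isunit (qpoch q i)) -> (0 < s <= n)%N ->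
  \sum_(f < n.+1) minv (qpoch q f) * \prod_(l < f) (q ^+ s - q ^+ l) = 0.
Proof.
move=> uq /andP[s0 sn]; apply: (isunit_inj (uq n)); rewrite qbinom_partial // mulr0.
have lts : (s.-1 < n)%N by rewrite prednK.
by rewrite (bigD1 (Ordinal lts)) //= prednK // subrr mul0r.
Qed.
End Units.

Section MotivicUnits.
Variable k : closedFieldType.
Local Notation L := (LL k).

Lemma isunit_LL : isunit L.
Proof. by exists (minv L); apply: LL_inv. Qed.

Lemma isunit_1subL i : (0 < i)%N -> isunit (1 - L ^+ i).
Proof.
move=> i0; have [y yE] := @to_loc_inv _ (@mot_den k) (1 - K0_L k ^+ i)
  (or_intror (ex_intro2 _ _ i i0 erefl)).
by exists y; rewrite -[RHS]yE rmorphB rmorph1 rmorphXn.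
Qed.

Lemma isunit_qpoch n : isunit (qpoch L n).
Proof.
rewrite /qpoch big_nat_cond; apply: isunit_prod => i /andP[/andP[i1 _] _].
exact: isunit_1subL.
Qed.

Lemma isunit_subL n l : (l < n)%N -> isunit (L ^+ n - L ^+ l).
Proof.
move=> ln; rewrite -(subnK (ltnW ln)) exprD -[X in _ - X]mul1r -mulrBl.
apply: isunitM; last exact/isunitX/isunit_LL.
by rewrite -opprB; apply/isunitN/isunit_1subL; rewrite subn_gt0.
Qed.

Definition gl_class n : Mot k := \prod_(l < n) (L ^+ n - L ^+ l).

Lemma isunit_gl_class n : isunit (gl_class n).
Proof. by apply: isunit_prod => l _; apply: isunit_subL. Qed.

(** This counts the completions of f independent rows to a frame of size e + f. The factor L^(f e)
    is the one that cancels the vertex part of the Euler form. *)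
Lemma gl_class_shift e f :
  \prod_(l < e) (L ^+ (e + f) - L ^+ (f + l)) = L ^+ (f * e) * gl_class e.
Proof.
have -> : L ^+ (f * e) = \prod_(l < e) L ^+ f.
  by rewrite prodr_const card_ord exprM.
rewrite -big_split /=.
by apply: eq_bigr => l _; rewrite mulrBr -!exprD addnC.
Qed.

Section GL.
Variables (I : finType) (d : I -> nat).

Definition gl_set : set (mxfam k d d) := [set g | forall i, g i \in unitmx].

Lemma lc_gl : lc gl_set.
Proof.
have := lc_neq01 (lcT (mxfam_cspace k d d)) (_ : rfun setT (fun g : mxfam k d d => \prod_i \det (g i))).
have -> : [set x : mxfam k d d | [set: mxfam k d d] x /\ \prod_i \det (x i) != 0] = gl_set.
  apply/seteqP; split=> g /=.
    by move=> [_ /prodf_neq0 H] i; rewrite unitmxE unitfE; apply: H.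
  by move=> H; split=> //; apply/prodf_neq0 => i _; rewrite -unitfE -unitmxE; apply: H.
apply; apply: rfun_prod => i; apply: rfun_det.
exact: (rmx_fam (phi := id)) (rmap_id _).
Qed.

(** The group is the space of frames with f = 0 over a point, here the space of 0 x 0 matrices. *)
Lemma cl_gl : cl gl_set = \prod_i gl_class (d i).
Proof.
pose K i : 'M[k]_(0, 0) -> 'M[k]_(d i, 0) := fun=> 0.
have efd i : (d i + 0 = d i)%N by rewrite addn0.
have := @cl_frames k (mx_cspace k 0 0) setT I d d (fun=> 0%N) (fun=> 0%N) (fun=> 0%N)
  (fun i => frame_of k (efd i)) K efd (lcT _) (fun i => rmx_cst _ _)
  (fun i x _ => mxrank0 _ _ _).
rewrite cl_setT /= mul1r => E.
transitivity (cl (@setT (mx_cspace k 0 0)) * cl gl_set).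
  by rewrite cl_setT /= mul1r.
rewrite -(cl_prod (lcT _) lc_gl).
transitivity (cl [set z : 'M[k]_(0, 0) * mxfam k d d | [set: 'M[k]_(0, 0)] z.1 /\ forall i,
  z.2 i \in unitmx /\ fr_K (frame_of k (efd i)) *m z.2 i *m K i z.1 = 0]).
  congr cl; apply/seteqP; split=> z [_ H]; split=> // i; last by have [] := H i.
  by split; [apply: H|rewrite mulmx0].
rewrite E; apply: eq_bigr => i _; rewrite big_ord0 mul1r.
by apply: eq_bigr => l _; rewrite add0n.
Qed.
End GL.
End MotivicUnits.

(** * Nilpotent representations *)

(** Sylvester's determinant identity. That [m] and [n] may differ is what allows a representation to
    be compared with a block of smaller dimension. *)
Lemma det_1sub_mulmx (R : comPzRingType) m n (A : 'M[R]_(m, n)) (B : 'M[R]_(n, m)) :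
  \det (1%:M - A *m B) = \det (1%:M - B *m A).
Proof.
have E : block_mx (1%:M - A *m B) A 0 1%:M *m block_mx 1%:M 0 B 1%:M =
         block_mx 1%:M 0 B 1%:M *m block_mx 1%:M A 0 (1%:M - B *m A).
  rewrite !mulmx_block !mulmx1 !mul1mx !mul0mx !mulmx0 !addr0 !add0r subrK.
  by rewrite addrC subrK.
move/(congr1 (@determinant _ _)): E; rewrite !det_mulmx.
by rewrite det_ublock det_lblock det_ublock !det1 !mulr1 !mul1r.
Qed.

Section Nilpotency.
Variables (k : closedFieldType) (Q : quiver).

Definition rep (d : dimvec Q) : Type :=
  mxfam k (fun a : arrow Q => d (target a)) (fun a => d (source a)).

(** As [w] may be scaled, this says that every element of the nonunital algebra spanned by the words
    has a power of the variable as characteristic polynomial, that is, is nilpotent. *)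
Definition wnil (d : dimvec Q) (M : rep d) : Prop :=
  forall w, \det (1%:M - weval M w) = 1.

Section Embeddings.
Variable d : dimvec Q.

Definition total_dim : nat := #|({i : vertex Q & 'I_(d i)} : finType)|.

(** The formula of the local matrix [P] behind [weval], so that [PPt], [PPt0] and [PtP] transfer by
    conversion. *)
Definition vemb (i : vertex Q) : 'M[k]_(d i, total_dim) :=
  \matrix_(r, t) (t == enum_rank (Tagged (fun i => 'I_(d i)) r))%:R.

Lemma vemb_tr i : vemb i *m (vemb i)^T = 1%:M.
Proof. exact: PPt. Qed.

Lemma vemb_tr0 i j : i != j -> vemb i *m (vemb j)^T = 0.
Proof. exact: PPt0. Qed.

Lemma sum_vemb : \sum_i (vemb i)^T *m vemb i = 1%:M.
Proof. exact: PtP. Qed.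

Lemma wevalE (M : rep d) a :
  weval M (Arr k a) = (vemb (target a))^T *m M a *m vemb (source a).
Proof. by []. Qed.

Lemma rep_pt_rep_mx (M : rep d) : rep_mx d (rep_pt M) = M.
Proof. by apply: functional_extensionality_dep => a; rewrite rep_ptK. Qed.

Lemma nullset_wnil (M : rep d) : nullset d (rep_pt M) <-> wnil M.
Proof.
split=> [/nullset_nilset H w|H].
  by have := H w; rewrite /= rep_pt_rep_mx.
apply/(nullsetP (size_rep_pt M)); rewrite rep_pt_rep_mx.
(* The row vectors killed by all arrows: the degeneration to 0 in [nilset_orbit] starts from this
   subspace and enlarges it. *)
have [S SP] : exists S : 'M[k]_total_dim, forall u : 'rV_total_dim,
    (forall a, u *m weval M (Arr k a) = 0) <-> (u <= S)%MS.
  apply: linear_rowspace => [a|c u v Hu Hv a]; first exact: mul0mx.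
  by rewrite mulmxDl -scalemxAl Hu Hv scaler0 addr0.
exact: nilset_orbit H SP (leqnn _).
Qed.

Lemma wnil_gact (g : forall i, 'M[k]_(d i)) (M : rep d) :
  (forall i, g i \in unitmx) -> wnil (gact g M) <-> wnil M.
Proof.
by move=> gU; split=> H w; have := H w; have /= -> := wdet_gact M w gU.
Qed.

(* Row vectors killed by [cok_mx i M] are the linear forms on the space at [i]
   that vanish on the images of all arrows ending at [i]. *)
Definition cok_mx i (M : rep d) : 'M[k]_(d i, #|{: arrow Q * 'I_total_dim}|) :=
  \matrix_(r, c) (vemb i *m weval M (Arr k (enum_val c).1)) r (enum_val c).2.

Lemma mul_cok_mx n i (A : 'M[k]_(n, d i)) (M : rep d) :
  A *m cok_mx i M = 0 <-> forall a, A *m vemb i *m weval M (Arr k a) = 0.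
Proof.
have E r a t : (A *m cok_mx i M) r (enum_rank (a, t)) =
    (A *m vemb i *m weval M (Arr k a)) r t.
  by rewrite -mulmxA !mxE; apply: eq_bigr => s _; rewrite !mxE enum_rankK.
split=> H; first by move=> a; apply/matrixP => r t; rewrite -E H !mxE.
apply/matrixP => r c; rewrite -[c]enum_valK; case: (enum_val c) => a t.
by rewrite E H !mxE.
Qed.

Lemma mul_cok_target n (A : forall i, 'M[k]_(n i, d i)) (M : rep d) :
  (forall i, A i *m cok_mx i M = 0) <-> forall a, A (target a) *m M a = 0.
Proof.
split=> [H a|H i].
  have /mul_cok_mx/(_ a) := H (target a).
  rewrite wevalE !mulmxA -(mulmxA (A _)) vemb_tr mulmx1 => E.
  by rewrite -[LHS]mulmx1 -(vemb_tr (source a)) mulmxA E mul0mx.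
apply/mul_cok_mx => a; rewrite wevalE !mulmxA.
have [->|ne] := eqVneq i (target a).
  by rewrite -(mulmxA (A _)) vemb_tr mulmx1 H mul0mx.
by rewrite -(mulmxA (A _)) vemb_tr0 // mulmx0 !mul0mx.
Qed.

(** [nil_step] for the zero subspace yields a nonzero row vector killed by all arrows; a nonzero
    component of it is a linear form in the left kernel of the corresponding [cok_mx]. *)
Lemma wnil_cok_rank (M : rep d) : wnil M -> d != 0 ->
  exists i, (\rank (cok_mx i M) < d i)%N.
Proof.
move=> nM d0.
have [||w [w0 wM]] := @nil_step _ _ _ M (0 : 'M_total_dim) nM.
- by move=> a; rewrite mul0mx sub0mx.
- rewrite mxrank0; have [i di] : exists i, d i != 0%N.
    apply: contrapT => /forallNP H; case/negP: d0; apply/eqP/ffunP => i.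
    by have /negP := H i; rewrite negbK ffunE => /eqP.
  have lt0 : (0 < d i)%N by rewrite lt0n.
  apply/card_gt0P; by exists (Tagged (fun i => 'I_(d i)) (Ordinal lt0)).
have [i wi] : exists i, w *m (vemb i)^T != 0.
  apply: contrapT => /forallNP H; case/negP: w0.
  rewrite submx0 -[w]mulmx1 -sum_vemb mulmx_sumr big1 // => i _.
  by rewrite mulmxA; have /negP := H i; rewrite negbK => /eqP ->; rewrite mul0mx.
exists i; rewrite ltn_neqAle rank_leq_row andbT; apply: contra wi => rK.
apply/eqP; have fK : row_free (cok_mx i M) by [].
apply: (row_free_inj fK); rewrite mul0mx; apply/mul_cok_mx => a.
rewrite wevalE !mulmxA; have [->|ne] := eqVneq i (target a).
  rewrite -[_ *m _ *m (vemb (target a))^T]mulmxA vemb_tr mulmx1.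
  by have := wM a; rewrite submx0 !mulmxA => /eqP.
by rewrite -[_ *m _ *m (vemb (target a))^T]mulmxA vemb_tr0 // mulmx0 !mul0mx.
Qed.

End Embeddings.

Section Blocks.
Variables (d e f : dimvec Q) (S : forall i, frame k (e i) (f i) (d i)).

Definition sub_rep (M : rep d) : rep e :=
  fun a => fr_J (S (target a)) *m M a *m fr_J' (S (source a)).

(** All arrows land in the e-part, so J' J w = w for each word value w of [M]. The block has word
    values J w J', and det(1 - J w J') = det(1 - J' J w) = det(1 - w). *)
Lemma wnil_sub_rep (M : rep d) : (forall a, fr_K (S (target a)) *m M a = 0) ->
  wnil M <-> wnil (sub_rep M).
Proof.
move=> KM.
pose J := \sum_i (vemb e i)^T *m fr_J (S i) *m vemb d i.
pose J' := \sum_i (vemb d i)^T *m fr_J' (S i) *m vemb e i.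
have Jt i : J *m (vemb d i)^T = (vemb e i)^T *m fr_J (S i).
  rewrite mulmx_suml (bigD1 i) //= -!mulmxA vemb_tr mulmx1 big1 ?addr0 // => j ji.
  by rewrite -!mulmxA vemb_tr0 // !mulmx0.
have Jt' i : J' *m (vemb e i)^T = (vemb d i)^T *m fr_J' (S i).
  rewrite mulmx_suml (bigD1 i) //= -!mulmxA vemb_tr mulmx1 big1 ?addr0 // => j ji.
  by rewrite -!mulmxA vemb_tr0 // !mulmx0.
have vJ' i : vemb d i *m J' = fr_J' (S i) *m vemb e i.
  rewrite mulmx_sumr (bigD1 i) //= !mulmxA vemb_tr mul1mx big1 ?addr0 // => j ji.
  by rewrite !mulmxA vemb_tr0 1?eq_sym // !mul0mx.
have JJM w : J' *m J *m weval M w = weval M w.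
  elim: w => [a|v IHv w IHw|v IHv w IHw|c w IHw].
  - rewrite wevalE !mulmxA -(mulmxA J' J) Jt !mulmxA Jt' -!mulmxA.
    congr (_ *m _); rewrite !mulmxA; congr (_ *m _).
    rewrite -[RHS]mul1mx -(fr_1 (S (target a))) mulmxDl -[X in _ + X]mulmxA KM.
    by rewrite mulmx0 addr0.
  - by rewrite /= mulmxDr IHv IHw.
  - by rewrite /= mulmxA IHv.
  - by rewrite /= -scalemxAr IHw.
have JMJ w : weval (sub_rep M) w = J *m weval M w *m J'.
  elim: w => [a|v IHv w IHw|v IHv w IHw|c w IHw].
  - by rewrite !wevalE !mulmxA Jt -!mulmxA vJ' /sub_rep !mulmxA.
  - by rewrite /= IHv IHw mulmxDr mulmxDl.
  - by rewrite /= IHv IHw -!mulmxA [J' *m (J *m _)]mulmxA [J' *m J *m (_ *m _)]mulmxA JJM.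
  - by rewrite /= IHw -scalemxAr -scalemxAl.
have detE w : \det (1%:M - weval (sub_rep M) w) = \det (1%:M - weval M w).
  by rewrite JMJ det_1sub_mulmx mulmxA JJM.
by split=> H w; have := H w; rewrite detE.
Qed.
End Blocks.
End Nilpotency.

(** * Classes of nullcones *)

Section Nullcones.
Variables (k : closedFieldType) (Q : quiver).
Local Notation L := (LL k).

Lemma iso_sub_eq (X : space k) (U V : set (seq k)) :
  (forall x, X x -> U x <-> V x) -> isomorphic (sub X U) (sub X V).
Proof.
move=> UV; exists id, id; split=> //; apply: morphism_sub.
- exact: morphism_incl.
- by move=> x [Xx] /(UV _ Xx).
- exact: morphism_incl.
- by move=> x [Xx] /(UV _ Xx).
Qed.

Section Classes.
Variable d : dimvec Q.

Definition nil_set : set (rep k d) := [set M | wnil M].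

Lemma nil_setE x : size x = rep_dim d -> nullset d x <-> nil_set (rep_mx d x).
Proof. by move=> sx; rewrite -{1}(rep_mxK sx); apply: nullset_wnil. Qed.

Lemma lc_nil_set : lc nil_set.
Proof.
have [S Sp SE] := @nullset_closed k Q d.
exists S, unit, (fun _ _ => 1); split=> //; first by move=> _; apply: polyfun_cst.
move=> M; have sM := size_rep_pt M.
have -> : nil_set M <-> nullset d (rep_pt M) by split=> /nullset_wnil.
split=> [nM|[H _]].
  split; last by exists tt; apply: oner_neq0.
  move=> p Sp'; apply: contrapT => /eqP pM.
  have : (rep_space k d `\` nullset d) (rep_pt M) by rewrite SE; split=> //; exists p.
  by case.
apply: contrapT => nM.
have : (rep_space k d `\` nullset d) (rep_pt M) by split.
by rewrite SE => -[_ [p Sp']]; rewrite H ?eqxx.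
Qed.

Lemma motive_nullcone : motive (nullcone k d) = cl nil_set.
Proof.
apply/esym/clE; first exact: lc_nil_set.
by apply: iso_sub_eq => x sx; apply: nil_setE.
Qed.

Lemma motive_GL : motive (GL_variety k d) = \prod_i gl_class k (d i).
Proof.
rewrite -cl_gl; apply/esym/clE; first exact: lc_gl.
apply: iso_sub_eq => x sx; split; first by move=> [_ /gl_detE].
by move=> H; split=> //; apply/gl_detE.
Qed.

Lemma rmx_weval (W : set (rep k d)) a : rmx W (fun M => weval M (Arr k a)).
Proof.
apply: rmxM; last exact: rmx_cst.
apply: rmxM; first exact: rmx_cst.
exact: (rmx_fam (phi := id)) (rmap_id _).
Qed.

Lemma rmx_cok_mx (W : set (rep k d)) i : rmx W (@cok_mx k Q d i).
Proof.
move=> r c; pose w (M : rep k d) := vemb k d i *m weval M (Arr k (enum_val c).1).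
have rw : rmx W w by apply: rmxM; [apply: rmx_cst|apply: rmx_weval].
by apply: rfun_ext (rw r (enum_val c).2) => M _; rewrite mxE.
Qed.

End Classes.

(* Conjugating by the frame [g] puts [M] in the block form [A B; 0 0] with [A]
   nilpotent of dimension [e] and [B] arbitrary. *)
Lemma cl_nil_frames (d e f : dimvec Q) (S : forall i, frame k (e i) (f i) (d i)) :
  lc [set z : rep k d * mxfam k d d | wnil z.1 /\ forall i, z.2 i \in unitmx /\
        fr_K (S i) *m z.2 i *m cok_mx i z.1 = 0] ->
  cl [set z : rep k d * mxfam k d d | wnil z.1 /\ forall i, z.2 i \in unitmx /\
        fr_K (S i) *m z.2 i *m cok_mx i z.1 = 0] =
  cl (@gl_set k _ d) * (cl (@nil_set e) * L ^+ (\sum_a e (target a) * f (source a))%N).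
Proof.
set Y := [set z | _] => lY.
pose hom := mxfam k (fun a : arrow Q => e (target a)) (fun a => f (source a)).
pose B := mxfam_cspace k (fun a : arrow Q => e (target a)) (fun a => f (source a)).
have -> : (\sum_a e (target a) * f (source a))%N = cdim B by rewrite cdim_mxfam.
rewrite -(cl_prodT B (lc_nil_set e)).
have lZ : lc [set z : rep k e * hom | @nil_set e z.1] := lc_fst (lc_nil_set e).
rewrite -(cl_prod (lc_gl k d) lZ).
pose phi (z : rep k d * mxfam k d d) : mxfam k d d * (rep k e * hom) :=
  (z.2, (sub_rep S (gact z.2 z.1),
         fun a => fr_J (S (target a)) *m gact z.2 z.1 a *m fr_K' (S (source a)))).
pose join (z : mxfam k d d * (rep k e * hom)) : rep k d := fun a =>
  fr_J' (S (target a)) *m (z.2.1 a *m fr_J (S (source a)) +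
                           z.2.2 a *m fr_K (S (source a))).
pose psi (z : mxfam k d d * (rep k e * hom)) : rep k d * mxfam k d d :=
  (gact (fun i => invmx (z.1 i)) (join z), z.1).
have gU (z : rep k d * mxfam k d d) : Y z -> forall i, z.2 i \in unitmx.
  by move=> [_ H] i; have [] := H i.
have r1 a : rmx Y (fun z => z.1 a) by apply: (rmx_fam (phi := fst)) (rmap_fst _).
have r2 i : rmx Y (fun z => z.2 i) by apply: (rmx_fam (phi := snd)) (rmap_snd _).
have rg a : rmx Y (fun z => gact z.2 z.1 a).
  apply: rmxM; first by apply: rmxM.
  by apply: rmx_inv => // z /gU.
(* For the conjugated representation the frame condition says that the lower blocks vanish; the
   invertible matrix at the source of each arrow can be cancelled. *)
have KY (z : rep k d * mxfam k d d) : (forall i, z.2 i \in unitmx) ->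
    (forall i, fr_K (S i) *m z.2 i *m cok_mx i z.1 = 0) <->
    forall a, fr_K (S (target a)) *m gact z.2 z.1 a = 0.
  move=> zU; rewrite (mul_cok_target (fun i => fr_K (S i) *m z.2 i)).
  split=> H a; rewrite /gact; first by rewrite !mulmxA H mul0mx.
  have := congr1 (mulmx^~ (z.2 (source a))) (H a).
  by rewrite /gact /= !mulmxA mulmxKV ?mul0mx.
apply: (@cl_iso _ _ _ _ _ phi psi) => //.
- exact: (lcI (lc_fst (lc_gl k d)) (lc_preim (rmap_snd _) lZ)).
- apply: rmap_pair; first exact: rmap_snd.
  apply: rmap_pair; apply/rmap_famP => a; apply: rmxM; try exact: rmx_cst;
    by apply: rmxM => //; apply: rmx_cst.
- set Z := [set z | _]; have rZ i : rmx Z (fun z => z.1 i).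
    exact: (rmx_fam (phi := fst)) (rmap_fst _).
  apply: rmap_pair; last exact: rmap_fst.
  apply/rmap_famP => a; apply: rmxM; last first.
    apply: (@rmx_ext _ _ _ _ _ _
      (fun z : mxfam k d d * (rep k e * hom) => z.1 (source a))) => // z [zU _].
    exact: invmxK.
  apply: rmxM; first by apply: rmx_inv => // z [zU _]; apply: zU.
  apply: rmxM; first exact: rmx_cst.
  have rs : rmap Z (fun z => z.2) by apply: rmap_snd.
  apply: rmxD; apply: rmxM; try exact: rmx_cst.
    apply: (rmx_fam (phi := fun z : mxfam k d d * (rep k e * hom) => z.2.1)).
    by apply: (rmap_comp rs (W' := setT)) => //; apply: rmap_fst.
  apply: (rmx_fam (phi := fun z : mxfam k d d * (rep k e * hom) => z.2.2)).
  by apply: (rmap_comp rs (W' := setT)) => //; apply: rmap_snd.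
- move=> [M g] Yz; have gu := gU _ Yz; have [/= nM H] := Yz.
  have KM := (KY (M, g) gu).1 (fun i => (H i).2).
  split; first split=> //=.
    by apply/(wnil_sub_rep KM)/wnil_gact.
  rewrite /psi /phi /=; congr pair; apply: functional_extensionality_dep => a.
  have -> : join (g, (sub_rep S (gact g M), fun a => fr_J (S (target a)) *m gact g M a
      *m fr_K' (S (source a)))) = gact g M.
    apply: functional_extensionality_dep => b; rewrite /join /= /sub_rep.
    rewrite -!(mulmxA (fr_J _ *m _)) -mulmxDr fr_1 mulmx1 mulmxA.
    rewrite -[RHS]mul1mx -(fr_1 (S (target b))) mulmxDl -[X in _ = _ + X]mulmxA KM.
    by rewrite mulmx0 addr0.
  by rewrite /gact invmxK !mulmxA mulVmx ?mul1mx ?mulmxKV.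
- move=> [g [A C]] [/= gu nA].
  have gj a : gact g (gact (fun i => invmx (g i)) (join (g, (A, C)))) a =
      join (g, (A, C)) a.
    by rewrite /gact invmxK !mulmxA mulmxV ?mul1mx ?mulmxK.
  have Kj a : fr_K (S (target a)) *m join (g, (A, C)) a = 0.
    by rewrite /join /= mulmxA fr_KJ mul0mx.
  have Jj a : fr_J (S (target a)) *m join (g, (A, C)) a =
      A a *m fr_J (S (source a)) + C a *m fr_K (S (source a)).
    by rewrite /join /= mulmxA fr_JJ mul1mx.
  have subj : sub_rep S (join (g, (A, C))) = A.
    apply: functional_extensionality_dep => a; rewrite /sub_rep Jj mulmxDl -!mulmxA.
    by rewrite fr_JJ fr_KJ mulmx0 mulmx1 addr0.
  have gE : gact g (gact (fun i => invmx (g i)) (join (g, (A, C)))) = join (g, (A, C)).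
    exact: functional_extensionality_dep.
  split; last first.
    rewrite /phi /psi /= gE subj; congr (_, (_, _)).
    apply: functional_extensionality_dep => a; rewrite Jj mulmxDl -!mulmxA.
    by rewrite fr_JK fr_KK mulmx0 mulmx1 add0r.
  split=> /=.
    apply/wnil_gact; first by move=> i; rewrite unitmx_inv.
    by apply/(wnil_sub_rep Kj); rewrite subj.
  move=> i; split; first exact: gu.
  by move: i; apply/(KY (_, g)) => //= a; rewrite gE Kj.
Qed.

End Nullcones.

(** * The product of the two series *)

(** The functions are the minors of all sizes of all [K i], packed in the finite type [J]. On a
    piece where each is zero or nowhere zero, a minor invertible at one point is invertible at every
    other, so the ranks agree. *)
Lemma devissage_rank (k : closedFieldType) (T : cspace k) (W0 : set T)
    (I : finType) (n m : I -> nat) (K : forall i, T -> 'M[k]_(n i, m i))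
    (Phi : set T -> Mot k) :
  lc W0 -> (forall i, rmx W0 (K i)) ->
  (forall W h, W `<=` W0 -> lc W -> rfun W h ->
    Phi W = Phi [set x | W x /\ h x = 0] + Phi [set x | W x /\ h x != 0]) ->
  (forall W (r : I -> nat), W `<=` W0 -> lc W ->
    (forall i x, W x -> \rank (K i x) = r i) -> Phi W = 0) ->
  Phi W0 = 0.
Proof.
move=> lW0 rK add van.
pose J : finType := {i : I & {r : 'I_(n i).+1 &
  ({ffun 'I_r -> 'I_(n i)} * {ffun 'I_r -> 'I_(m i)})%type}}.
apply: (@devissage _ T W0 J (fun j x =>
  \det (mxsub (tagged (tagged j)).1 (tagged (tagged j)).2 (K (tag j) x)))) => //.
  by move=> j; apply/rfun_det/rmx_mxsub/rK.
move=> W WW0 lW const.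
have le i x y : W x -> W y -> (\rank (K i x) <= \rank (K i y))%N.
  move=> Wx Wy; have [f [g u]] := unit_minor (erefl (\rank (K i x))).
  have lt : (\rank (K i x) < (n i).+1)%N by rewrite ltnS rank_leq_row.
  have [H|H] := const (Tagged _ (Tagged (fun r : 'I_(n i).+1 =>
    ({ffun 'I_r -> 'I_(n i)} * {ffun 'I_r -> 'I_(m i)})%type) (i := Ordinal lt) (f, g))).
    by move: u; rewrite unitmxE unitfE; have /= -> := H x Wx; rewrite eqxx.
  by apply: (@minor_rank _ _ _ _ _ f g); rewrite unitmxE unitfE; have /= := H y Wy.
have [[x0 Wx0]|nW] := pselect (exists x, W x).
  apply: (van W (fun i => \rank (K i x0))) => // i x Wx.
  by apply/eqP; rewrite eqn_leq !le.
apply: (van W (fun=> 0%N)) => // i x Wx; exfalso; apply: nW; by exists x.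
Qed.

Section Series.
Variables (k : closedFieldType) (Q : quiver).
Local Notation L := (LL k).

(** A splitting is determined by its first part, whose component at each vertex is an arbitrary f <=
    d i; distributivity then exchanges sum and product. *)
Lemma sum_splittings (A : comPzRingType) (d : dimvec Q) (a : vertex Q -> nat -> A) :
  \sum_(p <- splittings d) \prod_i a i (p.1 i) =
  \prod_i \sum_(f < (d i).+1) a i f.
Proof.
pose m := (\max_i d i).+1.
have dm i : ((d i).+1 <= m)%N by rewrite ltnS; apply: leq_bigmax.
(* Distributivity needs one index type for all vertices, hence the common bound [m], the one used in
   [splittings]. *)
under [RHS]eq_bigr => i _ do rewrite (big_ord_widen m (a i) (dm i)).
rewrite (bigA_distr_big_dep (fun i (j : 'I_m) => (j < (d i).+1)%N)) /=.
set P := family _.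
transitivity (\sum_(e <- [seq dimvec_of_ord u | u <- enum P]) \prod_i a i (e i)).
  rewrite -(big_map (fun p => p.1) xpredT (fun e : dimvec Q => \prod_i a i (e i))).
  apply: perm_big; apply: uniq_perm.
  - rewrite map_inj_in_uniq ?splittings_uniq // => -[e e'] [f f'].
    rewrite !mem_splittings /= => /eqP ed /eqP fd ef; congr pair => //.
    rewrite -ed ef in fd; apply/ffunP => i; move/ffunP/(_ i): fd.
    by rewrite !ffunE => /addnI.
  - rewrite map_inj_uniq ?enum_uniq // => u v /ffunP uv.
    by apply/ffunP => i; apply: val_inj; have := uv i; rewrite !ffunE.
  - move=> e; apply/mapP/mapP => [[p]|[u]].
      rewrite mem_splittings => /eqP pd ->.
      have lt i : (p.1 i < (d i).+1)%N by rewrite ltnS -pd ffunE leq_addr.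
      exists [ffun i => Ordinal (leq_trans (lt i) (dm i))].
        by rewrite mem_enum; apply/familyP => i; rewrite ffunE; apply: lt.
      by apply/ffunP => i; rewrite !ffunE.
    rewrite mem_enum => /familyP uP ->.
    exists (dimvec_of_ord u, [ffun i => d i - u i]%N) => //.
    rewrite mem_splittings; apply/eqP/ffunP => i /=; rewrite !ffunE.
    by apply: subnKC; rewrite -ltnS; apply: uP.
rewrite big_map big_enum; apply: eq_bigr => u _.
by apply: eq_bigr => i _; rewrite ffunE.
Qed.

Lemma zexp_euler (d e : dimvec Q) : zexp L (- euler d e) =
  L ^+ (\sum_a d (source a) * e (target a))%N * minv L ^+ (\sum_i d i * e i)%N.
Proof.
have zexpN n : zexp L (- n%:Z) = minv L ^+ n by case: n => [|n] //=; rewrite ?expr0.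
have sumZ (I : finType) (F : I -> nat) : \sum_i (F i)%:Z = (\sum_i F i)%N%:Z.
  by rewrite (big_morph Posz PoszD (erefl _)).
by rewrite /euler opprB !sumZ zexpD ?LL_inv // zexpN.
Qed.

(* The set whose class is [cl (gl_set d) * cl (nil_set p.2) * L ^+ _] when
   [p.1 + p.2 = d], and a junk value otherwise. *)
Definition flagged (d : dimvec Q) (p : dimvec Q * dimvec Q) : set (rep k d * mxfam k d d) :=
  if pselect (forall i, (p.2 i + p.1 i)%N = d i) is left H
  then [set z | wnil z.1 /\ forall i, z.2 i \in unitmx /\
         fr_K (frame_of k (H i)) *m z.2 i *m cok_mx i z.1 = 0]
  else set0.
Arguments flagged d p : clear implicits.

(** The (f, e) term without the arrow part of the power of L and without the class of the nullcone:
    these two, times [G_d], make up the class of [flagged d (f, e)]. *)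
Let coef (p : dimvec Q * dimvec Q) : Mot k :=
  minv L ^+ (\sum_i p.1 i * p.2 i)%N * minv (qpochd L p.1) *
  minv (\prod_i gl_class k (p.2 i)).

Let lc_flagged d p : lc (flagged d p).
Proof.
rewrite /flagged; case: pselect => [H|_]; last exact: lc0.
apply: (@lc_frames _ _ (@nil_set k Q d)) => //; first exact: lc_nil_set.
by move=> i; apply: rmx_cok_mx.
Qed.

(** The factor L^(f e) [GL_e] of the frames cancels the vertex part of the Euler form and 1/[GL_e],
    leaving the q-binomial summand for s = d_i - r_i. *)
Let coef_frames (d : dimvec Q) (r : vertex Q -> nat) p : p.1 + p.2 = d ->
  coef p * \prod_i (\prod_(l < p.1 i) (L ^+ (d i - r i) - L ^+ l) *
                    \prod_(l < p.2 i) (L ^+ d i - L ^+ (p.1 i + l))) =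
  \prod_i (minv (qpoch L (p.1 i)) * \prod_(l < p.1 i) (L ^+ (d i - r i) - L ^+ l)).
Proof.
move=> pd; rewrite /coef expr_sum /qpochd.
rewrite !minv_prod; [|by move=> i; apply: isunit_gl_class|by move=> i; apply: isunit_qpoch].
rewrite -!big_split /=; apply: eq_bigr => i _.
have di : d i = (p.2 i + p.1 i)%N by rewrite -pd ffunE addnC.
rewrite {2}di gl_class_shift.
set x := minv L ^+ _; set y := L ^+ (_ * _); set u := minv (gl_class _ _).
have xy : x * y = 1 by rewrite /x /y -exprMn mulrC LL_inv expr1n.
have uG : u * gl_class k (p.2 i) = 1 by rewrite mulrC; apply/isunitP/isunit_gl_class.
set v := minv (qpoch _ _); set G := \prod_(l < _) _.
rewrite [G * _]mulrC mulrA [x * v]mulrC -(mulrA v x u) -(mulrA v) mulrACA xy uG.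
by rewrite !mulr1.
Qed.

(** Multiplying by the unit [G_d] turns each term into a coefficient times the class of a space of
    pairs of a representation and a frame. *)
Lemma nullcone_sum0 (d : dimvec Q) : d != 0 ->
  \sum_(p <- splittings d) zexp L (- euler p.1 p.2) * minv (qpochd L p.1) *
     (cl (@nil_set k Q p.2) * minv (\prod_i gl_class k (p.2 i))) = 0.
Proof.
move=> d0.
have uG : isunit (cl (@gl_set k _ d)).
  by rewrite cl_gl; apply: isunit_prod => i _; apply: isunit_gl_class.
apply: (isunit_inj uG); rewrite mulr0 mulr_sumr.
(* The same sum with the representation confined to [W]. It is additive in [W], so it can be
   evaluated on pieces where each [cok_mx] has constant rank. *)
pose Phi (W : set (rep k d)) := \sum_(p <- splittings d)
  coef p * cl [set z : rep k d * mxfam k d d | W z.1 /\ flagged d p z].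
transitivity (Phi (@nil_set k Q d)).
  apply: eq_big_seq => -[f e]; rewrite mem_splittings /= => /eqP pd.
  have -> : [set z : rep k d * mxfam k d d | @nil_set k Q d z.1 /\ flagged d (f, e) z] =
      flagged d (f, e).
    apply/seteqP; split=> z; first by case.
    by move=> zf; split=> //; move: zf; rewrite /flagged; case: pselect => [?|_] // [].
  have := lc_flagged d (f, e); rewrite /flagged.
  case: pselect => [H|[]]; last by move=> i; rewrite -pd ffunE addnC.
  move=> /cl_nil_frames ->; rewrite zexp_euler /coef /=.
  under [X in L ^+ X]eq_bigr => a _ do rewrite mulnC.
  set x := cl _; set y := L ^+ _; set w := minv L ^+ _.
  set a := minv (qpochd _ _); set b := cl _; set c := minv _.
  rewrite [RHS]mulrCA -(mulrA y w a) [y * (w * a)]mulrC -!(mulrA (w * a)).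
  by rewrite [c * (b * y)]mulrC [b * y]mulrC -(mulrA y b).
apply: (@devissage_rank k (mxfam_cspace k _ _) (@nil_set k Q d) _ _ _ (@cok_mx k Q d)).
- exact: lc_nil_set.
- by move=> i; apply: rmx_cok_mx.
- move=> W h _ lW rh; rewrite /Phi -big_split /=; apply: eq_bigr => p _.
  by rewrite (cl_over_split (lc_flagged d p) lW rh) mulrDr.
move=> W r WN lW rkW; rewrite /Phi.
have [[M WM]|nW] := pselect (exists M, W M); last first.
  by rewrite big1 // => p _; rewrite cl0 ?mulr0 // => z [Wz _]; apply: nW; exists z.1.
(* One vertex with nonzero cokernel is enough: its factor annihilates the product over all
   vertices. *)
have [i ri] := wnil_cok_rank (WN _ WM) d0; rewrite (rkW i M WM) in ri.
transitivity (cl W * \sum_(p <- splittings d) \prod_i (minv (qpoch L (p.1 i)) *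
    \prod_(l < p.1 i) (L ^+ (d i - r i) - L ^+ l))).
  rewrite mulr_sumr; apply: eq_big_seq => p; rewrite mem_splittings => /eqP pd.
  rewrite -coef_frames // mulrCA; congr (_ * _); rewrite /flagged.
  case: pselect => [H|[]]; last by move=> j; rewrite -pd ffunE addnC.
  rewrite -(cl_frames (fun j => frame_of k (H j)) H lW (@rmx_cok_mx k Q d W) rkW).
  congr cl; apply/seteqP; split=> z; first by move=> [Wz [_ Hz]].
  by move=> [Wz Hz]; do !split=> //; apply: WN.
rewrite (sum_splittings d (fun i f => minv (qpoch L f) *
  \prod_(l < f) (L ^+ (d i - r i) - L ^+ l))).
rewrite (bigD1 i) //= qbinom_sum0 ?mul0r ?mulr0 //; first exact: isunit_qpoch.
by rewrite subn_gt0 ri leq_subr.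
Qed.

Lemma cl_nil_set0 : cl (@nil_set k Q 0) = 1.
Proof.
have -> : @nil_set k Q 0 = setT.
  apply/seteqP; split=> // M _ w.
  have N0 : total_dim (0 : dimvec Q) = 0%N.
    by apply/eqP/pred0P => -[i [j]] /=; rewrite ffunE.
  have -> : weval M w = 0.
    by apply/matrixP => i; have := ltn_ord i; rewrite [X in (_ < X)%N]N0.
  by rewrite subr0 det1.
rewrite cl_setT cdim_mxfam big1 // => a _; by rewrite !ffunE.
Qed.

(* A one-sided inverse of a series with constant term 1 is two-sided:
   [h * f = 0] forces [h = 0], coefficient by coefficient. *)
Lemma tw_left_inverse (f g : twps k Q) : g * f = 1 -> f 0 = 1 -> f * g = 1.
Proof.
move=> gf f0; apply/eqP; rewrite -subr_eq0; apply/eqP; set h := f * g - 1.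
have hf : h * f = 0 by rewrite mulrBl mul1r -mulrA gf mulr1 subrr.
suff H n (d : dimvec Q) : (\sum_i d i < n)%N -> h d = 0.
  by apply/funext => d; apply: (H (\sum_i d i).+1).
elim: n d => // n IHn d dn; have := congr1 (fun s : twps k Q => s d) hf.
rewrite twps_mulE big_splittingsr /= ?euler0r ?oppr0 ?expr0 ?mul1r ?f0 ?mulr1 //.
move=> p pd p0; rewrite IHn ?mulr0 ?mul0r // -ltnS (leq_trans _ dn) // ltnS -pd.
under [X in (_ < X)%N]eq_bigr => i _ do rewrite ffunE.
rewrite big_split /= -addn1 leq_add2l lt0n; apply: contraNneq p0 => /eqP.
rewrite sum_nat_eq0 => /forallP p20; apply/eqP/ffunP => i.
by have := p20 i; rewrite ffunE => /eqP.
Qed.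
End Series.

Theorem corollary3p2 (R : realType) (Q : quiver) :
  twseries (fun d : dimvec Q =>
    motive (nullcone R[i] d) * minv (motive (GL_variety R[i] d))) *
  twseries (fun d : dimvec Q => minv (qpochd (LL R[i]) d)) = 1.
Proof.
have N0 : motive (nullcone R[i] (0 : dimvec Q)) *
    minv (motive (GL_variety R[i] (0 : dimvec Q))) = 1.
  rewrite motive_nullcone motive_GL cl_nil_set0 mul1r big1 ?minv1 // => i _.
  by rewrite /gl_class ffunE big_ord0.
(* The multiplication is twisted, and [nullcone_sum0] has the series of the 1/(L)_d on the left; the
   constant term given by [N0] permits the exchange. *)
apply: tw_left_inverse => //; apply/funext => d; rewrite twps_mulE.
rewrite [RHS](_ : _ = (d == 0)%:R) //; have [->|d0] := eqVneq d 0.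
  rewrite big_splittingsr => [|p /ffunP p0 /eqP []]; last first.
    by apply/ffunP => i; have := p0 i; rewrite !ffunE => /eqP; rewrite addn_eq0 => /andP[_ /eqP].
  rewrite /twseries /= euler0l oppr0 mul1r N0 mulr1 /qpochd big1 ?minv1 // => i _.
  by rewrite ffunE /qpoch big_nil.
rewrite -[RHS](nullcone_sum0 _ d0); apply: eq_bigr => p _.
by rewrite /twseries motive_nullcone motive_GL.
Qed.
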